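(* Let $\pi:C([0,1])\to B(L^2([0,1]))$ be the *-monomorphism given by $\pi(f)=M_f$, where $M_f$ denotes the operator of multiplication by $f$. Then $$\mathcal F(\pi(C([0,1])))=\{M_f: f\in\mathcal R([0,1])\},$$ where $\mathcal R([0,1])$ denotes the set of Riemann integrable functions on $[0,1]$, and hence $\mathcal F(\pi(C([0,1])))$ is a C*-algebra.
   Context: For an operator space $V\subseteq B(\mathcal H)$, $\mathcal F(V)=\{T\in B(\mathcal H):\phi(T)=T$ for every completely contractive map $\phi:B(\mathcal H)\to B(\mathcal H)$ that is the identity on $V\}$. *)

(* Defs.v *)
From HB Require Import structures.
From mathcomp Require Import all_boot all_order all_algebra.
From mathcomp Require Import sesquilinear complex.
From mathcomp Require Import all_classical all_reals all_analysis.
From mathcomp Require Import measurable_realfun.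
From mathcomp Require Import ring lra.

Set Implicit Arguments.
Unset Strict Implicit.
Unset Printing Implicit Defensive.

Import Order.TTheory GRing.Theory Num.Theory.
Import numFieldNormedType.Exports.

Local Open Scope classical_set_scope.
Local Open Scope complex_scope.
Local Open Scope quotient_scope.
Local Open Scope ring_scope.

(* A Hilbert space is given by its inner product, linear in the first variable;
   its completeness plays no role in the definitions of this section, which are
   only used for the space L^2 below. *)
Section BoundedOperators.
Context {R : realType} {H : lmodType R[i]} (dot : {dot H for @conjc R}).

Definition hnorm (x : H) : R := Num.sqrt (complex.Re (dot x x)).

Definition bounded_operator : {pred H -> H} :=
  [pred T : H -> H | `[< linear T /\
     exists M : R, forall x, hnorm (T x) <= M * hnorm x >] ].

Lemma bounded_operatorP (T : H -> H) :
  reflect (linear T /\ exists M : R, forall x, hnorm (T x) <= M * hnorm x)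
          (T \in bounded_operator).
Proof. by rewrite inE; exact: asboolP. Qed.

Lemma Re_dotxx_ge0 x : 0 <= complex.Re (dot x x).
Proof.
by have := @dnorm_ge0 R[i] H dot x; rewrite lecE => /andP[].
Qed.

Lemma hnorm_ge0 x : 0 <= hnorm x. Proof. exact: sqrtr_ge0. Qed.

Lemma sqr_hnorm x : hnorm x ^+ 2 = complex.Re (dot x x).
Proof. by rewrite sqr_sqrtr// Re_dotxx_ge0. Qed.

Lemma hnormZ (a : R[i]) x : hnorm (a *: x) = Normc.normc a * hnorm x.
Proof.
have n0 : 0 <= Normc.normc a by case: a => ? ?; exact: sqrtr_ge0.
rewrite /hnorm (dnormZ (C := R[i])) -[X in `|X|]/a.
have -> : `|a| ^+ 2 = ((Normc.normc a) ^+ 2)%:C by rewrite rmorphXn.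
case: (dot x x) => u v /=; rewrite mul0r subr0 sqrtrM ?sqr_ge0// sqrtr_sqr.
by rewrite ger0_norm.
Qed.

Lemma hnormD x y : hnorm (x + y) ^+ 2 <= 2 * (hnorm x ^+ 2 + hnorm y ^+ 2).
Proof.
have : dot (x + y) (x + y) + dot (x - y) (x - y) =
    (dot x x + dot y y) + (dot x x + dot y y).
  rewrite (dnormD (C := R[i])) (dnormB (C := R[i])).
  by rewrite addrACA subrr addr0.
move=> /(congr1 (fun z : R[i] => complex.Re z)).
have := Re_dotxx_ge0 (x - y); rewrite !sqr_hnorm.
case: (dot _ _) => ? ?; case: (dot _ _) => ? ?; case: (dot _ _) => ? ?.
by case: (dot _ _) => ? ? /=; lra.
Qed.

Lemma bounded_operator_submod_closed : submod_closed bounded_operator.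
Proof.
split.
  apply/bounded_operatorP; split; first by move=> a x y /=; rewrite scaler0 addr0.
  exists 0 => x; rewrite mul0r le_eqVlt; apply/orP; left; apply/eqP.
  by rewrite /hnorm /= linear0l sqrtr0.
move=> a S T /bounded_operatorP[lS [M MS]] /bounded_operatorP[lT [N NT]].
apply/bounded_operatorP; split.
  move=> b x y /=; rewrite -[LHS]/(a *: S _ + T _) lS lT.
  rewrite -[RHS]/(b *: (a *: S x + T x) + (a *: S y + T y)).
  by rewrite !scalerDr !scalerA mulrC addrACA.
pose K := 2 * ((Normc.normc a * M) ^+ 2 + N ^+ 2).
have K0 : 0 <= K by rewrite mulr_ge0// addr_ge0// sqr_ge0.
exists (Num.sqrt K) => x; rewrite -[_ x]/(a *: S x + T x).
rewrite -(@ler_pXn2r _ 2)// ?nnegrE ?hnorm_ge0 ?mulr_ge0 ?sqrtr_ge0 ?hnorm_ge0//.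
apply: (le_trans (hnormD _ _)); rewrite [leRHS]exprMn (sqr_sqrtr K0) /K.
have sqr_le (u v : R) : 0 <= u -> u <= v -> u ^+ 2 <= v ^+ 2.
  by move=> u0 uv; rewrite ler_pXn2r// nnegrE// (le_trans u0).
rewrite -mulrA ler_wpM2l// mulrDl lerD//.
  rewrite -exprMn hnormZ -mulrA !(exprMn _ (Normc.normc a)) ler_wpM2l ?sqr_ge0//.
  exact: sqr_le (hnorm_ge0 _) (MS x).
by rewrite -exprMn; exact: sqr_le (hnorm_ge0 _) (NT x).
Qed.

HB.instance Definition _ := GRing.isSubmodClosed.Build _ _ bounded_operator
  bounded_operator_submod_closed.

Record bop := Bop { bop_fun :> H -> H ; _ : bop_fun \in bounded_operator }.
HB.instance Definition _ := [isSub for bop_fun].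
HB.instance Definition _ := [Choice of bop by <:].
HB.instance Definition _ := [SubChoice_isSubLmodule of bop by <:].

Lemma bop_ext (S T : bop) : S =1 T -> S = T.
Proof. by move=> ST; apply/val_inj/funext. Qed.

Lemma bop_mul_subproof (S T : bop) : (S \o T : H -> H) \in bounded_operator.
Proof.
have /bounded_operatorP[/= lS [M MS]] := valP S.
have /bounded_operatorP[/= lT [N NT]] := valP T.
apply/bounded_operatorP; split => [a x y /=|]; first by rewrite lT lS.
exists (`|M| * `|N|) => x /=; rewrite (le_trans (MS _))// -mulrA.
rewrite (@le_trans _ _ (`|M| * hnorm (T x)))//.
  by rewrite ler_wpM2r ?hnorm_ge0 ?ler_norm.
rewrite ler_wpM2l// (le_trans (NT _))//.
by rewrite ler_wpM2r ?hnorm_ge0 ?ler_norm.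
Qed.

Definition bop_mul (S T : bop) : bop := Bop (bop_mul_subproof S T).

Definition is_adjoint (T S : bop) : Prop :=
  forall x y, dot (T x) y = dot x (S y).

(* The norm of the n-fold Hilbert space direct sum H^n. *)
Definition hnormn n (x : 'I_n -> H) : R :=
  Num.sqrt (\sum_(i < n) hnorm (x i) ^+ 2).

Definition mxact n (T : 'M[bop]_n) (x : 'I_n -> H) (i : 'I_n) : H :=
  \sum_(j < n) T i j (x j).

(* The norm of M_n(B(H)), identified with B(H^n). *)
Definition mxopnorm n (T : 'M[bop]_n) : \bar R :=
  ereal_sup [set (hnormn (mxact T x))%:E | x in [set x | hnormn x <= 1]].

Definition opnorm (T : bop) : \bar R :=
  ereal_sup [set (hnorm (T x))%:E | x in [set x | hnorm x <= 1]].

Definition completely_contractive (phi : bop -> bop) : Prop :=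
  forall n (T : 'M[bop]_n), (mxopnorm (map_mx phi T) <= mxopnorm T)%E.

(* The operators fixed by every completely contractive linear map B(H) -> B(H)
   that is the identity on V; {linear _ -> _} is linearity over R[i]. *)
Definition fix_hull (V : set bop) : set bop :=
  [set T | forall phi : {linear bop -> bop},
     completely_contractive phi -> (forall S, V S -> phi S = S) -> phi T = T].

(* A C*-algebra of operators: a norm-closed *-subalgebra of B(H). *)
Record is_Cstar_algebra (A : set bop) : Prop := IsCstarAlgebra {
  Cstar0 : A 0;
  Cstar_linear : forall (a : R[i]) S T, A S -> A T -> A (a *: S + T);
  Cstar_mul : forall S T, A S -> A T -> A (bop_mul S T);
  Cstar_adjoint : forall T, A T -> exists2 S, A S & is_adjoint T S;
  Cstar_closed : forall T,
    (forall e : R, 0 < e -> exists2 S, A S & (opnorm (T - S)%R < e%:E)%E) -> A T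
}.

End BoundedOperators.
Section ComplexIntegral.
Context d (T : measurableType d) (R : realType).
Variables (mu : {measure set T -> \bar R}) (D : set T).
Implicit Types f g : T -> R[i].

Definition cmeasurable f : Prop :=
  measurable_fun D (fun x => complex.Re (f x)) /\
  measurable_fun D (fun x => complex.Im (f x)).

Definition cintegrable f : Prop :=
  mu.-integrable D (fun x => (complex.Re (f x))%:E) /\
  mu.-integrable D (fun x => (complex.Im (f x))%:E).

Definition cintegral f : R[i] :=
  (\int[mu]_(x in D) complex.Re (f x)) +i* (\int[mu]_(x in D) complex.Im (f x)).

Hypothesis mD : measurable D.

Lemma cReD (x y : R[i]) : complex.Re (x + y) = complex.Re x + complex.Re y.
Proof. by case: x y => ? ? []. Qed.

Lemma cImD (x y : R[i]) : complex.Im (x + y) = complex.Im x + complex.Im y.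
Proof. by case: x y => ? ? []. Qed.

Lemma cReM (x y : R[i]) : complex.Re (x * y) =
  complex.Re x * complex.Re y - complex.Im x * complex.Im y.
Proof. by case: x y => ? ? []. Qed.

Lemma cImM (x y : R[i]) : complex.Im (x * y) =
  complex.Re x * complex.Im y + complex.Im x * complex.Re y.
Proof. by case: x y => ? ? []. Qed.

Lemma cReJ (x : R[i]) : complex.Re x^*%C = complex.Re x.
Proof. by case: x. Qed.

Lemma cImJ (x : R[i]) : complex.Im x^*%C = - complex.Im x.
Proof. by case: x. Qed.

Lemma sqr_normcE (x : R[i]) :
  Normc.normc x ^+ 2 = complex.Re x ^+ 2 + complex.Im x ^+ 2.
Proof. by case: x => a b /=; rewrite sqr_sqrtr// addr_ge0 ?sqr_ge0. Qed.

Lemma cmeasurableD f g : cmeasurable f -> cmeasurable g -> cmeasurable (f \+ g).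
Proof.
move=> [f1 f2] [g1 g2]; split.
  by under eq_fun do rewrite /= cReD; exact: measurable_funD.
by under eq_fun do rewrite /= cImD; exact: measurable_funD.
Qed.

Lemma cmeasurableM f g : cmeasurable f -> cmeasurable g -> cmeasurable (f \* g).
Proof.
move=> [f1 f2] [g1 g2]; split.
  under eq_fun do rewrite /= cReM.
  by apply: measurable_funB; exact: measurable_funM.
under eq_fun do rewrite /= cImM.
by apply: measurable_funD; exact: measurable_funM.
Qed.

Lemma cmeasurable_cst a : cmeasurable (fun=> a).
Proof. by split; exact: measurable_cst. Qed.

Lemma cmeasurableJ f : cmeasurable f -> cmeasurable (fun x => (f x)^*%C).
Proof.
move=> [f1 f2]; split; first by under eq_fun do rewrite cReJ.
by under eq_fun do rewrite cImJ; exact: measurableT_comp.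
Qed.

Lemma measurable_sqr_normc f : cmeasurable f ->
  measurable_fun D (fun x => Normc.normc (f x) ^+ 2).
Proof.
move=> [f1 f2]; under eq_fun do rewrite sqr_normcE.
by apply: measurable_funD; exact: measurable_funX.
Qed.

Lemma cintegralD f g : cintegrable f -> cintegrable g ->
  cintegral (f \+ g) = cintegral f + cintegral g.
Proof.
move=> [f1 f2] [g1 g2]; rewrite /cintegral.
under eq_Rintegral do rewrite /= cReD.
under [in X in _ +i* X]eq_Rintegral do rewrite /= cImD.
by rewrite !RintegralD.
Qed.

Lemma cintegralZ (a : R[i]) f : cintegrable f ->
  cintegral (fun x => a * f x) = a * cintegral f.
Proof.
move=> [f1 f2]; rewrite /cintegral.
under eq_Rintegral do rewrite /= cReM.
under [in X in _ +i* X]eq_Rintegral do rewrite /= cImM.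
rewrite RintegralB//; last 2 first.
- exact: (integrableZl _ (complex.Re a) f1).
- exact: (integrableZl _ (complex.Im a) f2).
rewrite RintegralD//; last 2 first.
- exact: (integrableZl _ (complex.Re a) f2).
- exact: (integrableZl _ (complex.Im a) f1).
by rewrite !RintegralZl//; case: a.
Qed.

Lemma cintegralJ f : cintegrable f ->
  cintegral (fun x => (f x)^*%C) = (cintegral f)^*%C.
Proof.
move=> [f1 f2]; rewrite /cintegral /=.
under eq_Rintegral do rewrite cReJ.
under [in X in _ +i* X]eq_Rintegral do rewrite cImJ -mulN1r.
by rewrite RintegralZl// mulN1r.
Qed.

Lemma ae_eq_cintegral f g : cmeasurable f -> cmeasurable g ->
  ae_eq mu D f g -> cintegral f = cintegral g.
Proof.
move=> [f1 f2] [g1 g2] fg; rewrite /cintegral; congr (_ +i* _); congr fine.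
  by apply: ae_eq_integral => //; [exact/measurable_EFinP|exact/measurable_EFinP|
    exact: (ae_eq_comp (fun z => (complex.Re z)%:E) fg)].
by apply: ae_eq_integral => //; [exact/measurable_EFinP|exact/measurable_EFinP|
  exact: (ae_eq_comp (fun z => (complex.Im z)%:E) fg)].
Qed.

End ComplexIntegral.

Section L2.
Context d (T : measurableType d) (R : realType).
Variables (mu : {measure set T -> \bar R}) (D : set T) (mD : measurable D).
Implicit Types f g : T -> R[i].

Definition sq_integrable (_ : measurable D) : {pred T -> R[i]} :=
  [pred f : T -> R[i] | `[< cmeasurable D f /\
    (\int[mu]_(x in D) (Normc.normc (f x) ^+ 2)%:E < +oo)%E >] ].

Lemma sq_integrableP f :
  reflect (cmeasurable D f /\
           mu.-integrable D (fun x => (Normc.normc (f x) ^+ 2)%:E))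
          (f \in sq_integrable mD).
Proof.
have nE : (\int[mu]_(x in D) `|(Normc.normc (f x) ^+ 2)%:E| =
           \int[mu]_(x in D) (Normc.normc (f x) ^+ 2)%:E)%E.
  by apply: eq_integral => x _; rewrite gee0_abs// lee_fin sqr_ge0.
rewrite inE; apply: (iffP (asboolP _)) => -[mf foo]; split => //.
  apply/integrableP; split; last by rewrite nE.
  exact/measurable_EFinP/measurable_sqr_normc.
by rewrite -nE; case/integrableP: foo.
Qed.

Lemma sq_integrable_le f (G : T -> R) : cmeasurable D f ->
  mu.-integrable D (EFin \o G) ->
  {ae mu, forall x, D x -> Normc.normc (f x) ^+ 2 <= G x} ->
  f \in sq_integrable mD.
Proof.
move=> mf iG fG; rewrite unfold_in; apply: asboolT; split; first exact: mf.
have /integrableP[mG] := iG; apply: le_lt_trans.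
apply: ae_ge0_le_integral => //.
- by move=> x _; rewrite lee_fin sqr_ge0.
- exact/measurable_EFinP/measurable_sqr_normc.
- exact: measurableT_comp.
- apply: filterS fG => x + Dx => /(_ Dx) fG.
  by rewrite /= lee_fin (le_trans fG)// ler_norm.
Qed.

Lemma normcD_sqr (x y : R[i]) : Normc.normc (x + y) ^+ 2 <=
  2 * (Normc.normc x ^+ 2 + Normc.normc y ^+ 2).
Proof.
rewrite !sqr_normcE cReD cImD.
have := sqr_ge0 (complex.Re x - complex.Re y).
by have := sqr_ge0 (complex.Im x - complex.Im y); nra.
Qed.

Lemma sq_integrable_submod_closed : submod_closed (sq_integrable mD).
Proof.
split.
  apply: (@sq_integrable_le _ (fun=> 0)).
  - by split; exact: measurable_cst.
  - exact: integrable0.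
  - by apply: aeW => x _; rewrite sqr_normcE /= !expr0n addr0.
move=> a f g /sq_integrableP[mf sf] /sq_integrableP[mg sg].
pose G x := 2 * (Normc.normc a ^+ 2 * Normc.normc (f x) ^+ 2 +
                 Normc.normc (g x) ^+ 2).
apply: (@sq_integrable_le _ G).
- by apply: cmeasurableD => //; apply: cmeasurableM => //; exact: cmeasurable_cst.
- have h := integrableD mD (integrableZl mD (Normc.normc a ^+ 2) sf) sg.
  exact: (integrableZl mD 2 h).
- apply: aeW => x _ /=; rewrite -[_ x]/(a * f x + g x) (le_trans (normcD_sqr _ _))//.
  by rewrite Normc.normcM exprMn.
Qed.

HB.instance Definition _ := GRing.isSubmodClosed.Build _ _ (sq_integrable mD)
  sq_integrable_submod_closed.

Record L2fun := MkL2fun { L2fun_val :> T -> R[i] ; _ : L2fun_val \in sq_integrable mD }.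
HB.instance Definition _ := [isSub for L2fun_val].
HB.instance Definition _ := [Choice of L2fun by <:].
HB.instance Definition _ := [SubChoice_isSubLmodule of L2fun by <:].

Definition ae_eqb (f g : L2fun) : bool := `[< ae_eq mu D f g >].

Let ae_eqb_refl : reflexive ae_eqb.
Proof. by move=> f; exact/asboolP/ae_eq_refl. Qed.

Let ae_eqb_sym : symmetric ae_eqb.
Proof. by move=> f g; apply/asboolP/asboolP => /ae_eq_sym. Qed.

Let ae_eqb_trans : transitive ae_eqb.
Proof.
by move=> f g h /asboolP gf /asboolP fh; exact/asboolP/(ae_eq_trans gf fh).
Qed.

Canonical ae_eqb_equiv := EquivRel ae_eqb ae_eqb_refl ae_eqb_sym ae_eqb_trans.

Definition L2 : Type := {eq_quot ae_eqb}.
HB.instance Definition _ := Choice.on L2.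
HB.instance Definition _ := EqQuotient.on L2.

Definition L2class (f : L2fun) : L2 := \pi_L2 f.

Lemma L2classP (f g : L2fun) : L2class f = L2class g <-> ae_eq mu D f g.
Proof.
by split => [/eqmodP/asboolP//|fg]; apply/eqmodP/asboolP.
Qed.

Lemma L2class_repr (x : L2) : L2class (repr x) = x. Proof. exact: reprK. Qed.

Lemma repr_L2class (f : L2fun) : ae_eq mu D (repr (L2class f)) f.
Proof. by apply/L2classP; rewrite L2class_repr. Qed.

Definition L2add (x y : L2) : L2 := L2class (repr x + repr y).
Definition L2opp (x : L2) : L2 := L2class (- repr x).
Definition L2scale (a : R[i]) (x : L2) : L2 := L2class (a *: repr x).

Lemma L2addE (f g : L2fun) : L2add (L2class f) (L2class g) = L2class (f + g).
Proof.
apply/L2classP => /=; have := repr_L2class g; have := repr_L2class f.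
by apply: filterS2 => x fx gx Dx /=; rewrite -[LHS]/(_ + _) fx// gx.
Qed.

Lemma L2oppE (f : L2fun) : L2opp (L2class f) = L2class (- f).
Proof.
apply/L2classP => /=; have := repr_L2class f.
by apply: filterS => x fx Dx /=; rewrite -[LHS]/(- _) fx.
Qed.

Lemma L2scaleE (a : R[i]) (f : L2fun) : L2scale a (L2class f) = L2class (a *: f).
Proof.
apply/L2classP => /=; have := repr_L2class f.
by apply: filterS => x fx Dx /=; rewrite -[LHS]/(a *: _) fx.
Qed.

Let L2addA : associative L2add.
Proof.
move=> x y z; rewrite -(L2class_repr x) -(L2class_repr y) -(L2class_repr z).
by rewrite !L2addE addrA.
Qed.

Let L2addC : commutative L2add.
Proof. by move=> x y; rewrite /L2add addrC. Qed.

Let L2add0 : left_id (L2class 0) L2add.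
Proof. by move=> x; rewrite -(L2class_repr x) L2addE add0r. Qed.

Let L2addN : left_inverse (L2class 0) L2opp L2add.
Proof. by move=> x; rewrite -(L2class_repr x) L2oppE L2addE addNr. Qed.

HB.instance Definition _ := GRing.isZmodule.Build L2 L2addA L2addC L2add0 L2addN.

Lemma L2classD (f g : L2fun) : L2class (f + g) = L2class f + L2class g.
Proof. by rewrite -L2addE. Qed.

Let L2scaleA a b x : L2scale a (L2scale b x) = L2scale (a * b) x.
Proof. by rewrite -(L2class_repr x) !L2scaleE scalerA. Qed.

Let L2scale1 : left_id 1 L2scale.
Proof. by move=> x; rewrite -(L2class_repr x) L2scaleE scale1r. Qed.

Let L2scaleDr : right_distributive L2scale +%R.
Proof.
move=> a x y; rewrite -(L2class_repr x) -(L2class_repr y).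
by rewrite -L2classD !L2scaleE scalerDr L2classD.
Qed.

Let L2scaleDl x : {morph L2scale^~ x : a b / a + b}.
Proof.
move=> a b; rewrite -(L2class_repr x) !L2scaleE.
by rewrite scalerDl L2classD.
Qed.

HB.instance Definition _ := GRing.Zmodule_isLmodule.Build R[i] L2
  L2scaleA L2scale1 L2scaleDr L2scaleDl.

Lemma L2classZ (a : R[i]) (f : L2fun) : L2class (a *: f) = a *: L2class f.
Proof. by rewrite -L2scaleE. Qed.

(* Linear in the first argument. *)
Definition L2dot (x y : L2) : R[i] :=
  cintegral mu D (fun t => repr x t * (repr y t)^*%C).

Lemma normr_Re_mulJ_le (x y : R[i]) :
  `|complex.Re (x * y^*%C)| <= Normc.normc x ^+ 2 + Normc.normc y ^+ 2.
Proof.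
rewrite !sqr_normcE cReM cReJ cImJ.
move: (complex.Re x) (complex.Im x) (complex.Re y) (complex.Im y) => a b u v.
have := (sqr_ge0 (a - u), sqr_ge0 (a + u), sqr_ge0 (b + v), sqr_ge0 (b - v),
         sqr_ge0 a, sqr_ge0 b, sqr_ge0 u, sqr_ge0 v).
rewrite !(sqrrB, sqrrD) => -[[[[[[[]]]]]]] *.
by rewrite ler_norml; apply/andP; split; lra.
Qed.

Lemma normr_Im_mulJ_le (x y : R[i]) :
  `|complex.Im (x * y^*%C)| <= Normc.normc x ^+ 2 + Normc.normc y ^+ 2.
Proof.
rewrite !sqr_normcE cImM cReJ cImJ.
move: (complex.Re x) (complex.Im x) (complex.Re y) (complex.Im y) => a b u v.
have := (sqr_ge0 (a - v), sqr_ge0 (a + v), sqr_ge0 (b + u), sqr_ge0 (b - u),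
         sqr_ge0 a, sqr_ge0 b, sqr_ge0 u, sqr_ge0 v).
rewrite !(sqrrB, sqrrD) => -[[[[[[[]]]]]]] *.
by rewrite ler_norml; apply/andP; split; lra.
Qed.

Lemma cintegrable_dot (f g : L2fun) :
  cintegrable mu D (fun t => f t * (g t)^*%C).
Proof.
have /sq_integrableP[mf sf] := valP f; have /sq_integrableP[mg sg] := valP g.
have [mRe mIm] := cmeasurableM mf (cmeasurableJ mg).
have h := integrableD mD sf sg.
split; apply: (le_integrable mD _ _ h); try exact/measurable_EFinP.
- move=> t _; rewrite /= lee_fin [leRHS]ger0_norm ?addr_ge0 ?sqr_ge0//.
  exact: normr_Re_mulJ_le.
- move=> t _; rewrite /= lee_fin [leRHS]ger0_norm ?addr_ge0 ?sqr_ge0//.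
  exact: normr_Im_mulJ_le.
Qed.

Lemma L2dotE (f g : L2fun) : L2dot (L2class f) (L2class g) =
  cintegral mu D (fun t => f t * (g t)^*%C).
Proof.
have cm (u v : L2fun) : cmeasurable D (fun t => u t * (v t)^*%C).
  have /sq_integrableP[mu1 _] := valP u; have /sq_integrableP[mv _] := valP v.
  exact: cmeasurableM mu1 (cmeasurableJ mv).
apply: ae_eq_cintegral => //; have := repr_L2class g; have := repr_L2class f.
by apply: filterS2 => t ft gt Dt; rewrite ft// gt.
Qed.

Let L2dot_lin y : GRing.linear_for *%R (L2dot^~ y).
Proof.
move=> a x x'; rewrite -(L2class_repr x) -(L2class_repr x') -(L2class_repr y).
rewrite -L2classZ -L2classD !L2dotE.
rewrite -cintegralZ//; last exact: cintegrable_dot.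
rewrite -cintegralD//; last 2 first.
- by have := cintegrable_dot (a *: repr x) (repr y); congr cintegrable;
    apply/funext => t /=; rewrite mulrA.
- exact: cintegrable_dot.
by congr cintegral; apply/funext => t /=; rewrite mulrA -mulrDl.
Qed.

Let L2dotC x y : L2dot x y = (L2dot y x)^*%C.
Proof.
rewrite /L2dot -cintegralJ//; last exact: cintegrable_dot.
by congr cintegral; apply/funext => t; rewrite rmorphM /= conjcK mulrC.
Qed.

Let L2dot_linr x : GRing.linear_for (@conjc R \; *%R) (L2dot x).
Proof. by move=> a y y'; rewrite /= [LHS]L2dotC L2dot_lin rmorphD rmorphM (L2dotC x y) (L2dotC x y'). Qed.

Lemma L2dotxxE x : L2dot x x =
  (\int[mu]_(t in D) Normc.normc (repr x t) ^+ 2)%:C.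
Proof.
rewrite /L2dot /cintegral; congr (_ +i* _); last first.
  rewrite /Rintegral (eq_integral (fun=> 0%E)) ?integral0// => t _.
  by rewrite cImM cReJ cImJ mulrN mulrC addNr.
by apply: eq_Rintegral => t _; rewrite cReM cReJ cImJ sqr_normcE; ring.
Qed.

Let L2dot_gt0 x : x != 0 -> 0 < L2dot x x.
Proof.
move=> x0; rewrite L2dotxxE ltcR lt_neqAle eq_sym Rintegral_ge0 ?andbT; last first.
  by move=> t _; exact: sqr_ge0.
apply: contra x0 => /eqP r0; apply/eqP.
have /sq_integrableP[mf sf] := valP (repr x).
rewrite -(L2class_repr x); apply/L2classP.
have : (\int[mu]_(t in D) `|(Normc.normc (repr x t) ^+ 2)%:E| = 0)%E.
  rewrite -[RHS]/(0%:E) -r0 fineK; last exact: integrable_fin_num.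
  by apply: eq_integral => t _; rewrite gee0_abs// lee_fin sqr_ge0.
move=> /ae_eq_integral_abs -/(_ mD) => h.
have := h (measurable_int mu sf); apply: filterS => t + Dt => /(_ Dt)[] /eqP.
by rewrite sqrf_eq0 => /eqP/Normc.eq0_normc.
Qed.

HB.instance Definition _ := bilinear_isBilinear.Build R[i] L2 L2 R[i]
  *%R (@conjc R \; *%R) L2dot (L2dot_lin, L2dot_linr).
HB.instance Definition _ := isHermitianSesquilinear.Build R[i] L2 false (@conjc R) L2dot
  (fun x y => etrans (L2dotC x y) (esym (mul1r _))).
HB.instance Definition _ := isDotProduct.Build R[i] L2 L2dot L2dot_gt0.
End L2.
Section MultiplicationOperators.
Context d (T : measurableType d) (R : realType).
Variables (mu : {measure set T -> \bar R}) (D : set T) (mD : measurable D).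

Definition Linfty (f : T -> R[i]) : Prop :=
  cmeasurable D f /\
  exists M : R, {ae mu, forall x, D x -> Normc.normc (f x) <= M}.

Lemma normc_ge0 (z : R[i]) : 0 <= Normc.normc z.
Proof. by case: z => ? ?; exact: sqrtr_ge0. Qed.

Lemma mulfun_bound (f : T -> R[i]) (M : R) (g : T -> R[i]) :
  {ae mu, forall x, D x -> Normc.normc (f x) <= M} ->
  {ae mu, forall x, D x ->
     Normc.normc (f x * g x) ^+ 2 <= M ^+ 2 * Normc.normc (g x) ^+ 2}.
Proof.
apply: filterS => x + Dx => /(_ Dx) fM.
rewrite Normc.normcM exprMn ler_wpM2r ?sqr_ge0// ler_pXn2r// nnegrE ?normc_ge0//.
by rewrite (le_trans _ fM)// normc_ge0.
Qed.

Lemma mulfun_subproof (f : T -> R[i]) (g : L2fun mu mD) :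
  Linfty f -> (fun x => f x * g x) \in sq_integrable mu mD.
Proof.
move=> [mf [M fM]]; have /sq_integrableP[mg sg] := valP g.
apply: (sq_integrable_le mD (G := fun x => M ^+ 2 * Normc.normc (g x) ^+ 2)).
- exact: cmeasurableM.
- exact: (integrableZl mD (M ^+ 2) sg).
- exact: mulfun_bound.
Qed.

Definition mulfun (f : T -> R[i]) (fL : Linfty f) (g : L2fun mu mD) : L2fun mu mD :=
  MkL2fun (mulfun_subproof g fL).

Definition mulL2 (f : T -> R[i]) (fL : Linfty f) (x : L2 mu mD) : L2 mu mD :=
  L2class (mulfun fL (repr x)).

Lemma mulL2E (f : T -> R[i]) (fL : Linfty f) (g : L2fun mu mD) :
  mulL2 fL (L2class g) = L2class (mulfun fL g).
Proof.
apply/L2classP; have := repr_L2class g.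
by apply: filterS => x gx Dx /=; rewrite gx.
Qed.

Lemma hnorm_L2class (g : L2fun mu mD) : hnorm (@L2dot _ T R mu D mD) (L2class g) =
  Num.sqrt (\int[mu]_(x in D) Normc.normc (g x) ^+ 2).
Proof.
transitivity (Num.sqrt (complex.Re (L2dot (L2class g) (L2class g)))); first by [].
rewrite L2dotE; congr Num.sqrt; apply: eq_Rintegral => t _.
by rewrite cReM cReJ cImJ sqr_normcE; ring.
Qed.

Lemma mulL2_bounded (f : T -> R[i]) (fL : Linfty f) :
  mulL2 fL \in bounded_operator (@L2dot _ T R mu D mD).
Proof.
apply/bounded_operatorP; split.
  move=> a x y; rewrite -(L2class_repr x) -(L2class_repr y).
  rewrite -L2classZ -L2classD !mulL2E -L2classZ -L2classD.
  by apply/L2classP/aeW => t _ /=; rewrite mulrDr mulrCA.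
case: (fL) => mf [M fM]; exists `|M| => x; rewrite -(L2class_repr x) mulL2E !hnorm_L2class.
have /sq_integrableP[_ sg] := valP (repr x).
have /sq_integrableP[mh sh] := valP (mulfun fL (repr x)).
rewrite -sqrtr_sqr -sqrtrM ?sqr_ge0// ler_wsqrtr// -RintegralZl//.
rewrite /Rintegral fine_le//; first exact: integrable_fin_num.
  by apply: integrable_fin_num => //; exact: (integrableZl mD (M ^+ 2) sg).
apply: ae_ge0_le_integral => //.
- by move=> t _; rewrite lee_fin sqr_ge0.
- exact: measurable_int sh.
- by move=> t _; rewrite lee_fin mulr_ge0 ?sqr_ge0.
- exact: measurable_int (integrableZl mD (M ^+ 2) sg).
by have := mulfun_bound (repr x) fM; apply: filterS => t + Dt => /(_ Dt); rewrite lee_fin.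
Qed.

(* Multiplication by f is a bounded operator on L^2 for f essentially bounded
   and measurable; mulop f is 0 for all other f. *)
Definition mulop (f : T -> R[i]) : bop (@L2dot _ T R mu D mD) :=
  if pselect (Linfty f) is left fL then Bop (mulL2_bounded fL) else 0.

Lemma mulopE (f : T -> R[i]) (fL : Linfty f) (g : L2fun mu mD) :
  mulop f (L2class g) = L2class (mulfun fL g).
Proof.
rewrite /mulop; case: pselect => // fL'; rewrite /= mulL2E.
exact/L2classP/ae_eq_refl.
Qed.

End MultiplicationOperators.

Section UnitInterval.
Variable R : realType.

(* The library's lebesgue_measure is restricted to Borel sets, for which a
   Riemann integrable function need not be measurable. *)
Local Notation lambda := (@completed_lebesgue_measure R).

Definition I01 : set (caratheodory_type (wlength (@idfun R))^*%mu) := `[0, 1]%classic.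

Lemma measurable_I01 : measurable I01.
Proof. by apply: sub_caratheodory; exact: measurable_itv. Qed.

Definition L2_01 := L2 lambda measurable_I01.

Definition dot01 : {dot L2_01 for @conjc R} := @L2dot _ _ R lambda I01 measurable_I01.

(* Functions on [0, 1] are represented by functions on R, which only matter
   through their restrictions to [0, 1]. *)
Definition pi01 (f : R -> R[i]) : bop dot01 := mulop lambda measurable_I01 f.

Definition continuous01 : set (R -> R[i]) :=
  [set f | {within `[0, 1], continuous (f : R -> R[i]^o)}].

Definition riemann_sum (f : R -> R[i]) (a : R) (s t : seq R) : R[i] :=
  \sum_(i < size s) (nth 0 s i - nth 0 (a :: s) i)%:C * f (nth 0 t i).

(* s = (s_1 < ... < s_n = b) is a subdivision of [a, b] with a omitted, and
   t = (t_1, ..., t_n) is a choice of tags. *)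
Definition riemann_integrable (a b : R) (f : R -> R[i]) : Prop :=
  exists I : R[i], forall e : R, 0 < e -> exists2 delta : R, 0 < delta &
    forall s t : seq R, itv_partition a b s -> size t = size s ->
      (forall i, (i < size s)%N -> nth 0 s i - nth 0 (a :: s) i < delta) ->
      (forall i, (i < size s)%N -> nth 0 (a :: s) i <= nth 0 t i <= nth 0 s i) ->
      Normc.normc (riemann_sum f a s t - I) < e.

Definition riemann01 : set (R -> R[i]) := riemann_integrable 0 1.

End UnitInterval.

Section StarMonomorphism.
Variable R : realType.
Local Notation lambda := (@completed_lebesgue_measure R).
Implicit Types f g : R -> R[i].

Lemma normc_lt_ReIm (z w : R[i]) (e : R) : `|z - w| < e%:C ->
  `|complex.Re z - complex.Re w| < e /\ `|complex.Im z - complex.Im w| < e.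
Proof.
case: z w => a b [u v]; rewrite normc_def ltcR /= => h.
by split; apply: le_lt_trans h; rewrite -sqrtr_sqr ler_wsqrtr//= ?lerDl ?lerDr sqr_ge0.
Qed.

Lemma ReIm_lt_normc (z w : R[i]) (e : R) : 0 < e ->
  `|complex.Re z - complex.Re w| < e / 2 -> `|complex.Im z - complex.Im w| < e / 2 ->
  `|z - w| < e%:C.
Proof.
case: z w => a b [u v] e0 /= t1 t2; rewrite normc_def ltcR /=.
rewrite -[ltRHS]ger0_norm ?(ltW e0)// -sqrtr_sqr ltr_sqrt ?exprn_gt0//.
by move: t1 t2; rewrite !ltr_norml => /andP[? ?] /andP[? ?]; nra.
Qed.

Lemma continuous01P f : continuous01 f <->
  {within `[0, 1], continuous (fun x => complex.Re (f x))} /\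
  {within `[0, 1], continuous (fun x => complex.Im (f x))}.
Proof.
split=> [cf|[cRe cIm]].
  split=> x; apply/cvgrPdist_lt => e e0;
    have /cvgrPdist_lt /(_ e%:C) := cf x; rewrite ltcR => /(_ e0);
    by apply: filterS => t /normc_lt_ReIm[].
move=> x; apply/cvgrPdist_lt => e e0.
have [e1 e2] : 0 < complex.Re e /\ e = (complex.Re e)%:C.
  by case: e e0 => a b; rewrite ltcE /= => /andP[/eqP -> a0].
have /cvgrPdist_lt /(_ (complex.Re e / 2)) := cRe x; rewrite divr_gt0// => /(_ isT) h1.
have /cvgrPdist_lt /(_ (complex.Re e / 2)) := cIm x; rewrite divr_gt0// => /(_ isT) h2.
rewrite e2; near=> t; apply: ReIm_lt_normc => //; near: t; [exact: h1|exact: h2].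
Unshelve. all: by end_near. Qed.

Lemma continuous01_cmeasurable f : continuous01 f -> cmeasurable (@I01 R) f.
Proof.
have h (u : R -> R) : {within `[0, 1], continuous u} -> measurable_fun (@I01 R) u.
  move=> cu _ Y mY; apply: sub_caratheodory.
  exact: (subspace_continuous_measurable_fun (measurable_itv _) cu).
by move=> /continuous01P[/h ? /h].
Qed.

Lemma continuous01_Linfty f : continuous01 f -> Linfty lambda (@I01 R) f.
Proof.
move=> cf; split; first exact: continuous01_cmeasurable.
have h (u : R -> R) : {within `[0, 1], continuous u} ->
    exists M : R, forall x, `[0, 1]%classic x -> `|u x| <= M.
  move=> cu; have := @continuous_compact _ _ _ _ cu (@segment_compact R 0 1).
  move=> /compact_bounded [M [_ MP]]; exists (M + 1) => x x01.
  by apply: MP; [rewrite ltrDl|exists x].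
have [/h[M fM] /h[N fN]] := (continuous01P f).1 cf.
exists (Num.sqrt (M ^+ 2 + N ^+ 2)); apply: aeW => x x01.
rewrite -[leLHS]ger0_norm ?normc_ge0// -sqrtr_sqr ler_wsqrtr// sqr_normcE.
rewrite -(real_normK (num_real (complex.Re _))) -(real_normK (num_real (complex.Im _))).
have sqr_le (u v : R) : 0 <= u -> u <= v -> u ^+ 2 <= v ^+ 2.
  by move=> u0 uv; rewrite ler_pXn2r// nnegrE// (le_trans u0).
by rewrite lerD// sqr_le// ?fM ?fN.
Qed.

Lemma max_lt_min (x r : R) : 0 <= x -> x <= 1 -> 0 < r ->
  Num.max 0 (x - r) < Num.min 1 (x + r).
Proof.
by move=> *; rewrite gt_max !lt_min ltr01; apply/andP; split; apply/andP; split=> //; lra.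
Qed.

Lemma ae_eq_continuous01 f g : continuous01 f -> continuous01 g ->
  ae_eq lambda (@I01 R) f g -> {in `[0, 1], f =1 g}.
Proof.
move=> cf cg [N [mN N0 fgN]] x x01; apply/eqP/negPn/negP => fgx.
have e0 : 0 < `|f x - g x| / 2 by rewrite divr_gt0// normr_gt0 subr_eq0.
have x01' : `[0, 1]%classic x by [].
have /subspace_continuousP /(_ x x01') /cvgrPdist_lt /(_ _ e0) hf := cf.
have /subspace_continuousP /(_ x x01') /cvgrPdist_lt /(_ _ e0) hg := cg.
have : \forall t \near within `[0, 1]%classic (nbhs x), f t != g t.
  near=> t; apply/eqP => fgt.
  have : `|f x - g x| < `|f x - g x|; last by rewrite ltxx.
  apply: (le_lt_trans (ler_distD (f t) _ _)); rewrite [ltRHS]splitr.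
  apply: ltrD; first by near: t; exact: hf.
  by rewrite fgt distrC; near: t; exact: hg.
rewrite /within /= => -[/= r r0 rP].
have sub : `]Num.max 0 (x - r), Num.min 1 (x + r)[%classic `<=` N.
  move=> t /=; rewrite in_itv /= gt_max lt_min => /andP[/andP[t0 xt] /andP[t1 tx]].
  have t01 : `[0, 1]%classic t by rewrite /= in_itv /= !ltW.
  apply: fgN => /= /(_ t01) fgt.
  have := rP t; rewrite /ball_ /= ltr_distlC => /(_ _ t01).
  by rewrite fgt eqxx => h; have : false by apply: h; apply/andP; split; lra.
set a := Num.max 0 (x - r) in sub *; set b := Num.min 1 (x + r) in sub *.
have : (lebesgue_measure (`]a, b[%classic : set R) <= 0)%E.
  by rewrite -N0; exact: le_outer_measure.
move: x01; rewrite in_itv /= => /andP[x0 x1].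
have ab : a < b.
  exact: max_lt_min.
by rewrite lebesgue_measure_itv /= lte_fin ab -EFinB lee_fin subr_le0 leNgt ab.
Unshelve. all: by end_near. Qed.

Local Notation Linf := (Linfty lambda (@I01 R)).
Local Notation L2f := (L2fun lambda (@measurable_I01 R)).

Lemma one_sq_integrable : (fun=> 1 : R[i]) \in sq_integrable lambda (@measurable_I01 R).
Proof.
apply: (sq_integrable_le _ (G := fun=> 1)).
- by split; exact: measurable_cst.
- apply/integrableP; split; first exact: measurable_cst.
  rewrite (eq_integral (cst 1%E)); last by move=> x _ /=; rewrite normr1.
  rewrite integral_cst ?mul1e//; last exact: measurable_I01.
  have : (lebesgue_measure (`[0%R, 1%R]%classic : set R) < +oo)%E; last by [].
 
  by rewrite lebesgue_measure_itv /= lte_fin ltr01 -EFinB ltry.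
- by apply: aeW => x _; rewrite Normc.normc1 expr1n.
Qed.

Lemma pi01_eqP f g : Linf f -> Linf g ->
  pi01 f = pi01 g <-> ae_eq lambda (@I01 R) f g.
Proof.
move=> fL gL; split=> [fg|fg].
  pose u : L2f := MkL2fun one_sq_integrable.
  have := congr1 (fun S : bop (dot01 R) => S (L2class u)) fg.
  rewrite /= (mulopE fL).
  rewrite (mulopE gL).
  by move=> /L2classP; apply: filterS => x /= h /h; rewrite !mulr1.
apply: bop_ext => x /=; rewrite -(L2class_repr x).
rewrite (mulopE fL) (mulopE gL); apply/L2classP.
by apply: filterS fg => t h Dt /=; rewrite h.
Qed.

Lemma continuous01_stable (a : R[i]) f g : continuous01 f -> continuous01 g ->
  [/\ continuous01 (a *: f + g), continuous01 (f \* g) &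
      continuous01 (fun x => (f x)^*%C)].
Proof.
move=> /continuous01P[f1 f2] /continuous01P[g1 g2]; split; apply/continuous01P; split.
- have -> : (fun x => complex.Re ((a *: f + g) x)) = (fun x => (complex.Re a *
      complex.Re (f x) - complex.Im a * complex.Im (f x)) + complex.Re (g x)).
    by apply/funext => x; rewrite -cReM -cReD.
  move=> x; apply: cvgD; [apply: cvgB; apply: cvgMr; [exact: f1|exact: f2]|exact: g1].
- have -> : (fun x => complex.Im ((a *: f + g) x)) = (fun x => (complex.Re a *
      complex.Im (f x) + complex.Im a * complex.Re (f x)) + complex.Im (g x)).
    by apply/funext => x; rewrite -cImM -cImD.
  move=> x; apply: cvgD; [apply: cvgD; apply: cvgMr; [exact: f2|exact: f1]|exact: g2].
- have -> : (fun x => complex.Re ((f \* g) x)) = (fun x => complex.Re (f x) *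
      complex.Re (g x) - complex.Im (f x) * complex.Im (g x)).
    by apply/funext => x; rewrite -cReM.
  by move=> x; apply: cvgB; apply: cvgM; [exact: f1|exact: g1|exact: f2|exact: g2].
- have -> : (fun x => complex.Im ((f \* g) x)) = (fun x => complex.Re (f x) *
      complex.Im (g x) + complex.Im (f x) * complex.Re (g x)).
    by apply/funext => x; rewrite -cImM.
  by move=> x; apply: cvgD; apply: cvgM; [exact: f1|exact: g2|exact: f2|exact: g1].
- have -> // : (fun x => complex.Re (f x)^*%C) = (fun x => complex.Re (f x)).
  by apply/funext => x; rewrite cReJ.
- have -> : (fun x => complex.Im (f x)^*%C) = (fun x => - complex.Im (f x)).
    by apply/funext => x; rewrite cImJ.
  by move=> x; apply: cvgN; exact: f2.
Qed.

Lemma pi01_star_monomorphism :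
  [/\ forall (a : R[i]) f g, continuous01 f -> continuous01 g ->
        pi01 (a *: f + g) = a *: pi01 f + pi01 g,
      forall f g, continuous01 f -> continuous01 g ->
        pi01 (f \* g) = bop_mul (pi01 f) (pi01 g),
      forall f, continuous01 f -> is_adjoint (pi01 f) (pi01 (fun x => (f x)^*%C)) &
      forall f g, continuous01 f -> continuous01 g ->
        pi01 f = pi01 g <-> {in `[0, 1], f =1 g}].
Proof.
split=> [a f g cf cg|f g cf cg|f cf|f g cf cg].
- have [/continuous01_Linfty hL _ _] := continuous01_stable a cf cg.
  have fL := continuous01_Linfty cf; have gL := continuous01_Linfty cg.
  apply: bop_ext => x /=; rewrite -(L2class_repr x).
  rewrite (mulopE hL).
  rewrite -[RHS]/(a *: pi01 f (L2class (repr x)) + pi01 g (L2class (repr x))).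
  rewrite (mulopE fL) (mulopE gL).
  rewrite -L2classZ -L2classD; apply/L2classP/aeW => t _ /=.
  rewrite -[LHS]/((a * f t + g t) * repr x t).
  by rewrite -[RHS]/(a * (f t * repr x t) + g t * repr x t) mulrDl mulrA.
- have [_ /continuous01_Linfty hL _] := continuous01_stable 0 cf cg.
  have fL := continuous01_Linfty cf; have gL := continuous01_Linfty cg.
  apply: bop_ext => x /=; rewrite -(L2class_repr x).
  rewrite (mulopE hL).
  rewrite (mulopE gL).
  rewrite (mulopE fL).
  by apply/L2classP/aeW => t _ /=; rewrite mulrA.
- have [_ _ /continuous01_Linfty hL] := continuous01_stable 0 cf cf.
  have fL := continuous01_Linfty cf.
  move=> x y; rewrite -(L2class_repr x) -(L2class_repr y).
  rewrite (mulopE fL).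
  rewrite (mulopE hL).
  rewrite [LHS]L2dotE [RHS]L2dotE; congr cintegral; apply/funext => t /=.
  by rewrite rmorphM /= conjcK; ring.
- rewrite pi01_eqP; [|exact: continuous01_Linfty..].
  by split=> [|fg]; [exact: ae_eq_continuous01|apply: aeW => x xI; exact: fg].
Qed.

End StarMonomorphism.

(* Main.v *)
Require Import Defs.
From HB Require Import structures.
From mathcomp Require Import all_boot all_order all_algebra.
From mathcomp Require Import sesquilinear complex.
From mathcomp Require Import all_classical all_reals all_analysis.
From mathcomp Require Import measurable_realfun.
From mathcomp Require Import ring lra.

(** The operators fixed by every completely contractive map fixing the continuous
    symbols are found in two steps, both of which rest on a reformulation of
    Riemann integrability. Call a real function on [0, 1] squeezed if, for every
    e > 0, it lies between two continuous functions whose integrals differ by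
    less than e. A complex function is Riemann integrable if and only if its real
    and imaginary parts are squeezed (riemann01_squeezed).

    Multiplication by a Riemann integrable function is fixed. A linear map phi
    that is contractive and fixes the identity is positive on multiplication
    operators (unital_contraction_positive). If p <= u <= q with p and q
    continuous, then phi (M_u) lies between M_p and M_q, as does M_u; when u is
    squeezed this leaves no room for phi (M_u) to differ from M_u
    (positive_functional_squeezed, phi_fix_riemann).

    Conversely, let T be fixed. Conjugations by unitary multiplication operators
    are completely contractive and fix the continuous symbols, so T commutes with
    them, and T is multiplication by f = T 1 (fix_hull_multiplication). It remains
    to move M_f when f is not a.e. equal to a Riemann integrable function. Cut
    [0, 1] into n + 1 equal cells, choose a unit vector on each cell, and send an
    operator S to the step function whose value on a cell is the vector state of
    S there. As n grows along an ultrafilter these step functions converge weakly,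
    by compactness and the Radon-Nikodym theorem; multiplication by the limit
    defines a completely contractive map (singular_completely_contractive), and
    since the vectors concentrate at points it fixes every continuous symbol
    (singular_id). If the vectors are chosen where Re f nearly attains its
    essential supremum over the cells, the integrals of the step functions of M_f
    are upper sums of Re f, while they converge to the integral of Re f because
    M_f is fixed (hull_upper_step). Applied to f, -f, i f and -i f, this shows that
    Re f and Im f are squeezed up to null sets, and they can be modified on null
    sets into squeezed functions (ae_squeezed_modification).

    Fixed operators form a closed linear subspace. That it is closed under
    products and adjoints is seen on symbols: squeezed functions are closed under
    products. *)

Set Implicit Arguments.
Unset Strict Implicit.
Unset Printing Implicit Defensive.
Import Order.TTheory GRing.Theory Num.Theory.
Import numFieldNormedType.Exports.
Local Open Scope classical_set_scope.
Local Open Scope complex_scope.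
Local Open Scope ring_scope.

(** * Integrals of bounded measurable functions on [0, 1] *)

Section BoundedMeasurable.
Context {R : realType}.
Local Notation lambda := (@completed_lebesgue_measure R).
Local Notation I := (@I01 R).
Implicit Types u v p q : R -> R.

Lemma I01P (x : R) : I x <-> 0 <= x <= 1.
Proof. by rewrite /I01 /= in_itv. Qed.

Lemma lambda_I01 : lambda I = 1%E.
Proof.
have : lebesgue_measure (`[0, 1]%classic : set R) = 1%E; last by [].
by rewrite lebesgue_measure_itv /= lte_fin ltr01 oppr0 adde0.
Qed.

Definition bmeas u := measurable_fun I u /\ exists M, forall x, I x -> `|u x| <= M.

Definition int01 u := \int[lambda]_(x in I) u x.

Lemma bmeas_integrable u : bmeas u -> lambda.-integrable I (EFin \o u).
Proof.
move=> [mu [M uM]]; apply: (@measurable_bounded_integrable _ _ _ lambda).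
- exact: measurable_I01.
- by rewrite /= lambda_I01 ltry.
- exact: mu.
- exists `|M|; split; first exact: num_real.
  by move=> r Mr x Ix; apply: (le_trans (uM _ Ix)); rewrite (le_trans (ler_norm _) (ltW Mr)).
Qed.

Lemma bmeas_cst c : bmeas (fun=> c).
Proof. by split; [exact: measurable_cst|exists `|c|]. Qed.

Lemma bmeasD u v : bmeas u -> bmeas v -> bmeas (fun x => u x + v x).
Proof.
move=> [mu [M uM]] [mv [N vN]]; split; first exact: measurable_funD.
by exists (M + N) => x Ix; rewrite (le_trans (ler_normD _ _))// lerD ?uM ?vN.
Qed.

Lemma bmeasN u : bmeas u -> bmeas (fun x => - u x).
Proof.
move=> [mu [M uM]]; split; first exact: measurableT_comp.
by exists M => x Ix; rewrite normrN uM.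
Qed.

Lemma bmeasB u v : bmeas u -> bmeas v -> bmeas (fun x => u x - v x).
Proof. by move=> bu /bmeasN; exact: bmeasD. Qed.

Lemma bmeasM u v : bmeas u -> bmeas v -> bmeas (fun x => u x * v x).
Proof.
move=> [mu [M uM]] [mv [N vN]]; split; first exact: measurable_funM.
by exists (M * N) => x Ix; rewrite normrM ler_pM ?uM ?vN.
Qed.

Lemma bmeas_max u v : bmeas u -> bmeas v -> bmeas (fun x => Num.max (u x) (v x)).
Proof.
move=> [mu [M uM]] [mv [N vN]]; split; first exact: measurable_maxr.
exists (M + N) => x Ix; have := uM _ Ix; have := vN _ Ix.
have [] := leP (u x) (v x) => _; have := normr_ge0 (u x); have := normr_ge0 (v x); lra.
Qed.

Lemma int01D u v : bmeas u -> bmeas v -> int01 (fun x => u x + v x) = int01 u + int01 v.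
Proof.
by move=> bu bv; rewrite /int01 RintegralD//; (exact: measurable_I01 || exact: bmeas_integrable).
Qed.

Lemma int01B u v : bmeas u -> bmeas v -> int01 (fun x => u x - v x) = int01 u - int01 v.
Proof.
by move=> bu bv; rewrite /int01 RintegralB//; (exact: measurable_I01 || exact: bmeas_integrable).
Qed.

Lemma int01Z c u : bmeas u -> int01 (fun x => c * u x) = c * int01 u.
Proof.
by move=> bu; rewrite /int01 RintegralZl//; (exact: measurable_I01 || exact: bmeas_integrable).
Qed.

Lemma int01_cst c : int01 (fun=> c) = c.
Proof.
rewrite /int01 Rintegral_cst; last exact: measurable_I01.
by rewrite -[X in fine X]/(lambda I) lambda_I01 mulr1.
Qed.

Lemma le_int01 u v : bmeas u -> bmeas v -> (forall x, I x -> u x <= v x) ->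
  int01 u <= int01 v.
Proof.
by move=> bu bv uv; apply: le_Rintegral => //; (exact: measurable_I01 || exact: bmeas_integrable).
Qed.

Lemma int01_ge0 u : (forall x, I x -> 0 <= u x) -> 0 <= int01 u.
Proof. exact: Rintegral_ge0. Qed.

Lemma int01N u : bmeas u -> int01 (fun x => - u x) = - int01 u.
Proof.
move=> bu; rewrite -mulN1r -int01Z//; congr int01; apply/funext => x.
by rewrite mulN1r.
Qed.

(** Replacing v by the maximum of u and v changes it on a null set only, and
    makes the inequality hold everywhere. *)
Lemma le_int01_ae u v : bmeas u -> bmeas v ->
  {ae lambda, forall x, I x -> u x <= v x} -> int01 u <= int01 v.
Proof.
move=> bu bv uv.
have /ae_eq_integral E : ae_eq lambda I (EFin \o v)
    (EFin \o (fun x => Num.max (u x) (v x))).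
  by apply: filterS uv => x + Ix => /(_ Ix) h /=; rewrite max_r.
have -> : int01 v = int01 (fun x => Num.max (u x) (v x)).
  congr fine; apply: E; [exact: measurable_I01|apply/measurable_EFinP..].
    exact: bv.1.
  exact: (bmeas_max bu bv).1.
by apply: le_int01 => //; [exact: bmeas_max|move=> x _; rewrite le_max lexx].
Qed.

(** The pointwise infimum is measurable, nonnegative, and has an integral below
    every int01 (d j), that is, 0; such a function vanishes a.e. *)
Lemma inf_int01_eq0 (d : nat -> R -> R) : (forall j, bmeas (d j)) ->
  (forall j x, I x -> 0 <= d j x) ->
  (forall e, 0 < e -> exists j, int01 (d j) < e) ->
  {ae lambda, forall x, I x -> forall e, 0 < e -> exists j, d j x < e}.
Proof.
move=> bd d0 de.
pose m x := inf [set d j x | j in setT].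
have lb x : I x -> has_lbound [set d j x | j in setT].
  by move=> Ix; exists 0 => _ [j _ <-]; exact: d0.
have m0 x : I x -> 0 <= m x.
  by move=> Ix; apply: lb_le_inf; [exists (d 0%N x), 0%N|move=> _ [j _ <-]; exact: d0].
have md j x : I x -> m x <= d j x.
  by move=> Ix; apply: ge_inf; [exact: lb|exists j].
have mm : measurable_fun I m.
  have -> : m = fun x => inf (sdrop (d ^~ x) 0).
    apply/funext => x; congr inf; apply/seteqP; split => [_ [j _ <-]|_ [j _ <-]]; exists j => //.
  apply: measurable_fun_infs => [x Ix|j]; last exact: (bd j).1.
  by have [y ly] := lb x Ix; exists y => _ [j _ <-]; apply: ly; exists j.
have bm : bmeas m.
  split => //; have [_ [M dM]] := bd 0%N; exists M => x Ix.
  by rewrite ger0_norm ?m0// (le_trans (md 0%N x Ix))// (le_trans (ler_norm _))// dM.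
have im : int01 m = 0.
  apply/eqP; rewrite eq_le int01_ge0// andbT; apply/ler_addgt0Pr => e e0.
  have [j je] := de _ e0; rewrite add0r (le_trans _ (ltW je))//.
  by apply: le_int01 => // x Ix; exact: md.
have : (\int[lambda]_(x in I) `|(m x)%:E| = 0)%E.
  rewrite -[RHS]/(0%:E) -im fineK; last first.
    by apply: integrable_fin_num; (exact: measurable_I01 || exact: bmeas_integrable).
  by apply: eq_integral => x /[!inE] Ix; rewrite gee0_abs// lee_fin m0.
move=> /ae_eq_integral_abs -/(_ (@measurable_I01 R)) => h.
have := h ((measurable_EFinP I m).2 mm); apply: filterS => x + Ix e e0 => /(_ Ix)[mx].
have : m x < e by rewrite mx.
have s0 : [set d j x | j in setT] !=set0 by exists (d 0%N x), 0%N.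
by move=> /(inf_lt s0)[_ [j _ <-] je]; exists j.
Qed.

End BoundedMeasurable.

(** * Functions squeezed between continuous functions *)

Section Squeezed.
Context {R : realType}.
Local Notation lambda := (@completed_lebesgue_measure R).
Local Notation I := (@I01 R).
Implicit Types (u v p q : R -> R).
(* Predicates such as cont01 and squeezed unfold to products, whose bound
   variables would otherwise become implicit arguments of the lemmas. *)
Unset Implicit Arguments.

Definition cont01 u := {within `[0, 1]%classic, continuous u}.

Lemma cont01_cst c : cont01 (fun=> c).
Proof. by move=> x; exact: cvg_cst. Qed.

Lemma cont01D {u v} : cont01 u -> cont01 v -> cont01 (fun x => u x + v x).
Proof. by move=> cu cv x; apply: cvgD; [exact: cu|exact: cv]. Qed.

Lemma cont01N {u} : cont01 u -> cont01 (fun x => - u x).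
Proof. by move=> cu x; apply: cvgN; exact: cu. Qed.

Lemma cont01_comp {F : R -> R} {u} : continuous F -> cont01 u -> cont01 (F \o u).
Proof. by move=> cF cu x; exact: (cvg_comp _ _ (cu x) (cF (u x))). Qed.

Lemma cont01_max {u v} : cont01 u -> cont01 v -> cont01 (fun x => Num.max (u x) (v x)).
Proof. by move=> cu cv x; exact: (continuous_max (cu x) (cv x)). Qed.

Lemma cont01_min {u v} : cont01 u -> cont01 v -> cont01 (fun x => Num.min (u x) (v x)).
Proof. by move=> cu cv x; exact: (continuous_min (cu x) (cv x)). Qed.

Lemma cont01_bmeas {u} : cont01 u -> bmeas u.
Proof.
move=> cu; split.
  move=> _ Y mY; apply: sub_caratheodory.
  exact: (subspace_continuous_measurable_fun (measurable_itv _) cu).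
have := @continuous_compact _ _ _ _ cu (@segment_compact R 0 1).
move=> /compact_bounded [M [_ MP]]; exists (M + 1) => x x01.
by apply: MP; [rewrite ltrDl|exists x].
Qed.

(** The Darboux criterion with continuous functions in place of step functions:
    the maps of the theorem are known to fix the continuous symbols. *)
Definition squeezed u := forall e : R, 0 < e -> exists p q,
  [/\ cont01 p, cont01 q, forall x, I x -> p x <= u x <= q x &
      int01 (fun x => q x - p x) < e].

Lemma squeezed_cont {u} : cont01 u -> squeezed u.
Proof.
move=> cu e e0; exists u, u; split => // [x _|]; first by rewrite lexx.
by rewrite (_ : (fun x => _) = (fun=> 0)) ?int01_cst//; apply/funext => x; rewrite subrr.
Qed.

Lemma squeezedN {u} : squeezed u -> squeezed (fun x => - u x).
Proof.
move=> su e /su[p [q [cp cq pq ie]]]; exists (fun x => - q x), (fun x => - p x).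
split; [exact: cont01N|exact: cont01N|by move=> x /pq; rewrite !lerN2 andbC|].
by rewrite (_ : (fun x => _) = (fun x => q x - p x))//; apply/funext => x; ring.
Qed.

Lemma squeezedD {u v} : squeezed u -> squeezed v -> squeezed (fun x => u x + v x).
Proof.
move=> su sv e e0; have e2 : 0 < e / 2 by rewrite divr_gt0.
have [p [q [cp cq pq ie]]] := su _ e2; have [p' [q' [cp' cq' pq' ie']]] := sv _ e2.
exists (fun x => p x + p' x), (fun x => q x + q' x).
split; [exact: cont01D|exact: cont01D| |].
  by move=> x Ix; have /andP[? ?] := pq x Ix; have /andP[? ?] := pq' x Ix; rewrite !lerD.
rewrite (_ : (fun x => _) = (fun x => (q x - p x) + (q' x - p' x))); last first.
  by apply/funext => x; ring.
rewrite int01D; first by rewrite [ltRHS]splitr ltrD.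
  by apply: bmeasB; exact: cont01_bmeas.
by apply: bmeasB; exact: cont01_bmeas.
Qed.

(** A nondecreasing F preserves the sandwich, and being L-Lipschitz it multiplies
    the gap between the two sides by at most L. *)
Lemma squeezed_comp {F : R -> R} {L : R} {u} : continuous F ->
  (forall s t, s <= t -> 0 <= F t - F s <= L * (t - s)) ->
  squeezed u -> squeezed (F \o u).
Proof.
move=> cF FL su e e0.
have L1 : 0 < `|L| + 1 by rewrite ltr_wpDl.
have [p [q [cp cq pq ie]]] := su _ (divr_gt0 e0 L1).
exists (F \o p), (F \o q); split; [exact: cont01_comp|exact: cont01_comp| |].
  move=> x Ix /=; have /andP[/FL /andP[+ _] /FL /andP[+ _]] := pq x Ix.
  by rewrite !subr_ge0 => -> ->.
rewrite ltr_pdivlMr// in ie; apply: le_lt_trans ie.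
have bm : bmeas (fun x => q x - p x) by apply: bmeasB; exact: cont01_bmeas.
rewrite mulrC -int01Z//; apply: le_int01.
- by apply: bmeasB; apply: cont01_bmeas; exact: cont01_comp.
- by apply: bmeasM => //; exact: bmeas_cst.
- move=> x Ix /=; have /andP[px xq] := pq x Ix.
  have pqx := le_trans px xq.
  have /andP[_ h] := FL _ _ pqx; apply: (le_trans h).
  by rewrite ler_wpM2r ?subr_ge0// (le_trans (ler_norm _))// lerDl.
Qed.

Lemma squeezedZ c {u} : squeezed u -> squeezed (fun x => c * u x).
Proof.
wlog c0 : c u / 0 <= c.
  move=> H su; have [/H|/ltW c0] := leP 0 c; first exact.
  have := squeezedN (H (- c) u _ su); rewrite oppr_ge0 => /(_ c0).
  by rewrite (_ : (fun x => _) = (fun x => c * u x))//; apply/funext => x; ring.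
apply: (@squeezed_comp (fun x => c * x) c).
  by move=> x; apply: cvgMr; exact: cvg_id.
by move=> s t st; rewrite -mulrBr lexx andbT mulr_ge0// subr_ge0.
Qed.

Lemma squeezedB {u v} : squeezed u -> squeezed v -> squeezed (fun x => u x - v x).
Proof. by move=> su /squeezedN; exact: squeezedD. Qed.

Lemma eq_squeezed {u v} : (forall x, I x -> u x = v x) -> squeezed u -> squeezed v.
Proof.
move=> uv su e /su[p [q [cp cq pq ie]]]; exists p, q; split => // x Ix.
by rewrite -uv// pq.
Qed.

Lemma squeezed_sum {n} {F : 'I_n -> R -> R} : (forall i, squeezed (F i)) ->
  squeezed (fun x => \sum_(i < n) F i x).
Proof.
elim: n F => [|n IH] F sF.
  by apply: eq_squeezed (squeezed_cont (cont01_cst 0)) => x _; rewrite big_ord0.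
pose G i := F (widen_ord (leqnSn n) i).
have sG : squeezed (fun x => \sum_(i < n) G i x) by apply: IH => i; exact: sF.
by apply: eq_squeezed (squeezedD sG (sF ord_max)) => x _; rewrite big_ord_recr.
Qed.

Lemma squeezed_bounded {u} : squeezed u -> exists M, forall x, I x -> `|u x| <= M.
Proof.
move=> /(_ 1 ltr01)[p [q [/cont01_bmeas [_ [M pM]] /cont01_bmeas [_ [N qN]] pq _]]].
exists (M + N) => x Ix; have /andP[px xq] := pq x Ix.
move: (pM x Ix) (qN x Ix); rewrite !ler_norml => /andP[? ?] /andP[? ?].
by apply/andP; split; lra.
Qed.

(** The variant adapted to symbols of operators, which are determined only up
    to a null set. *)
Definition ae_squeezed u := forall e : R, 0 < e -> exists p q,
  [/\ cont01 p, cont01 q, {ae lambda, forall x, I x -> p x <= u x <= q x} &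
      int01 (fun x => q x - p x) < e].

End Squeezed.

(** * Functions squeezed almost everywhere *)

Section SqueezedModification.
Context {R : realType}.
Local Notation lambda := (@completed_lebesgue_measure R).
Local Notation I := (@I01 R).
Implicit Types (u v p q : R -> R).
Unset Implicit Arguments.

(** The continuous functions max p q and q agree a.e. on [0, 1], hence
    everywhere, since nonempty open subsets have positive measure. *)
Lemma cont01_le_ae p q : cont01 p -> cont01 q ->
  {ae lambda, forall x, I x -> p x <= q x} -> forall x, I x -> p x <= q x.
Proof.
move=> cp cq pq x Ix.
have cm : cont01 (fun x => Num.max (p x) (q x)) by exact: cont01_max.
have cC v : cont01 v -> continuous01 (fun x => (v x)%:C).
  by move=> cv; apply/continuous01P; split => //; exact: cont01_cst.
have : {in `[0, 1], (fun x => (Num.max (p x) (q x))%:C) =1 (fun x => (q x)%:C)}.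
  apply: ae_eq_continuous01; [exact: cC|exact: cC|].
  by apply: filterS pq => t + It => /(_ It) h; rewrite max_r.
by move=> /(_ x Ix) /(congr1 (@complex.Re R)) /= <-; rewrite le_max lexx.
Qed.

(** g is the infimum of a sequence of upper functions. By continuity the lower
    functions lie below the upper ones at every point, so g is squeezed between
    them at every point too; and g = u wherever both are caught between
    functions that come arbitrarily close to each other, that is, a.e. *)
Lemma ae_squeezed_modification u : ae_squeezed u ->
  exists g, [/\ squeezed g, bmeas g & {ae lambda, forall x, I x -> g x = u x}].
Proof.
move=> su.
have e0 (j : nat) : 0 < (j.+1%:R : R)^-1 by rewrite invr_gt0.
have /choice[p /choice[q H]] : forall j : nat, exists p, exists q,
  [/\ cont01 p, cont01 q, {ae lambda, forall x, I x -> p x <= u x <= q x} &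
      int01 (fun x => q x - p x) < j.+1%:R^-1].
  by move=> j; exact: su (e0 j).
have cp j : cont01 (p j) by have [] := H j.
have cq j : cont01 (q j) by have [] := H j.
have pqu : {ae lambda, forall x j, I x -> p j x <= u x <= q j x}.
  by apply/ae_foralln => j; have [] := H j.
have pq i j x : I x -> p i x <= q j x.
  apply: (cont01_le_ae (p i) (q j)) => //.
  by apply: filterS pqu => t h It; have /andP[+ _] := h i It; have /andP[_ +] := h j It; lra.
pose g x := inf [set q j x | j in setT].
have lb x : I x -> has_lbound [set q j x | j in setT].
  by move=> Ix; exists (p 0%N x) => _ [j _ <-]; exact: pq.
have pg j x : I x -> p j x <= g x.
  move=> Ix; apply: lb_le_inf; first by exists (q 0%N x), 0%N.
  by move=> _ [i _ <-]; exact: pq.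
have gq j x : I x -> g x <= q j x.
  by move=> Ix; apply: ge_inf; [exact: lb|exists j].
have small e : 0 < e -> exists j, int01 (fun x => q j x - p j x) < e.
  move=> ep; have [j je] : exists j : nat, j.+1%:R^-1 < e.
    exists (Num.truncn e^-1); rewrite -[ltRHS]invrK ltf_pV2 ?posrE ?invr_gt0//.
    exact: truncnS_gt.
  by exists j; apply: lt_trans je; have [] := H j.
have mg : measurable_fun I g.
  have -> : g = fun x => inf (sdrop (q ^~ x) 0).
    apply/funext => x; congr inf; apply/seteqP; split => [_ [j _ <-]|_ [j _ <-]]; exists j => //.
  apply: measurable_fun_infs => [x Ix|j]; last exact: (cont01_bmeas (cq j)).1.
  by have [y ly] := lb x Ix; exists y => _ [j _ <-]; apply: ly; exists j.
exists g; split.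
- move=> e /small[j je]; exists (p j), (q j); split => // x Ix.
  by rewrite pg ?gq.
- split => //; have [_ [M pM]] := cont01_bmeas (cp 0%N).
  have [_ [N qN]] := cont01_bmeas (cq 0%N); exists (M + N) => x Ix.
  have := pg 0%N x Ix; have := gq 0%N x Ix.
  by move: (pM x Ix) (qN x Ix); rewrite !ler_norml => /andP[? ?] /andP[? ?] ? ?;
    apply/andP; split; lra.
- have := @inf_int01_eq0 _ (fun j x => q j x - p j x).
  move=> /(_ (fun j => bmeasB (cont01_bmeas (cq j)) (cont01_bmeas (cp j)))).
  have d0 (j : nat) x : I x -> 0 <= q j x - p j x by move=> Ix; rewrite subr_ge0 pq.
  move=> /(_ d0 small) d0'; apply: filterS2 d0' pqu => x h1 h2 Ix.
  apply/eqP; rewrite -subr_eq0 -normr_le0; apply/ler_addgt0Pr => e ep.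
  have [j je] := h1 Ix e ep; rewrite add0r.
  have /andP[? ?] := h2 j Ix; have := pg j x Ix; have := gq j x Ix.
  by rewrite ler_norml => ? ?; apply/andP; split; lra.
Qed.

Lemma squeezed_ae_squeezed {u} : squeezed u -> ae_squeezed u.
Proof.
by move=> su e /su[p [q [? ? ? ?]]]; exists p, q; split => //; exact: aeW.
Qed.

(** Measurability rests on the completeness of the measure: u is a.e. equal to
    an infimum of continuous functions. *)
Lemma squeezed_bmeas {u} : squeezed u -> bmeas u.
Proof.
move=> su; have bu := squeezed_bounded su; split => //.
have [g [_ [mg _] gu]] := ae_squeezed_modification _ (squeezed_ae_squeezed su).
apply/measurable_EFinP.
apply: (ae_measurable_fun (@completed_lebesgue_measure_is_complete R) (f := EFin \o g)).
  by apply: filterS gu => x + Ix => /(_ Ix) /= ->.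
exact/measurable_EFinP.
Qed.

(** The slack in int01 (w - v) < e pays for replacing v and w by continuous
    functions. *)
Lemma squeezed_between v w e : squeezed v -> squeezed w ->
  int01 (fun x => w x - v x) < e ->
  exists p q, [/\ cont01 p, cont01 q, (forall x, I x -> p x <= v x), (forall x, I x -> w x <= q x) &
      int01 (fun x => q x - p x) < e].
Proof.
move=> sv sw ie; set d := e - int01 (fun x => w x - v x).
have d2 : 0 < d / 2 by rewrite divr_gt0// subr_gt0.
have [p [q' [cp cq' pq' ip]]] := sv _ d2.
have [p' [q [cp' cq pq iq]]] := sw _ d2.
exists p, q; split => //; [by move=> x /pq' /andP[]|by move=> x /pq /andP[]|].
have [bp bq bp' bq'] : [/\ bmeas p, bmeas q, bmeas p' & bmeas q'].
  by split; exact: cont01_bmeas.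
have [bv bw] : bmeas v /\ bmeas w by split; exact: squeezed_bmeas.
have h1 : int01 v <= int01 q' by apply: le_int01 => // x /pq' /andP[].
have h2 : int01 p' <= int01 w by apply: le_int01 => // x /pq /andP[].
move: ip iq; rewrite /d !int01B//; lra.
Qed.

Lemma squeezed_squeeze u : (forall e : R, 0 < e -> exists v w, [/\ squeezed v, squeezed w,
    forall x, I x -> v x <= u x <= w x & int01 (fun x => w x - v x) < e]) -> squeezed u.
Proof.
move=> H e /H[v [w [sv sw vuw ie]]].
have [p [q [cp cq pv wq ie']]] := squeezed_between _ _ _ sv sw ie.
exists p, q; split => // x Ix; have /andP[? ?] := vuw x Ix.
by rewrite (le_trans (pv x Ix))//= (le_trans _ (wq x Ix)).
Qed.

Lemma ae_squeezed_squeeze u : (forall e : R, 0 < e -> exists v w, [/\ squeezed v, squeezed w,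
    {ae lambda, forall x, I x -> v x <= u x <= w x} & int01 (fun x => w x - v x) < e]) ->
  ae_squeezed u.
Proof.
move=> H e /H[v [w [sv sw vuw ie]]].
have [p [q [cp cq pv wq ie']]] := squeezed_between _ _ _ sv sw ie.
exists p, q; split => //; apply: filterS vuw => x + Ix => /(_ Ix) /andP[? ?].
by rewrite (le_trans (pv x Ix))//= (le_trans _ (wq x Ix)).
Qed.

End SqueezedModification.

(** * Step functions on uniform partitions *)

Section Steps.
Context {R : realType}.
Local Notation lambda := (@completed_lebesgue_measure R).
Local Notation I := (@I01 R).
Implicit Types (u v p q : R -> R).
Unset Implicit Arguments.

Lemma bmeas_indic (i : interval R) : bmeas (\1_[set` i] : R -> R).
Proof.
split; last by exists 1 => x _; rewrite indicE; case: (_ \in _); rewrite ?normr1 ?normr0.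
apply: measurable_indic; apply: sub_caratheodory; exact: measurable_itv.
Qed.

Lemma int01_indic (i : interval R) :
  int01 (\1_[set` i] : R -> R) = fine (lambda ([set` i] `&` I)).
Proof.
rewrite /int01 /Rintegral integral_indic//; first exact: measurable_I01.
apply: sub_caratheodory; exact: measurable_itv.
Qed.

Lemma le_int01_indic_cc (a b : R) : a <= b -> int01 (\1_(`[a, b]%classic) : R -> R) <= b - a.
Proof.
move=> ab; rewrite int01_indic -lee_fin fineK; last first.
  rewrite ge0_fin_numE//; apply: (@le_lt_trans _ _ (lambda I)).
    by apply: le_measure; rewrite ?inE; [apply: measurableI|exact: measurable_I01|exact: subIsetr];
     [apply: sub_caratheodory; exact: measurable_itv|exact: measurable_I01].
  by rewrite lambda_I01 ltry.
apply: (@le_trans _ _ (lambda `[a, b]%classic)).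
  apply: le_outer_measure; exact: subIsetl.
rewrite [leLHS](_ : _ = lebesgue_measure (`[a, b]%classic : set R))//.
by rewrite lebesgue_measure_itv /= lte_fin; case: ifPn => _; rewrite ?lee_fin ?subr_ge0.
Qed.

Lemma int01_indic_oc (a b : R) : 0 <= a -> a <= b -> b <= 1 ->
  int01 (\1_(`]a, b]%classic) : R -> R) = b - a.
Proof.
move=> a0 ab b1; rewrite int01_indic setIidl; last first.
  by move=> x /=; rewrite /I01 /= !in_itv /= => /andP[? ?]; apply/andP; split; lra.
rewrite [X in fine X](_ : _ = lebesgue_measure (`]a, b]%classic : set R))//.
rewrite lebesgue_measure_itv /= lte_fin.
by case: ltP => //= ba; apply/esym/eqP; rewrite subr_eq0 eq_le ab ba.
Qed.

Lemma continuous_clamp (d a : R) : continuous (fun x : R => Num.max 0 (Num.min 1 ((x - a) / d))).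
Proof.
move=> x; have h : {for x, continuous (fun y : R => (y - a) / d : R^o)}.
  by apply: cvgMl; apply: cvgB; [exact: cvg_id|exact: cvg_cst].
have cc (k : R) : {for x, continuous (fun=> k : R^o)} by exact: cvg_cst.
exact: (continuous_max (cc 0) (continuous_min (cc 1) h)).
Qed.

(** Two continuous ramps of width d, one ending and one starting at the jump. *)
Lemma squeezed_indic_ge (a : R) : squeezed (fun x => (a <= x)%R%:R).
Proof.
move=> e e0; pose d := e / 4; have d0 : 0 < d by rewrite divr_gt0.
pose F b (x : R) : R := Num.max 0 (Num.min 1 ((x - b) / d)).
have cF b : cont01 (F b).
  by move=> x; apply: continuous_subspaceT; exact: continuous_clamp.
have F01 b x : 0 <= F b x <= 1 by rewrite le_max lexx /= ge_max ler01 ge_min lexx.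
have F0 b x : x <= b -> F b x = 0.
  by move=> xb; apply/max_l; rewrite ge_min ler_pdivrMr// mul0r subr_le0 xb orbT.
have F1 b x : b + d <= x -> F b x = 1.
  move=> xb; rewrite /F min_l ?max_r ?ler01//.
  by rewrite ler_pdivlMr// mul1r lerBrDl.
exists (F a), (F (a - d)); split; [exact: cF|exact: cF| |].
  move=> x _; case: (leP a x) => ax; rewrite ?mulr1n ?mulr0n.
    have /andP[_ ->] := F01 a x.
    by rewrite (F1 (a - d)) ?lexx// subrK.

  by rewrite (F0 a) ?(ltW ax)// lexx /=; have /andP[] := F01 (a - d) x.
have -> : e = 4 * d by rewrite /d; field.
apply: (@le_lt_trans _ _ ((a + d) - (a - d))); last by lra.
apply: (@le_trans _ _ (int01 (\1_(`[a - d, a + d]%classic) : R -> R))).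
  apply: le_int01; [by apply: bmeasB; exact: cont01_bmeas|exact: bmeas_indic|].
  move=> x _; rewrite indicE; case: (boolP (x \in _)).
    move=> _ /=; have := F01 a x; have := F01 (a - d) x.
    by move=> /andP[_ ?] /andP[? _]; lra.
  move=> /negP xnot; suff -> : F (a - d) x = F a x by rewrite subrr.
  have [xa|ax] := leP x (a - d); first by rewrite !F0//; lra.
  have [xa'|ax'] := leP (a + d) x; first by rewrite !F1//; lra.
  by exfalso; apply: xnot; rewrite inE /= in_itv /=; apply/andP; split; lra.
by apply: le_int01_indic_cc; lra.
Qed.

(** Index of the cell of x in the partition of [0, 1] into n + 1 intervals of
    equal length, closed on the left; the minimum with n puts the endpoint 1
    into the last one. *)
Definition cell n (x : R) : nat := minn n (Num.truncn (x * n.+1%:R)).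

Lemma cell_le n x : (cell n x <= n)%N.
Proof. exact: geq_minl. Qed.

Lemma cell_gt n x j : (j < cell n x)%N = (j < n)%N && (j.+1%:R / n.+1%:R <= x).
Proof. by rewrite /cell ltn_min truncn_gt_nat ler_pdivrMr. Qed.

Lemma cell_itv n x : I x -> (cell n x)%:R / n.+1%:R <= x <= (cell n x).+1%:R / n.+1%:R.
Proof.
move=> /I01P /andP[x0 x1]; apply/andP; split.
  have [->|] := posnP (cell n x); first by rewrite mul0r.
  by move=> k0; have := cell_gt n x (cell n x).-1; rewrite prednK// leqnn => /esym/andP[].
have := cell_gt n x (cell n x); rewrite ltnn => /esym /negbT; rewrite negb_and.
case/orP; last by rewrite -ltNge => /ltW.
rewrite -leqNgt => nc; have -> : cell n x = n by apply/eqP; rewrite eqn_leq cell_le.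
by rewrite divff.
Qed.

(** A step function is the telescoping sum of its jumps, each of which is a
    multiple of an indicator function of the form a <= x. *)
Lemma squeezed_step n (c : nat -> R) : squeezed (fun x => c (cell n x)).
Proof.
pose F (j : 'I_n) (x : R) : R := (c j.+1 - c j) * (j.+1%:R / n.+1%:R <= x)%R%:R.
have sF : squeezed (fun x => c 0%N + \sum_(j < n) F j x).
  apply: squeezedD; first exact: squeezed_cont (cont01_cst _).
  by apply: squeezed_sum => j; apply: squeezedZ; exact: squeezed_indic_ge.
apply: eq_squeezed sF => x _.
have kn := cell_le n x; set k := cell n x in kn *.
rewrite (eq_bigr (fun j : 'I_n => if (j < k)%N then c j.+1 - c j else 0)); last first.
  move=> j _; rewrite /F /k cell_gt ltn_ord /=.
  by case: (_ <= x); rewrite ?mulr1 ?mulr0.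
rewrite -big_mkcond /= -(big_ord_widen n (fun j => c j.+1 - c j) kn).
by rewrite -(big_mkord xpredT (fun j => c j.+1 - c j)) telescope_sumr// addrC subrK.
Qed.

Lemma bmeas_sum n (F : 'I_n -> R -> R) : (forall i, bmeas (F i)) ->
  bmeas (fun x => \sum_(i < n) F i x).
Proof.
elim: n F => [|n IH] F bF.
  rewrite (_ : (fun x => _) = fun=> 0); first exact: bmeas_cst.
  by apply/funext => x; rewrite big_ord0.
rewrite (_ : (fun x => _) = fun x => \sum_(i < n) F (widen_ord (leqnSn n) i) x + F ord_max x).
  by apply: bmeasD => //; exact: IH.
by apply/funext => x; rewrite big_ord_recr.
Qed.

Lemma int01_sum n (F : 'I_n -> R -> R) : (forall i, bmeas (F i)) ->
  int01 (fun x => \sum_(i < n) F i x) = \sum_(i < n) int01 (F i).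
Proof.
elim: n F => [|n IH] F bF.
  rewrite big_ord0 (_ : (fun x => _) = fun=> 0) ?int01_cst//.
  by apply/funext => x; rewrite big_ord0.
rewrite big_ord_recr /= -(IH (fun i => F (widen_ord (leqnSn n) i)))// -int01D//.
  by congr int01; apply/funext => x; rewrite big_ord_recr.
exact: bmeas_sum.
Qed.

Lemma le_int01_step n (c : nat -> R) : (forall k, (k <= n)%N -> 0 <= c k) ->
  int01 (fun x => c (cell n x)) <= \sum_(k < n.+1) c k / n.+1%:R.
Proof.
move=> c0; pose J (k : nat) : set R := `[k%:R / n.+1%:R, k.+1%:R / n.+1%:R]%classic.
pose F (k : 'I_n.+1) (x : R) := c k * (\1_(J k) : R -> R) x.
have bJ (k : 'I_n.+1) : bmeas (\1_(J k) : R -> R) by exact: bmeas_indic.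
have bF k : bmeas (F k) by apply: bmeasM => //; exact: bmeas_cst.
apply: (@le_trans _ _ (int01 (fun x => \sum_(k < n.+1) F k x))).
  apply: le_int01; [exact: squeezed_bmeas (squeezed_step n c)|exact: bmeas_sum|].
  move=> x Ix; have kn : (cell n x < n.+1)%N by rewrite ltnS cell_le.
  rewrite (bigD1 (Ordinal kn))//= {1}/F /= indicE mem_set ?mulr1; last first.
    by rewrite /J /= in_itv /=; exact: cell_itv.
  rewrite lerDl; apply: sumr_ge0 => k _; apply: mulr_ge0; last by rewrite indicE.
  by apply: c0; rewrite -ltnS.
rewrite int01_sum//; apply: ler_sum => k _.
rewrite int01Z//; apply: ler_wpM2l; first by apply: c0; rewrite -ltnS.
apply: le_trans (le_int01_indic_cc _ _ _) _.
  by rewrite ler_pM2r ?invr_gt0// ler_nat.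
by rewrite -mulrBl -natrB ?leqnSn// subSnn mul1r.
Qed.

End Steps.

(** * Riemann sums of squeezed functions *)

Section Riemann.
Context {R : realType}.
Local Notation lambda := (@completed_lebesgue_measure R).
Local Notation I := (@I01 R).
Implicit Types (u v p q : R -> R).
Unset Implicit Arguments.

Definition real_riemann_sum u (a : R) (s t : seq R) : R :=
  \sum_(i < size s) (nth 0 s i - nth 0 (a :: s) i) * u (nth 0 t i).

Definition tagged (a b d : R) (s t : seq R) : Prop :=
  [/\ itv_partition a b s, size t = size s,
      (forall i, (i < size s)%N -> nth 0 s i - nth 0 (a :: s) i < d) &
      (forall i, (i < size s)%N -> nth 0 (a :: s) i <= nth 0 t i <= nth 0 s i)].

Definition has_riemann_integral u (J : R) : Prop := forall e : R, 0 < e -> exists2 d : R, 0 < d &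
    forall s t : seq R, tagged 0 1 d s t -> `|real_riemann_sum u 0 s t - J| < e.

Lemma Re_riemann_sum (f : R -> R[i]) a s t :
  complex.Re (riemann_sum f a s t) = real_riemann_sum (fun x => complex.Re (f x)) a s t.
Proof.
rewrite /riemann_sum /real_riemann_sum (big_morph _ (@cReD R) (erefl : complex.Re 0 = 0)).
by apply: eq_bigr => i _; rewrite cReM /= mul0r subr0.
Qed.

Lemma Im_riemann_sum (f : R -> R[i]) a s t :
  complex.Im (riemann_sum f a s t) = real_riemann_sum (fun x => complex.Im (f x)) a s t.
Proof.
rewrite /riemann_sum /real_riemann_sum (big_morph _ (@cImD R) (erefl : complex.Im 0 = 0)).
by apply: eq_bigr => i _; rewrite cImM /= mul0r addr0.
Qed.

Lemma ler_Re_normc (z : R[i]) : `|complex.Re z| <= Normc.normc z.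
Proof.
rewrite -ler_sqr ?nnegrE ?normr_ge0 ?normc_ge0// sqr_normcE real_normK ?num_real//.
by rewrite lerDl sqr_ge0.
Qed.

Lemma ler_Im_normc (z : R[i]) : `|complex.Im z| <= Normc.normc z.
Proof.
rewrite -ler_sqr ?nnegrE ?normr_ge0 ?normc_ge0// sqr_normcE real_normK ?num_real//.
by rewrite lerDr sqr_ge0.
Qed.

Lemma normc_le_ReIm (z : R[i]) : Normc.normc z <= `|complex.Re z| + `|complex.Im z|.
Proof.
rewrite -ler_sqr ?nnegrE ?addr_ge0 ?normr_ge0 ?normc_ge0// sqr_normcE sqrrD.
rewrite !real_normK ?num_real// -addrA lerD2l lerDr mulrn_wge0//.
Qed.

Lemma riemann01P (f : R -> R[i]) : riemann01 f <->
  (exists J, has_riemann_integral (fun x => complex.Re (f x)) J) /\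
  (exists J, has_riemann_integral (fun x => complex.Im (f x)) J).
Proof.
split => [[J H]|[[J1 H1] [J2 H2]]].
  split; [exists (complex.Re J)|exists (complex.Im J)] => e /H[d d0 Hd];
    exists d => // s t [h1 h2 h3 h4]; apply: le_lt_trans (Hd s t h1 h2 h3 h4).
  - have := ler_Re_normc (riemann_sum f 0 s t - J).
    by rewrite cReD Re_riemann_sum; case: (J).
  - have := ler_Im_normc (riemann_sum f 0 s t - J).
    by rewrite cImD Im_riemann_sum; case: (J).
exists (J1 +i* J2) => e e0; have e2 : 0 < e / 2 by rewrite divr_gt0.
have [d1 d10 Hd1] := H1 _ e2; have [d2 d20 Hd2] := H2 _ e2.
exists (Num.min d1 d2); first by rewrite lt_min d10.
move=> s t h1 h2 h3 h4; apply: le_lt_trans (normc_le_ReIm _) _.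
rewrite cReD cImD Re_riemann_sum Im_riemann_sum /= [ltRHS]splitr.
by apply: ltrD; [apply: Hd1|apply: Hd2]; split => // i /h3; rewrite lt_min => /andP[].
Qed.

Lemma tagged_cons a b d x s t : tagged a b d (x :: s) t -> exists c t',
  [/\ t = c :: t', a < x <= b, a <= c <= x, x - a < d & tagged x b d s t'].
Proof.
case: t => [|c t] [[/= /andP[ax xs] lb]] //= [sz] h3 h4.
exists c, t; split => //.
- have xb : itv_partition x b s by [].
  by rewrite ax (itv_partition_le xb).
- exact: (h4 0%N).
- exact: (h3 0%N).
- by split => // i si; [exact: (h3 i.+1)|exact: (h4 i.+1)].
Qed.

Lemma real_riemann_sum_cons u a x s c t : real_riemann_sum u a (x :: s) (c :: t) = (x - a) * u c + real_riemann_sum u x s t.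
Proof. by rewrite /real_riemann_sum big_ord_recl. Qed.

Lemma real_riemann_sum_nil u a t : real_riemann_sum u a [::] t = 0.
Proof. by rewrite /real_riemann_sum big_ord0. Qed.

Lemma le_real_riemann_sum u v a b d s t : 0 <= a -> b <= 1 -> tagged a b d s t ->
  (forall x, I x -> u x <= v x) -> real_riemann_sum u a s t <= real_riemann_sum v a s t.
Proof.
move=> + b1 + uv; elim: s a t => [|x s IH] a t a0; first by rewrite !real_riemann_sum_nil.
move=> /tagged_cons[c [t' [-> /andP[ax xb] /andP[ac cx] _ tag]]].
rewrite !real_riemann_sum_cons lerD ?IH//; last by lra.
rewrite ler_wpM2l ?subr_ge0 ?(ltW ax)// uv//; apply/I01P; lra.
Qed.

(** Heine's theorem: on the compact [0, 1], the modulus d found near each point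
    can be chosen uniformly. *)
Lemma cont01_uniform q : cont01 q -> forall e, 0 < e -> exists2 d, 0 < d &
  forall x y, I x -> I y -> `|x - y| < d -> `|q x - q y| < e.
Proof.
move=> cq e e0; have e2 : 0 < e / 2 by rewrite divr_gt0.
have : near_covering (`[0, 1]%classic : set R).
  by apply/compact_near_coveringP; exact: segment_compact.
move=> /(_ R (at_right 0)
  (fun d x => forall y, I x -> I y -> `|x - y| < d -> `|q x - q y| < e) _).
have H (x : R) : `[0, 1]%classic x -> \forall x' \near x & d \near 0^'+,
    forall y, I x' -> I y -> `|x' - y| < d -> `|q x' - q y| < e.
  move=> Ix; have /subspace_continuousP /(_ x Ix) /cvgrPdist_lt /(_ _ e2) := cq.
  rewrite /within /= => -[/= r r0 rP].
  exists (ball x (r / 2), [set d | d < r / 2]) => /=.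
    split; first by apply: nbhsx_ballx; rewrite divr_gt0.
    by apply: nbhs_right_lt; rewrite divr_gt0.
  move=> [x' d] /= [xx' dr] y Ix' Iy x'y.
  have h1 : `|q x - q x'| < e / 2.
    by apply: rP Ix' => /=; apply: lt_trans xx' _; rewrite ltr_pdivrMr// ltr_pMr// ltr1n.
  have h2 : `|q x - q y| < e / 2.
    apply: rP Iy => /=; rewrite /ball /= in xx'.
    rewrite (le_lt_trans (ler_distD x' _ _))// [ltRHS]splitr ltrD//.
    exact: lt_trans dr.
  by rewrite (le_lt_trans (ler_distD (q x) _ _))// distrC [ltRHS]splitr ltrD.
move=> /(_ H) h.
have [d [d0 dP]] := @filter_ex _ _ (at_right_proper_filter 0) _ (filterI (nbhs_right_gt 0) h).
by exists d => // x y Ix Iy; exact: dP.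
Qed.

(** Induction on the subdivision: on each subinterval q stays within e of its
    value at the tag. Half-open intervals make the pieces disjoint. *)
Lemma real_riemann_sum_approx q e d : 0 <= e -> cont01 q ->
  (forall x y, I x -> I y -> `|x - y| < d -> `|q x - q y| < e) ->
  forall s t a, 0 <= a -> tagged a 1 d s t ->
  `|real_riemann_sum q a s t - int01 (fun x => (\1_(`]a, 1]%classic) : R -> R) x * q x)| <= e * (1 - a).
Proof.
move=> e0 cq qd; have bq := cont01_bmeas cq.
have bind a b : bmeas (fun x => (\1_(`]a, b]%classic) : R -> R) x * q x).
  by apply: bmeasM => //; exact: bmeas_indic.
elim=> [|x s IH] t a a0.
  move=> [[_ /eqP /= ->] _ _ _].
  rewrite real_riemann_sum_nil (_ : (fun x => _) = fun=> 0) ?int01_cst ?subrr ?normr0 ?mulr0//.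
  by apply/funext => x; rewrite set_itvoc0 indic0 mul0r.
move=> /tagged_cons[c [t' [-> /andP[ax x1] /andP[ac cx] xad tag]]].
have x0 : 0 <= x by lra.
have {IH} := IH _ _ x0 tag.
rewrite real_riemann_sum_cons; set r := real_riemann_sum _ _ _ _ => IH.
have -> : int01 (fun y => (\1_(`]a, 1]%classic) : R -> R) y * q y) =
    int01 (fun y => (\1_(`]a, x]%classic) : R -> R) y * q y) +
    int01 (fun y => (\1_(`]x, 1]%classic) : R -> R) y * q y).
  rewrite -int01D//; congr int01; apply/funext => y; rewrite -mulrDl; congr (_ * _).
  rewrite !indicE !mem_setE !in_itv /=.
  have [yx|xy] := leP y x; first by rewrite (le_trans yx x1) andbT /= addr0.
  by rewrite andbF add0r (lt_trans ax xy) /=.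
suff : `|(x - a) * q c - int01 (fun y => (\1_(`]a, x]%classic) : R -> R) y * q y)| <= e * (x - a).
  by move: IH; rewrite !ler_norml => /andP[? ?] /andP[? ?]; apply/andP; split; lra.
have ix : int01 (\1_(`]a, x]%classic) : R -> R) = x - a by apply: int01_indic_oc => //; exact: ltW.
have bi k : bmeas (fun y => (\1_(`]a, x]%classic) : R -> R) y * k).
  by apply: bmeasM; [exact: bmeas_indic|exact: bmeas_cst].
have ik k : int01 (fun y => (\1_(`]a, x]%classic) : R -> R) y * k) = (x - a) * k.
  rewrite -ix mulrC -int01Z; last exact: bmeas_indic.
  by congr int01; apply/funext => y; rewrite mulrC.
have Ic : I c by apply/I01P; lra.
have key y : I y -> (\1_(`]a, x]%classic) : R -> R) y * (q c - e) <= (\1_(`]a, x]%classic) : R -> R) y * q y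
    <= (\1_(`]a, x]%classic) : R -> R) y * (q c + e).
  move=> Iy; rewrite indicE mem_setE in_itv /=.
  case: (boolP (a < y <= x)) => [/andP[ay yx]|_]; last by rewrite !mul0r lexx.
  rewrite !mul1r; have := qd c y Ic Iy; rewrite !ltr_norml.
  have cyd : - d < c - y < d by apply/andP; split; lra.
  by move=> /(_ cyd) /andP[? ?]; apply/andP; split; lra.
have h1 : (x - a) * (q c - e) <= int01 (fun y => (\1_(`]a, x]%classic) : R -> R) y * q y).
  by rewrite -ik; apply: le_int01 => // y /key /andP[].
have h2 : int01 (fun y => (\1_(`]a, x]%classic) : R -> R) y * q y) <= (x - a) * (q c + e).
  by rewrite -ik; apply: le_int01 => // y /key /andP[].
by rewrite ler_norml; apply/andP; split; lra.
Qed.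

Lemma cont01_riemann q : cont01 q -> has_riemann_integral q (int01 q).
Proof.
move=> cq e e0; have e2 : 0 < e / 2 by rewrite divr_gt0.
have [d d0 qd] := cont01_uniform _ cq _ e2; exists d => // s t tag.
have := real_riemann_sum_approx _ _ _ (ltW e2) cq qd s t 0 (lexx _) tag.
rewrite subr0 mulr1; set J := int01 _ => h.
have -> : int01 q = J; last by apply: le_lt_trans h _; rewrite ltr_pdivrMr// ltr_pMr// ltr1n.
have bq := cont01_bmeas cq.
have bJ : bmeas (fun x => (\1_(`]0, 1]%classic) : R -> R) x * q x).
  by apply: bmeasM => //; exact: bmeas_indic.
(* The half-open interval misses only the endpoint 0. *)
have h0 : {ae lambda, forall x, I x -> q x = (\1_(`]0, 1]%classic) : R -> R) x * q x}.
  exists [set 0]; split.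
  - by apply: sub_caratheodory; exact: measurable_set1.
  - by rewrite -[LHS]/(lebesgue_measure [set (0 : R)]) lebesgue_measure_set1.
  - move=> x /= /not_implyP[/I01P /andP[x0 x1]]; rewrite indicE mem_setE in_itv /= x1 andbT.
    by have [_|x0'] := ltP 0 x; [rewrite mul1r|move=> _; apply/eqP; rewrite eq_le x0 x0'].
apply/eqP; rewrite eq_le; apply/andP; split; apply: le_int01_ae => //;
  apply: filterS h0 => x + Ix => /(_ Ix) h1; rewrite -?h1; by rewrite lexx.
Qed.

Lemma squeezed_riemann u : squeezed u -> has_riemann_integral u (int01 u).
Proof.
move=> su e e0; have e2 : 0 < e / 2 by rewrite divr_gt0.
have [p [q [cp cq pq ie]]] := su _ e2.
have [bu bp bq] : [/\ bmeas u, bmeas p & bmeas q].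
  by split; [exact: squeezed_bmeas|exact: cont01_bmeas|exact: cont01_bmeas].
have [d1 d10 Hp] := cont01_riemann _ cp _ e2; have [d2 d20 Hq] := cont01_riemann _ cq _ e2.
exists (Num.min d1 d2); first by rewrite lt_min d10.
move=> s t tag.
have /Hp : tagged 0 1 d1 s t.
  by case: tag => ? ? h ?; split => // i /h; rewrite lt_min => /andP[].
have /Hq : tagged 0 1 d2 s t.
  by case: tag => ? ? h ?; split => // i /h; rewrite lt_min => /andP[].
have h1 : real_riemann_sum p 0 s t <= real_riemann_sum u 0 s t by apply: le_real_riemann_sum tag _ => // x /pq /andP[].
have h2 : real_riemann_sum u 0 s t <= real_riemann_sum q 0 s t by apply: le_real_riemann_sum tag _ => // x /pq /andP[].
have h3 : int01 p <= int01 u by apply: le_int01 => // x /pq /andP[].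
have h4 : int01 u <= int01 q by apply: le_int01 => // x /pq /andP[].
rewrite int01B// in ie.
by rewrite !ltr_norml => /andP[? ?] /andP[? ?]; apply/andP; split; lra.
Qed.

End Riemann.

(** * Riemann integrable functions are squeezed *)

Section RiemannSqueezed.
Context {R : realType}.
Implicit Types (u v p q : R -> R).
Unset Implicit Arguments.

Lemma real_riemann_sum_uniform u n (t : nat -> R) :
  real_riemann_sum u 0 (mkseq (fun k => k.+1%:R / n.+1%:R) n.+1) (mkseq t n.+1) =
  (\sum_(k < n.+1) u (t k)) / n.+1%:R.
Proof.
rewrite /real_riemann_sum size_mkseq mulr_suml; apply: eq_bigr => -[k kn] _ /=.
rewrite !nth_mkseq// mulrC; congr (_ * _).
case: k kn => [|k] kn; first by rewrite /= subr0 mul1r.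
rewrite -[nth _ _ _]/(nth 0 (mkseq (fun k => k.+1%:R / n.+1%:R) n.+1) k) nth_mkseq ?(ltnW kn)//.
by rewrite -mulrBl -natrB ?leqnSn// subSnn mul1r.
Qed.

Lemma tagged_uniform n d (t : nat -> R) : n.+1%:R^-1 < d ->
  (forall k, (k <= n)%N -> k%:R / n.+1%:R <= t k <= k.+1%:R / n.+1%:R) ->
  tagged 0 1 d (mkseq (fun k => k.+1%:R / n.+1%:R) n.+1) (mkseq t n.+1).
Proof.
move=> nd tk; pose s : seq R := mkseq (fun k => k.+1%:R / n.+1%:R) n.+1.
have sz : size s = n.+1 by rewrite size_mkseq.
have s0 k : (k < n.+1)%N -> nth 0 (0 :: s) k = k%:R / n.+1%:R.
  by case: k => [|k] kn /=; [rewrite mul0r|rewrite nth_mkseq// ltnW].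
split; rewrite ?size_mkseq//.
- split.
    apply/(pathP 0) => k; rewrite size_mkseq => kn.
    by rewrite s0// nth_mkseq// ltr_pM2r ?invr_gt0// ltr_nat.
  by rewrite -nth_last size_mkseq /= nth_mkseq// divff.
- move=> k kn; rewrite s0// nth_mkseq//.
  by rewrite -mulrBl -natrB ?leqnSn// subSnn mul1r.
- by move=> k kn; rewrite s0// !nth_mkseq//; exact: tk.
Qed.

(** On a uniform partition of mesh below d, any two choices of tags give close
    sums. Moving one tag only bounds u on each cell, so that the supremum M k
    and the infimum m k over the k-th cell exist; moving all tags close to
    these values bounds the gap between the step functions M and m. *)
Lemma riemann_squeezed u L : has_riemann_integral u L -> squeezed u.
Proof.
move=> ru; apply: squeezed_squeeze => e e0.
have e8 : 0 < e / 8 by rewrite divr_gt0.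
have [d d0 Hd] := ru _ e8.
have [n nd] : exists n : nat, n.+1%:R^-1 < d.
  exists (Num.truncn d^-1); rewrite -[ltRHS]invrK ltf_pV2 ?posrE ?invr_gt0//.
  exact: truncnS_gt.
set N : R := n.+1%:R; have N0 : 0 < N by rewrite /N.
pose J k : set R := [set x | k%:R / N <= x <= k.+1%:R / N].
have osc (t t' : nat -> R) : (forall k, (k <= n)%N -> J k (t k)) ->
    (forall k, (k <= n)%N -> J k (t' k)) ->
    \sum_(k < n.+1) (u (t k) - u (t' k)) < e / 4 * N.
  move=> tJ tJ'; rewrite -ltr_pdivrMr//.
  pose S (t : nat -> R) := \sum_(k < n.+1) u (t k).
  have -> : \sum_(k < n.+1) (u (t k) - u (t' k)) = S t - S t' by rewrite sumrB.
  rewrite mulrBl.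
  have := Hd _ _ (tagged_uniform n d t nd tJ).
  have := Hd _ _ (tagged_uniform n d t' nd tJ').
  rewrite !real_riemann_sum_uniform !ltr_norml -/N -/(S t) -/(S t') .
  by move: (S t / N) (S t' / N) => a b /andP[? ?] /andP[? ?]; lra.
pose l (k : nat) := k%:R / N.
have Jl k : J k (l k) by rewrite /J /l /= lexx ler_pM2r ?invr_gt0// ler_nat leqnSn.
(* Only the tag of the k-th cell moves. *)
have osc1 k x y : (k <= n)%N -> J k x -> J k y -> u x - u y < e / 4 * N.
  move=> kn Jx Jy.
  have := osc (fun j => if j == k then x else l j) (fun j => if j == k then y else l j).
  have kn' : (k < n.+1)%N by [].
  rewrite (bigD1 (Ordinal kn'))//= eqxx big1 ?addr0 => [|i ik]; last first.
    have -> : (i : nat) == k = false by apply/negbTE; apply: contraNneq ik => ik; exact/eqP/val_inj.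
    by rewrite subrr.
  by apply=> j _; case: eqP => [->|_].
pose B := e / 4 * N.
have hs k : (k <= n)%N -> has_sup (u @` J k).
  move=> kn; split; first by exists (u (l k)), (l k).
  by exists (u (l k) + B) => _ [x Jx <-]; have := osc1 k x (l k) kn Jx (Jl k); rewrite /B; lra.
have hi k : (k <= n)%N -> has_inf (u @` J k).
  move=> kn; split; first by exists (u (l k)), (l k).
  by exists (u (l k) - B) => _ [x Jx <-]; have := osc1 k (l k) x kn (Jl k) Jx; rewrite /B; lra.
pose M k := sup (u @` J k); pose m k := inf (u @` J k).
have uM k x : (k <= n)%N -> J k x -> m k <= u x <= M k.
  move=> kn Jx; apply/andP; split; first by apply: ge_inf; [exact: (hi k kn).2|exists x].
  by apply: ub_le_sup; [exact: (hs k kn).2|exists x].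
exists (fun x => m (cell n x)), (fun x => M (cell n x)); split.
- exact: squeezed_step.
- exact: squeezed_step.
- by move=> x Ix; apply: uM; [exact: cell_le|exact: cell_itv].
apply: (@le_lt_trans _ _ (\sum_(k < n.+1) (M k - m k) / n.+1%:R)).
  apply: (le_int01_step n (fun k => M k - m k)) => k kn.
  by rewrite subr_ge0; have /andP[] := uM k (l k) kn (Jl k); exact: le_trans.
rewrite -mulr_suml ltr_pdivrMr//.
have /choice[t tM] : forall k, exists x, (k <= n)%N -> J k x /\ M k - e / 8 < u x.
  move=> k; have [kn|kn] := leqP k n; last by exists 0.
  by have [_ [x Jx <-] h] := sup_adherent e8 (hs k kn); exists x.
have /choice[t' tm] : forall k, exists x, (k <= n)%N -> J k x /\ u x < m k + e / 8.
  move=> k; have [kn|kn] := leqP k n; last by exists 0.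
  by have [_ [x Jx <-] h] := inf_adherent e8 (hi k kn); exists x.
have h := osc t t' (fun k kn => (tM k kn).1) (fun k kn => (tm k kn).1).
apply: (@le_lt_trans _ _ (\sum_(k < n.+1) (u (t k) - u (t' k) + e / 4))).
  apply: ler_sum => k _; have kn : (k <= n)%N by rewrite -ltnS.
  have [_ ?] := tM k kn; have [_ ?] := tm k kn; lra.
rewrite big_split /= sumr_const card_ord -[e / 4 *+ _]mulr_natr -/N.
have := mulr_gt0 e0 N0; move: h; rewrite -/N.
have -> : e / 4 * N = e * N / 4 by ring.
by move: (e * N) (\sum_(k < n.+1) _) => a b; lra.
Qed.

Lemma riemann01_squeezed (f : R -> R[i]) : riemann01 f <->
  squeezed (fun x => complex.Re (f x)) /\ squeezed (fun x => complex.Im (f x)).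
Proof.
split=> [/riemann01P[[? /riemann_squeezed ?] [? /riemann_squeezed ?]]//|[s1 s2]].
by apply/riemann01P; split; eexists; exact: squeezed_riemann.
Qed.

End RiemannSqueezed.

(** * Bounded operators and completely contractive maps *)

Section Hilbert.
Context {R : realType} {H : lmodType R[i]} (dot : {dot H for @conjc R}).
Implicit Types (x y : H) (S T : bop dot).
Unset Implicit Arguments.
Local Notation hnorm := (hnorm dot).

Lemma dotDl x y z : dot (x + y) z = dot x z + dot y z.
Proof. exact: linearDl. Qed.

Lemma dotDr x y z : dot z (x + y) = dot z x + dot z y.
Proof. exact: linearDr. Qed.

Lemma dotZl a x z : dot (a *: x) z = a * dot x z.
Proof. exact: linearZl_LR. Qed.

Lemma dotZr a x z : dot z (a *: x) = a^*%C * dot z x.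
Proof. exact: linearZr_LR. Qed.

Lemma dotC x y : dot x y = (dot y x)^*%C.
Proof. by rewrite (@hermC _ _ _ _ dot) /= expr0 mul1r. Qed.

Lemma dotxx x : dot x x = (hnorm x ^+ 2)%:C.
Proof.
rewrite sqr_hnorm; have := @dnorm_ge0 _ _ dot x; rewrite lecE /= => /andP[/eqP].
by case: (dot x x) => a b /= ->.
Qed.

Lemma bop_linear T : linear T.
Proof. by have /bounded_operatorP[] := valP T. Qed.

Lemma bop_bounded T : exists2 M : R, 0 <= M & forall x, hnorm (T x) <= M * hnorm x.
Proof.
have /bounded_operatorP[_ [M TM]] := valP T; exists `|M| => // x.
by apply: le_trans (TM x) _; rewrite ler_wpM2r ?hnorm_ge0// ler_norm.
Qed.

Lemma bopD T x y : T (x + y) = T x + T y.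
Proof. by have := bop_linear T 1 x y; rewrite !scale1r. Qed.

Lemma bop0 T : T 0 = 0.
Proof. by apply: (addIr (T 0)); rewrite -bopD !add0r. Qed.

Lemma bopZ T a x : T (a *: x) = a *: T x.
Proof. by have := bop_linear T a x 0; rewrite !addr0 bop0 addr0. Qed.

Lemma bop_sum T n (F : 'I_n -> H) : T (\sum_(i < n) F i) = \sum_(i < n) T (F i).
Proof.
elim: n F => [|n IH] F; first by rewrite !big_ord0 bop0.
by rewrite !big_ord_recr /= bopD IH.
Qed.

Lemma addbopE S T x : (S + T)%R x = S x + T x. Proof. by []. Qed.
Lemma scalebopE a T x : (a *: T)%R x = a *: T x. Proof. by []. Qed.
Lemma oppbopE T x : (- T)%R x = - T x. Proof. by []. Qed.
Lemma mulbopE S T x : bop_mul S T x = S (T x). Proof. by []. Qed.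
Lemma zerobopE x : (0 : bop dot) x = 0. Proof. by []. Qed.

(** Expand the nonnegative square norm of x - a y, where a is the coefficient
    of the orthogonal projection of x on y. *)
Lemma cauchy_schwarz x y : Normc.normc (dot x y) <= hnorm x * hnorm y.
Proof.
have n0 z : 0 <= hnorm z := hnorm_ge0 dot z.
have [y0|y0] := eqVneq y 0.
  by rewrite y0 [dot x 0]linear0r Normc.normc0 mulr_ge0.
have N0 : 0 < hnorm y ^+ 2.
  by have := @dnorm_gt0 _ _ dot y; rewrite y0 dotxx ltcR.
rewrite -ler_sqr ?nnegrE ?mulr_ge0 ?normc_ge0// exprMn.
set N := hnorm y ^+ 2 in N0 *.
pose a := N^-1%:C * dot x y.
have : 0 <= dot (x + (- a) *: y) (x + (- a) *: y) by exact: dnorm_ge0.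
rewrite dotDl !dotDr dotZl !dotZr dotZl (dotC y x) !dotxx -/N lecE => /andP[_].
rewrite sqr_normcE /a; case: (dot x y) => c d /=.
rewrite !mul0r !mulr0 !subr0 !addr0.
rewrite -(ler_pM2r N0) mul0r => h.
rewrite -subr_ge0; apply: le_trans h _; rewrite le_eqVlt; apply/orP; left; apply/eqP.
by field; exact: lt0r_neq0.
Qed.

(** Over the complex numbers the quadratic form of T determines T: evaluate it
    at x + y and at x + i y. *)
Lemma polarization_eq0 T : (forall x, dot (T x) x = 0) -> T = 0.
Proof.
move=> T0; apply: bop_ext => x; rewrite zerobopE.
suff d0 y : dot (T x) y = 0.
  by apply/eqP; rewrite -(@dnorm_eq0 _ _ dot) d0.
have h1 : dot (T x) y + dot (T y) x = 0.
  by have := T0 (x + y); rewrite bopD dotDl !dotDr !T0 addr0 add0r.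
have h2 : dot (T x) y - dot (T y) x = 0.
  have := T0 (x + 'i *: y); rewrite bopD bopZ dotDl !dotDr dotZl !dotZr dotZl !T0.
  rewrite !mulr0 addr0 add0r => h.
  have : 'i * (dot (T x) y - dot (T y) x) = 0.
    move: h; case: (dot _ _) => a b; case: (dot _ _) => c d /eqP.
    rewrite eq_complex /= => /andP[/eqP e1 /eqP e2]; apply/eqP.
    by rewrite eq_complex /=; apply/andP; split; apply/eqP; lra.
  by move/eqP; rewrite mulf_eq0 => /orP[|/eqP//]; rewrite eq_complex /= oner_eq0 andbF.
have : dot (T x) y *+ 2 = 0 by rewrite mulr2n -[X in _ + X](subrK (dot (T y) x)) h2 add0r.
by move/eqP; rewrite mulrn_eq0 => /orP[//|/eqP].
Qed.

Lemma hnormnE n (x : 'I_n -> H) : hnormn dot x ^+ 2 = \sum_(i < n) hnorm (x i) ^+ 2.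
Proof. by rewrite sqr_sqrtr// sumr_ge0// => i _; exact: sqr_ge0. Qed.

Lemma hnormn_ge0 n (x : 'I_n -> H) : 0 <= hnormn dot x.
Proof. exact: sqrtr_ge0. Qed.

Lemma le_hnormn n (x y : 'I_n -> H) (C : R) : 0 <= C ->
  hnormn dot x <= C * hnormn dot y <->
  \sum_(i < n) hnorm (x i) ^+ 2 <= C ^+ 2 * \sum_(i < n) hnorm (y i) ^+ 2.
Proof.
move=> C0; rewrite -!hnormnE -exprMn ler_sqr ?nnegrE ?hnormn_ge0//.
by rewrite mulr_ge0 ?hnormn_ge0.
Qed.

Lemma mxopnorm_ge0 n (T : 'M[bop dot]_n) : (0%:E <= mxopnorm T)%E.
Proof.
apply: ereal_sup_ubound; exists (fun=> 0); rewrite /= /hnormn.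
  by rewrite big1 ?sqrtr0// => i _; rewrite /Defs.hnorm linear0r sqrtr0 expr0n.
rewrite big1 ?sqrtr0// => i _; rewrite /mxact big1 => [|j _]; last exact: bop0.
by rewrite /Defs.hnorm linear0r sqrtr0 expr0n.
Qed.

Lemma hnormnZ n (a : R) (x : 'I_n -> H) : 0 <= a ->
  hnormn dot (fun i => a%:C *: x i) = a * hnormn dot x.
Proof.
move=> a0; apply/eqP; rewrite -(@eqrXn2 _ 2)// ?hnormn_ge0 ?mulr_ge0 ?hnormn_ge0//.
rewrite exprMn !hnormnE mulr_sumr; apply/eqP/eq_bigr => i _.
by rewrite hnormZ exprMn sqr_normcE /= expr0n addr0.
Qed.

Lemma mxopnorm_le n (T : 'M[bop dot]_n) (M : R) : 0 <= M ->
  (mxopnorm T <= M%:E)%E <->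
  (forall x : 'I_n -> H, hnormn dot (mxact T x) <= M * hnormn dot x).
Proof.
move=> M0; split => [TM x|TM]; last first.
  apply: ub_ereal_sup => _ [x /= x1 <-]; rewrite lee_fin (le_trans (TM x))//.
  by rewrite -[leRHS]mulr1 ler_wpM2l.
have act a : mxact T (fun i => a *: x i) = fun i => a *: mxact T x i.
  by apply/funext => i; rewrite /mxact scaler_sumr; apply: eq_bigr => j _; rewrite bopZ.
(* A vector of norm 0 stays in the unit ball under any scaling. *)
have [x0|x0] := eqVneq (hnormn dot x) 0.
  rewrite x0 mulr0; apply/ler_addgt0Pr => e e0; rewrite add0r.
  have k0 : 0 <= (M + 1) / e by rewrite divr_ge0 ?addr_ge0// ltW.
  have : (((M + 1) / e * hnormn dot (mxact T x))%:E <= M%:E)%E.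
    apply: le_trans TM; apply: ereal_sup_ubound.
    exists (fun i => ((M + 1) / e)%:C *: x i); first by rewrite /= hnormnZ// x0 mulr0.
    by rewrite act hnormnZ.
  rewrite lee_fin mulrAC ler_pdivrMr// => h.
  rewrite -(@ler_pM2l _ (M + 1)) ?ltr_wpDl//; apply: le_trans h _.
  by rewrite ler_pM2r// lerDl.
have xgt0 : 0 < hnormn dot x by rewrite lt_neqAle eq_sym x0 hnormn_ge0.
have : (((hnormn dot x)^-1 * hnormn dot (mxact T x))%:E <= M%:E)%E.
  apply: le_trans TM; apply: ereal_sup_ubound.
  exists (fun i => ((hnormn dot x)^-1)%:C *: x i).
    by rewrite /= hnormnZ ?invr_ge0 ?hnormn_ge0// mulVf.
  by rewrite act hnormnZ// invr_ge0 hnormn_ge0.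
by rewrite lee_fin ler_pdivrMl// mulrC.
Qed.

(** Trades inequalities between extended-real suprema for the bounds that they
    express; all later estimates are of the second kind. *)
Lemma completely_contractiveP (phi : bop dot -> bop dot) :
  (forall n (T : 'M[bop dot]_n) (M : R), 0 <= M ->
    (forall x : 'I_n -> H, hnormn dot (mxact T x) <= M * hnormn dot x) ->
    (forall x : 'I_n -> H, hnormn dot (mxact (map_mx phi T) x) <= M * hnormn dot x)) <->
  completely_contractive phi.
Proof.
split=> [h n T|h n T M M0 /(mxopnorm_le _ T _ M0) TM]; last first.
  by apply/mxopnorm_le => //; apply: le_trans TM; exact: h.
have := mxopnorm_ge0 _ T; case E : (mxopnorm T) => [M| |]//; last by move=> _; exact: leey.
rewrite lee_fin => M0; apply/mxopnorm_le => //; apply: h => //.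
by apply/mxopnorm_le => //; rewrite E.
Qed.

Lemma completely_contractive1 (phi : bop dot -> bop dot) (T : bop dot) (M : R) : 0 <= M ->
  completely_contractive phi ->
  (forall x, hnorm (T x) <= M * hnorm x) -> (forall x, hnorm (phi T x) <= M * hnorm x).
Proof.
move=> M0 /completely_contractiveP h TM x.
have n1 (y : 'I_1 -> H) : hnormn dot y = hnorm (y ord0).
  by rewrite /hnormn big_ord1 sqrtr_sqr ger0_norm// hnorm_ge0.
have := h 1%N (const_mx T) M M0 _ (fun=> x).
rewrite !n1 /mxact big_ord1 !mxE; apply => y.
by rewrite !n1 /mxact big_ord1 mxE.
Qed.

Lemma hnorm_eq0 x : (hnorm x == 0) = (x == 0).
Proof.
by rewrite -(@dnorm_eq0 _ _ dot) dotxx eq_complex /= eqxx andbT sqrf_eq0.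
Qed.

Lemma hnormN x : hnorm (- x) = hnorm x.
Proof. by rewrite -scaleN1r hnormZ; rewrite /= oppr0 expr0n addr0 sqrrN expr1n sqrtr1 mul1r. Qed.

Lemma hnorm_le2 x y (c : R) : hnorm x <= c -> hnorm y <= c -> hnorm (x + y) <= 2 * c.
Proof.
move=> xc yc; have c0 : 0 <= c by apply: le_trans xc; exact: hnorm_ge0.
rewrite -ler_sqr ?nnegrE ?hnorm_ge0 ?mulr_ge0//; apply: le_trans (Defs.hnormD _ _ _) _.
have h (z : H) : hnorm z <= c -> hnorm z ^+ 2 <= c ^+ 2.
  by move=> zc; rewrite ler_sqr ?nnegrE ?hnorm_ge0.
by have := h x xc; have := h y yc; rewrite exprMn; lra.
Qed.

Lemma opnorm_bound (T : bop dot) (M : R) : 0 <= M -> (opnorm T <= M%:E)%E ->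
  forall x, hnorm (T x) <= M * hnorm x.
Proof.
move=> M0 TM x.
have n1 (y : 'I_1 -> H) : hnormn dot y = hnorm (y ord0).
  by rewrite /hnormn big_ord1 sqrtr_sqr ger0_norm// hnorm_ge0.
have : (mxopnorm (const_mx T : 'M[bop dot]_1) <= M%:E)%E.
  apply: ub_ereal_sup => _ [y /= y1 <-]; apply: le_trans TM; apply: ereal_sup_ubound.
  by exists (y ord0); [rewrite /= -n1|rewrite n1 /mxact big_ord1 mxE].
by move=> /(mxopnorm_le _ _ _ M0) /(_ (fun=> x)); rewrite !n1 /mxact big_ord1 mxE.
Qed.

(** A S B acts on each matrix entry, so that the amplification of this map to
    matrices is conjugation by the diagonal amplifications of A and B. *)
Lemma completely_contractive_compression (A B : bop dot) :
  (forall x, hnorm (A x) <= hnorm x) -> (forall x, hnorm (B x) <= hnorm x) ->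
  completely_contractive (fun S => bop_mul A (bop_mul S B)).
Proof.
move=> A1 B1; apply/completely_contractiveP => n T M M0 TM x.
have le2 (u v : R) : 0 <= u -> u <= v -> u ^+ 2 <= v ^+ 2.
  by move=> u0 uv; rewrite ler_sqr// nnegrE (le_trans u0).
apply: (@le_trans _ _ (hnormn dot (mxact T (fun i => B (x i))))).
  apply: ler_wsqrtr; apply: ler_sum => i _; apply: le2; first exact: hnorm_ge0.
  rewrite [X in hnorm X](_ : _ = A (mxact T (fun i => B (x i)) i)) ?A1//.
  by rewrite /mxact bop_sum; apply: eq_bigr => j _; rewrite mxE.
apply: le_trans (TM _) _; rewrite ler_wpM2l// ler_wsqrtr//.
by apply: ler_sum => i _; apply: le2; [exact: hnorm_ge0|exact: B1].
Qed.

End Hilbert.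

(** * Multiplication operators on square-integrable functions *)

Section Multiplication.
Context {R : realType}.
Local Notation lambda := (@completed_lebesgue_measure R).
Local Notation I := (@I01 R).
Local Notation Linf := (Linfty lambda I).
Local Notation L2f := (L2fun lambda (@measurable_I01 R)).
Local Notation H := (L2_01 R).
Local Notation hn := (hnorm (dot01 R)).
Local Notation cls := (@L2class _ _ R lambda I (@measurable_I01 R)).
Implicit Types (u v : R -> R) (f g : R -> R[i]) (x y : H).
Unset Implicit Arguments.

Definition ofreal u : R -> R[i] := fun t => (u t)%:C.

Lemma bmeas_Linf {u} : bmeas u -> Linf (ofreal u).
Proof.
move=> [mu [M uM]]; split; first by split => //; exact: measurable_cst.
exists M; apply: aeW => t It; apply: le_trans (uM t It).
by rewrite -ler_sqr ?nnegrE ?normc_ge0// sqr_normcE /= expr0n addr0 real_normK ?num_real.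
Qed.

Lemma Linf_bmeas f : cmeasurable I f -> (exists M, forall t, I t -> Normc.normc (f t) <= M) ->
  Linf f.
Proof. by move=> mf [M fM]; split => //; exists M; exact: aeW. Qed.

Lemma Linf_cst a : Linf (fun=> a).
Proof.
apply: Linf_bmeas; first by split; exact: measurable_cst.
by exists (Normc.normc a).
Qed.

Lemma LinfM {f g} : Linf f -> Linf g -> Linf (fun t => f t * g t).
Proof.
move=> [mf [M fM]] [mg [N gN]]; split; first exact: cmeasurableM.
exists (M * N); apply: filterS2 fM gN => t h1 h2 It.
by rewrite Normc.normcM ler_pM ?normc_ge0 ?h1 ?h2.
Qed.

Lemma LinfD {f g} : Linf f -> Linf g -> Linf (fun t => f t + g t).
Proof.
move=> [mf [M fM]] [mg [N gN]]; split; first exact: cmeasurableD.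
exists (M + N); apply: filterS2 fM gN => t h1 h2 It.
by apply: le_trans (le_normcD _ _) _; rewrite lerD ?h1 ?h2.
Qed.

Lemma LinfZ a {f} : Linf f -> Linf (fun t => a * f t).
Proof. by move=> Lf; exact: LinfM (Linf_cst a) Lf. Qed.

Lemma LinfJ {f} : Linf f -> Linf (fun t => (f t)^*%C).
Proof.
move=> [mf [M fM]]; split; first exact: cmeasurableJ.
exists M; apply: filterS fM => t h It; apply: le_trans (h It).
by rewrite -ler_sqr ?nnegrE ?normc_ge0// !sqr_normcE cReJ cImJ sqrrN.
Qed.

Lemma pi01E {f} (Lf : Linf f) (g : L2f) : pi01 f (cls g) = cls (mulfun Lf g).
Proof. exact: (mulopE Lf). Qed.

(** pi01 f is multiplication by f only if f is essentially bounded, which is why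
    the algebraic rules carry Linf hypotheses. *)
Lemma pi01_lin a {f g} : Linf f -> Linf g ->
  pi01 (fun t => a * f t + g t) = a *: pi01 f + pi01 g.
Proof.
move=> Lf Lg; have Lh : Linf (fun t => a * f t + g t) by exact: LinfD (LinfZ a Lf) Lg.
apply: bop_ext => x; rewrite addbopE scalebopE -(L2class_repr x).
rewrite (pi01E Lh) (pi01E Lf) (pi01E Lg) -L2classZ -L2classD; apply/L2classP/aeW => t _ /=.
rewrite -[LHS]/((a * f t + g t) * repr x t).
by rewrite -[RHS]/(a * (f t * repr x t) + g t * repr x t) mulrDl mulrA.
Qed.

Lemma pi01_mul {f g} : Linf f -> Linf g ->
  pi01 (fun t => f t * g t) = bop_mul (pi01 f) (pi01 g).
Proof.
move=> Lf Lg; apply: bop_ext => x; rewrite mulbopE -(L2class_repr x).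
rewrite (pi01E (LinfM Lf Lg)) (pi01E Lg) (pi01E Lf).
by apply/L2classP/aeW => t _ /=; rewrite mulrA.
Qed.

Lemma pi01_adjoint {f} : Linf f -> is_adjoint (pi01 f) (pi01 (fun t => (f t)^*%C)).
Proof.
move=> Lf x y; rewrite -(L2class_repr x) -(L2class_repr y) (pi01E Lf) (pi01E (LinfJ Lf)).
rewrite [LHS]L2dotE [RHS]L2dotE; congr cintegral; apply/funext => t /=.
by rewrite rmorphM /= conjcK; ring.
Qed.

Lemma pi01_ae f g : Linf f -> Linf g -> {ae lambda, forall t, I t -> f t = g t} ->
  pi01 f = pi01 g.
Proof. by move=> Lf Lg fg; apply/(pi01_eqP Lf Lg). Qed.

Lemma pi01_1 x : pi01 (fun=> 1) x = x.
Proof.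
rewrite -(L2class_repr x) (pi01E (Linf_cst 1)); apply/L2classP/aeW => t _ /=.
by rewrite mul1r.
Qed.

Lemma hnorm_cls (g : L2f) : hn (cls g) ^+ 2 = \int[lambda]_(t in I) Normc.normc (g t) ^+ 2.
Proof.
have -> : hn (cls g) = Num.sqrt (\int[lambda]_(t in I) Normc.normc (g t) ^+ 2).
  exact: hnorm_L2class.
by rewrite sqr_sqrtr// Rintegral_ge0// => t _; exact: sqr_ge0.
Qed.

Lemma sq_int (g : L2f) : lambda.-integrable I (EFin \o (fun t => Normc.normc (g t) ^+ 2)).
Proof. by have /sq_integrableP[] := valP g. Qed.

Lemma le_Rintegral_ae (a b : R -> R) : lambda.-integrable I (EFin \o a) ->
  lambda.-integrable I (EFin \o b) -> {ae lambda, forall t, I t -> a t <= b t} ->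
  \int[lambda]_(t in I) a t <= \int[lambda]_(t in I) b t.
Proof.
move=> ia ib ab.
have [ma mb] : measurable_fun I a /\ measurable_fun I b.
  by split; apply/measurable_EFinP; [exact: measurable_int ia|exact: measurable_int ib].
have mm : measurable_fun I (fun t => Num.max (a t) (b t)) by exact: measurable_maxr.
have E : ae_eq lambda I (EFin \o b) (EFin \o (fun t => Num.max (a t) (b t))).
  by apply: filterS ab => t + It => /(_ It) h /=; rewrite max_r.
have im : lambda.-integrable I (EFin \o (fun t => Num.max (a t) (b t))).
  have ian := integrable_norm ia.
  have ibn := integrable_norm ib.
  apply: (le_integrable (@measurable_I01 R) _ _ (integrableD (@measurable_I01 R) ian ibn)).
    exact/measurable_EFinP.
  move=> t _ /=; rewrite lee_fin [leRHS]ger0_norm ?addr_ge0//.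
  by have [_|_] := leP (a t) (b t); rewrite ?lerDl ?lerDr.
have -> : \int[lambda]_(t in I) b t = \int[lambda]_(t in I) Num.max (a t) (b t).
  congr fine; apply: ae_eq_integral E; [exact: measurable_I01|exact/measurable_EFinP..].
by apply: le_Rintegral => // [|t _]; [exact: measurable_I01|rewrite le_max lexx].
Qed.

Lemma pi01_norm {f} (M : R) : Linf f -> 0 <= M ->
  {ae lambda, forall t, I t -> Normc.normc (f t) <= M} ->
  forall x, hn (pi01 f x) <= M * hn x.
Proof.
move=> Lf M0 fM x; rewrite -(L2class_repr x) (pi01E Lf).
rewrite -ler_sqr ?nnegrE ?mulr_ge0 ?hnorm_ge0// exprMn !hnorm_cls.
rewrite -RintegralZl; [|exact: measurable_I01|exact: sq_int].
apply: le_Rintegral_ae; [exact: sq_int| |].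
  exact: (integrableZl (@measurable_I01 R) (M ^+ 2) (sq_int _)).
exact: mulfun_bound.
Qed.

Lemma integrable_bmeasM {v} {w : R -> R} : bmeas v -> lambda.-integrable I (EFin \o w) ->
  lambda.-integrable I (EFin \o (fun t => v t * w t)).
Proof.
move=> [mv [M vM]] iw.
apply: (le_integrable (@measurable_I01 R) _ _ (integrableZl (@measurable_I01 R) M (integrable_norm iw))).
  apply/measurable_EFinP; apply: measurable_funM => //.
  by apply/measurable_EFinP; exact: measurable_int iw.
move=> t It /=; rewrite lee_fin !normrM normr_id ler_wpM2r//.
by rewrite (le_trans (vM _ It))// ler_norm.
Qed.

Lemma dot_real v x : bmeas v -> dot01 R (pi01 (ofreal v) x) x =
  (\int[lambda]_(t in I) (v t * Normc.normc (repr x t) ^+ 2))%:C.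
Proof.
move=> bv; rewrite -{1 2}(L2class_repr x) (pi01E (bmeas_Linf bv)) [LHS]L2dotE /cintegral.
congr (_ +i* _); last first.
  rewrite /Rintegral (eq_integral (fun=> 0%E)) ?integral0// => t _ /=.
  by rewrite !cImM !cReM !cReJ !cImJ; congr (_%:E); rewrite /=; ring.
by apply: eq_Rintegral => t _; rewrite !cReM cReJ cImJ !cImM sqr_normcE /=; ring.
Qed.

End Multiplication.

(** * Unital contractive maps on squeezed symbols *)

Section Fixed.
Context {R : realType}.
Local Notation lambda := (@completed_lebesgue_measure R).
Local Notation I := (@I01 R).
Local Notation Linf := (Linfty lambda I).
Local Notation H := (L2_01 R).
Local Notation hn := (hnorm (dot01 R)).
Local Notation V := (@pi01 R @` @continuous01 R).
Implicit Types (u v : R -> R) (f g : R -> R[i]) (x y : H).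
Unset Implicit Arguments.

Lemma integral_truncation (w : R -> R) : lambda.-integrable I (EFin \o w) ->
  (forall t, I t -> 0 <= w t) -> forall e, 0 < e -> exists n : nat,
  \int[lambda]_(t in I) (w t - Num.min (w t) n%:R) < e.
Proof.
move=> iw w0 e e0; have mw := (measurable_EFinP I w).1 (measurable_int _ iw).
pose f_ (n : nat) (t : R) := (w t - Num.min (w t) n%:R)%:E.
have mf n : measurable_fun I (f_ n).
  apply/measurable_EFinP; apply: (measurable_funB mw).
  exact: measurable_minr mw (measurable_cst _).
have fw n t : I t -> 0 <= w t - Num.min (w t) n%:R <= w t.
  move=> It; have := w0 t It; rewrite subr_ge0 ge_min lexx /= => wt.
  by rewrite gerBl le_min wt ler0n.
have f0 : {ae lambda, forall t, I t -> f_ ^~ t @ \oo --> 0%E}.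
  apply: aeW => t It; apply: cvg_near_cst.
  near=> n; rewrite /f_ min_l ?subrr//.
  apply: (@le_trans _ _ (Num.truncn (w t)).+1%:R); first exact: ltW (truncnS_gt _).
  by rewrite ler_nat; near: n; exact: nbhs_infty_ge.
have fle : {ae lambda, forall t n, I t -> (`|f_ n t| <= (EFin \o w) t)%E}.
  apply: aeW => t n It; have /andP[h1 h2] := fw n t It.
  by rewrite /f_ /= lee_fin ger0_norm.
have [_ _] := @dominated_convergence _ _ R lambda I (@measurable_I01 R) f_ (fun=> 0%E)
  (EFin \o w) mf (measurable_cst _) f0 iw fle.
rewrite integral0 => /fine_cvgP[_] /cvgrPdist_lt /(_ e e0) [N _ /(_ N (leqnn _))].
rewrite /= sub0r normrN => h; exists N; apply: le_lt_trans h.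
exact: ler_norm.
Unshelve. all: by end_near. Qed.

(** The inequality is the bound for the point (a, b) of the numerical range of
    an operator of norm at most sqrt (c^2 / 4 + t^2). Its two sides have the
    same coefficient of t^2, so the term 2 t b N, linear in t, has to vanish;
    then t = 0 gives the sign of a. *)
Lemma positivity_algebra (a b c N : R) : 0 <= N -> 0 <= c ->
  (forall t, (a - c / 2 * N) ^+ 2 + (b + t * N) ^+ 2 <= (c ^+ 2 / 4 + t ^+ 2) * N ^+ 2) ->
  b = 0 /\ 0 <= a.
Proof.
move=> N0 c0 h; split; last first.
  have := h 0; rewrite mul0r addr0 expr0n addr0 => h0.
  have cN := mulr_ge0 c0 N0; have := sqr_ge0 b; nra.
apply/eqP/negPn/negP => b0.
have b2 : 0 < b ^+ 2 by rewrite exprn_even_gt0.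
have [N00|Nneq] := eqVneq N 0; first by have := h 0; rewrite N00; nra.
(* At t = K / (b N) the linear term is 2 K, more than the bound allows. *)
pose K := (c ^+ 2 / 4) * N ^+ 2 + 1.
have := h (K / (b * N)).
have -> : (b + K / (b * N) * N) ^+ 2 = b ^+ 2 + 2 * K + (K / b) ^+ 2.
  by field; rewrite b0 Nneq.
have -> : (c ^+ 2 / 4 + (K / (b * N)) ^+ 2) * N ^+ 2 = (K - 1) + (K / b) ^+ 2.
  by rewrite /K; field; rewrite b0 Nneq.
have := sqr_ge0 (a - c / 2 * N).
have : 1 <= K by rewrite /K lerDr mulr_ge0 ?sqr_ge0 ?divr_ge0 ?sqr_ge0.
lra.
Qed.

(** If p <= u <= q with p and q continuous, positivity puts s u between the
    integrals of p w and q w, so it suffices to make the integral of (q - p) w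
    small. Cut w at a level n: below n the integral of q - p controls it; above
    n, q - p stays under a bound c independent of e, and the rest of w has a
    small integral. *)
Lemma positive_functional_squeezed (s : (R -> R) -> R[i]) (w : R -> R) :
  lambda.-integrable I (EFin \o w) -> (forall t, 0 <= w t) ->
  (forall a v v', bmeas v -> bmeas v' ->
     s (fun t => a * v t + v' t) = a%:C * s v + s v') ->
  (forall v, bmeas v -> (forall t, I t -> 0 <= v t) ->
     complex.Im (s v) = 0 /\ 0 <= complex.Re (s v)) ->
  (forall v, cont01 v -> s v = (\int[lambda]_(t in I) (v t * w t))%:C) ->
  forall u, squeezed u -> s u = (\int[lambda]_(t in I) (u t * w t))%:C.
Proof.
move=> iw w0 s_lin s_pos s_cont u su; have bu := squeezed_bmeas su.
pose J v := \int[lambda]_(t in I) (v t * w t).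
have JB v v' : bmeas v -> bmeas v' -> J (fun t => v t - v' t) = J v - J v'.
  move=> bv bv'; rewrite /J -RintegralB; [|exact: measurable_I01|exact: integrable_bmeasM..].
  by apply: eq_Rintegral => t _; rewrite mulrBl.
have le_J v v' : bmeas v -> bmeas v' -> (forall t, I t -> v t <= v' t) -> J v <= J v'.
  move=> bv bv' vv'; apply: le_Rintegral; [exact: measurable_I01|exact: integrable_bmeasM..|].
  by move=> t It; rewrite ler_wpM2r// vv'.
have cont p q : cont01 p -> cont01 q -> (forall t, I t -> p t <= u t <= q t) ->
    complex.Im (s u) = 0 /\ J p <= complex.Re (s u) <= J q.
  move=> cp cq pq; have bp := cont01_bmeas cp; have bq := cont01_bmeas cq.
  have bqu : bmeas (fun t => (-1) * u t + q t) := bmeasD (bmeasM (bmeas_cst (-1)) bu) bq.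
  have bup : bmeas (fun t => (-1) * p t + u t) := bmeasD (bmeasM (bmeas_cst (-1)) bp) bu.
  have [] := s_pos _ bqu; first by move=> t /pq /andP[_ h]; rewrite mulN1r addrC subr_ge0.
  have [] := s_pos _ bup; first by move=> t /pq /andP[h _]; rewrite mulN1r addrC subr_ge0.
  rewrite (s_lin _ _ _ bp bu) (s_lin _ _ _ bu bq) (s_cont _ cp) (s_cont _ cq) -/(J p) -/(J q).
  move: (J p) (J q) (s u); clear=> jp jq [a b] /=.
  rewrite !mul0r !mulr0 !subr0 !addr0 => ? ? ? ?.
  by split; [lra|apply/andP; split; lra].
have [p0 [q0 [cp0 cq0 pq0 _]]] := su _ ltr01.
have [Ims _] := cont _ _ cp0 cq0 pq0.
suff Res : complex.Re (s u) = J u by move: Ims Res; case: (s u) => a b /= -> ->.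
have [_ [c cP]] := bmeasB (cont01_bmeas cq0) (cont01_bmeas cp0).
have c0 : 0 <= c.
  have I0 : I 0 by apply/I01P; rewrite lexx ler01.
  exact: le_trans (cP 0 I0).
apply/eqP; rewrite -subr_eq0 -normr_le0; apply/ler_addgt0Pr => e e0; rewrite add0r.
have [n ne] := integral_truncation w iw (fun t _ => w0 t) (e / 2 / (c + 1))
   (divr_gt0 (divr_gt0 e0 (ltr0Sn _ 1)) (ltr_wpDl c0 ltr01)).
have n1 : 0 < n%:R + 1 :> R by rewrite ltr_wpDl.
have [p1 [q1 [cp1 cq1 pq1 ie1]]] := su _ (divr_gt0 (divr_gt0 e0 (ltr0Sn _ 1)) n1).
pose p t := Num.max (p0 t) (p1 t); pose q t := Num.min (q0 t) (q1 t).
have cp : cont01 p by exact: cont01_max.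
have cq : cont01 q by exact: cont01_min.
have pq t : I t -> p t <= u t <= q t.
  move=> It; rewrite ge_max le_min.
  by have /andP[-> ->] := pq0 t It; have /andP[-> ->] := pq1 t It.
have [_ /andP[ps sq]] := cont _ _ cp cq pq.
have bp := cont01_bmeas cp; have bq := cont01_bmeas cq.
have pu : J p <= J u by apply: le_J => // t /pq /andP[].
have uq : J u <= J q by apply: le_J => // t /pq /andP[].
suff Jpq : J q - J p <= e.
  move: ps sq pu uq Jpq; move: (J p) (J q) (J u) (complex.Re (s u)); clear=> a b c' d ? ? ? ? ?.
  by rewrite ler_norml; apply/andP; split; lra.
rewrite -(JB _ _ bq bp).
have bpq := bmeasB bq bp.
have m0 t : 0 <= Num.min (w t) n%:R by rewrite le_min ler0n andbT w0.
have mn t : Num.min (w t) n%:R <= n%:R by rewrite ge_min lexx orbT.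
have mw t : Num.min (w t) n%:R <= w t by rewrite ge_min lexx.
have qq0 t : q t <= q0 t by rewrite /q ge_min lexx.
have qq1 t : q t <= q1 t by rewrite /q ge_min lexx orbT.
have pp0 t : p0 t <= p t by rewrite /p le_max lexx.
have pp1 t : p1 t <= p t by rewrite /p le_max lexx orbT.
have bw : bmeas (fun t => Num.min (w t) n%:R).
  split; last by exists n%:R => t _; rewrite ger0_norm.
  apply: measurable_minr; last exact: measurable_cst.
  by apply/measurable_EFinP; exact: measurable_int iw.
have iw' : lambda.-integrable I (EFin \o (fun t => w t - Num.min (w t) n%:R)).
  by have := integrableB (@measurable_I01 R) iw (bmeas_integrable bw).
have -> : J (fun t => q t - p t) = int01 (fun t => (q t - p t) * Num.min (w t) n%:R) +
    \int[lambda]_(t in I) ((q t - p t) * (w t - Num.min (w t) n%:R)).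
  rewrite /int01 -RintegralD; first by apply: eq_Rintegral => t _; ring.
  - exact: measurable_I01.
  - by apply: bmeas_integrable; exact: bmeasM.
  - exact: integrable_bmeasM.
have qp t : I t -> 0 <= q t - p t.
  by move=> /pq /andP[h1 h2]; rewrite subr_ge0 (le_trans h1).
rewrite [leRHS]splitr; apply: lerD.
- have b1 := bmeasB (cont01_bmeas cq1) (cont01_bmeas cp1).
  apply: (@le_trans _ _ (int01 (fun t => (n%:R + 1) * (q1 t - p1 t)))).
    apply: le_int01; [exact: bmeasM bpq bw|exact: bmeasM (bmeas_cst _) b1|].
    move=> t It; rewrite mulrC; apply: ler_pM; [exact: m0|exact: qp| |exact: lerB].
    by apply: le_trans (mn t) _; rewrite lerDl.
  by rewrite int01Z// mulrC -ler_pdivlMr// ltW.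
- apply: (@le_trans _ _ (\int[lambda]_(t in I) ((c + 1) * (w t - Num.min (w t) n%:R)))).
    apply: le_Rintegral; [exact: measurable_I01|exact: (integrable_bmeasM bpq iw')| |].
      exact: (integrable_bmeasM (bmeas_cst (c + 1)) iw').
    move=> t It; apply: ler_wpM2r; first by rewrite subr_ge0; exact: mw.
    have := cP t It; rewrite ler_norml => /andP[_ h].
    apply: (@le_trans _ _ (q0 t - p0 t)); first exact: lerB.
    by apply: le_trans h _; rewrite lerDl.
  rewrite RintegralZl; [|exact: measurable_I01|exact: iw'].
  by rewrite mulrC -ler_pdivlMr ?ltr_wpDl// ltW.
Qed.

Variable phi : {linear bop (dot01 R) -> bop (dot01 R)}.
Hypothesis ccphi : completely_contractive phi.
Hypothesis phi1 : phi (pi01 (fun=> 1)) = pi01 (fun=> 1).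

(** For real t the symbol v - c / 2 + i t is bounded by sqrt (c^2 / 4 + t^2), and
    phi maps its operator to phi (M_v) - c / 2 + i t, which therefore obeys the
    same bound. Letting t vary confines the numerical range of phi (M_v) to the
    nonnegative reals. *)
Lemma unital_contraction_positive v (c : R) : bmeas v -> (forall t, I t -> 0 <= v t <= c) ->
  forall x, complex.Im (dot01 R (phi (pi01 (ofreal v)) x) x) = 0 /\
            0 <= complex.Re (dot01 R (phi (pi01 (ofreal v)) x) x).
Proof.
move=> bv vc x.
have c0 : 0 <= c.
  have I0 : I 0 by apply/I01P; rewrite lexx ler01.
  by have /andP[h1 h2] := vc 0 I0; exact: le_trans h2.
apply: (@positivity_algebra _ _ c (hn x ^+ 2)) => //; first exact: sqr_ge0.
move=> t; pose z : R[i] := (- (c / 2)) +i* t.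
have Lv := bmeas_Linf bv; have L1 := Linf_cst (1 : R[i]).
pose f : R -> R[i] := fun s => z * 1 + ofreal v s.
have Lf : Linf f by exact: LinfD (LinfZ z L1) Lv.
pose B := Num.sqrt (c ^+ 2 / 4 + t ^+ 2).
have B2 : B ^+ 2 = c ^+ 2 / 4 + t ^+ 2.
  by rewrite sqr_sqrtr// addr_ge0 ?divr_ge0 ?sqr_ge0.
have fB : {ae lambda, forall s, I s -> Normc.normc (f s) <= B}.
  apply: aeW => s Is; rewrite -ler_sqr ?nnegrE ?normc_ge0 ?sqrtr_ge0// B2 sqr_normcE /f /ofreal /z /=.
  by have /andP[? ?] := vc s Is; nra.
have nB := completely_contractive1 _ _ _ _ (sqrtr_ge0 _) ccphi (pi01_norm _ Lf (sqrtr_ge0 _) fB) x.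
have E : dot01 R (phi (pi01 f) x) x = z * (hn x ^+ 2)%:C + dot01 R (phi (pi01 (ofreal v)) x) x.
  by rewrite (pi01_lin z L1 Lv) linearP phi1 addbopE scalebopE pi01_1 dotDl dotZl dotxx.
have le1 : Normc.normc (dot01 R (phi (pi01 f) x) x) <= B * hn x ^+ 2.
  apply: le_trans (cauchy_schwarz _ _ _) _.
  by rewrite expr2 mulrA; exact: (ler_wpM2r (hnorm_ge0 _ _) nB).
have : Normc.normc (dot01 R (phi (pi01 f) x) x) ^+ 2 <= (B * hn x ^+ 2) ^+ 2.
  by rewrite ler_sqr// nnegrE ?normc_ge0// mulr_ge0 ?sqrtr_ge0 ?sqr_ge0.
rewrite exprMn B2.
rewrite E sqr_normcE; case: (dot01 R _ x) => a b /=.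
move=> h; apply: le_trans h; rewrite le_eqVlt; apply/orP; left; apply/eqP; ring.
Qed.

Hypothesis phiV : forall S, V S -> phi S = S.

Lemma cont01_continuous01 u : cont01 u -> continuous01 (ofreal u).
Proof. by move=> cu; apply/continuous01P; split => //; exact: cont01_cst. Qed.

(** For each x, the functional S |-> <phi S x, x> on symbols is positive and
    agrees with <S x, x> on continuous symbols, hence also on squeezed ones. *)
Lemma phi_fix_squeezed u : squeezed u -> phi (pi01 (ofreal u)) = pi01 (ofreal u).
Proof.
move=> su; apply/eqP; rewrite -subr_eq0; apply/eqP/polarization_eq0 => x.
rewrite addbopE oppbopE [LHS]linearBl /=.
pose s v := dot01 R (phi (pi01 (ofreal v)) x) x.
have lin a v v' : bmeas v -> bmeas v' -> phi (pi01 (ofreal (fun t => a * v t + v' t))) =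
    a%:C *: phi (pi01 (ofreal v)) + phi (pi01 (ofreal v')).
  move=> bv bv'; rewrite -linearP -(pi01_lin a%:C (bmeas_Linf bv) (bmeas_Linf bv')).
  by congr (phi (pi01 _)); apply/funext => t; rewrite /ofreal rmorphD rmorphM.
have s_lin a v v' : bmeas v -> bmeas v' -> s (fun t => a * v t + v' t) = a%:C * s v + s v'.
  move=> bv bv'; transitivity (dot01 R (a%:C *: phi (pi01 (ofreal v)) x + phi (pi01 (ofreal v')) x) x).
    exact: (congr1 (fun T : bop (dot01 R) => dot01 R (T x) x) (lin a v v' bv bv')).
  by rewrite dotDl dotZl.
have s_pos v : bmeas v -> (forall t, I t -> 0 <= v t) ->
    complex.Im (s v) = 0 /\ 0 <= complex.Re (s v).
  move=> bv v0; have [_ [c vc]] := bv.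
  apply: (unital_contraction_positive v c bv) => t It.
  by rewrite v0//= (le_trans (ler_norm _))// vc.
have s_cont v : cont01 v ->
    s v = (\int[lambda]_(t in I) (v t * Normc.normc (repr x t) ^+ 2))%:C.
  move=> cv; rewrite /s (_ : phi _ = pi01 (ofreal v)); first exact: dot_real (cont01_bmeas cv).
  by apply: phiV; exists (ofreal v) => //; exact: cont01_continuous01.
have w0 t : 0 <= Normc.normc (repr x t) ^+ 2 by exact: sqr_ge0.
have := positive_functional_squeezed s _ (sq_int (repr x)) w0 s_lin s_pos s_cont u su.
rewrite /s => ->; rewrite [X in _ - X](dot_real _ _ (squeezed_bmeas su)).
exact: subrr.
Qed.

Lemma phi_fix_riemann f : squeezed (fun t => complex.Re (f t)) ->
  squeezed (fun t => complex.Im (f t)) -> phi (pi01 f) = pi01 f.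
Proof.
move=> sr si.
have -> : pi01 f = 'i *: pi01 (ofreal (fun t => complex.Im (f t))) +
                   pi01 (ofreal (fun t => complex.Re (f t))).
  rewrite -pi01_lin; [|exact: bmeas_Linf (squeezed_bmeas _)..].
  congr pi01; apply/funext => t; rewrite /ofreal; case: (f t) => a b.
  by apply/eqP; rewrite eq_complex /=; apply/andP; split; apply/eqP; ring.
by rewrite linearP /= !phi_fix_squeezed.
Qed.

End Fixed.

(** * The commutant of the multiplication operators *)

Section Commutant.
Context {R : realType}.
Local Notation lambda := (@completed_lebesgue_measure R).
Local Notation I := (@I01 R).
Local Notation Linf := (Linfty lambda I).
Local Notation L2f := (L2fun lambda (@measurable_I01 R)).
Local Notation H := (L2_01 R).
Local Notation V := (@pi01 R @` @continuous01 R).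
Local Notation cls := (@L2class _ _ R lambda I (@measurable_I01 R)).
Implicit Types (u v : R -> R) (f g : R -> R[i]) (x y : H).
Unset Implicit Arguments.

Lemma Rintegral_eq0_ae (k : R -> R) : lambda.-integrable I (EFin \o k) ->
  (forall t, I t -> 0 <= k t) -> \int[lambda]_(t in I) k t <= 0 ->
  {ae lambda, forall t, I t -> k t = 0}.
Proof.
move=> ik k0 k1.
have im : \int[lambda]_(t in I) k t = 0 by apply/eqP; rewrite eq_le k1 Rintegral_ge0.
have : (\int[lambda]_(t in I) `|(k t)%:E| = 0)%E.
  rewrite -[RHS]/(0%:E) -im fineK; last first.
    by apply: integrable_fin_num; [exact: measurable_I01|exact: ik].
  by apply: eq_integral => t /[!inE] It; rewrite gee0_abs// lee_fin k0.
move=> /ae_eq_integral_abs -/(_ (@measurable_I01 R)) => h.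
have := h (measurable_int _ ik); apply: filterS => t + It => /(_ It).
by move=> [].
Qed.

Lemma normc1_conj (z : R[i]) : Normc.normc z = 1 -> z * z^*%C = 1.
Proof.
move=> /(congr1 (fun r => r ^+ 2)); rewrite sqr_normcE; case: z => a b /=.
rewrite expr1n => h; apply/eqP; rewrite eq_complex /=; apply/andP; split; apply/eqP; last by ring.
by rewrite -h; ring.
Qed.

Lemma pi01_0 : pi01 (fun=> 0) = 0 :> bop (dot01 R).
Proof.
have L0 := Linf_cst (0 : R[i]); have := pi01_lin (-1) L0 L0.
rewrite scaleN1r addNr => <-; congr pi01; apply/funext => t.
by rewrite mulr0 addr0.
Qed.

Lemma pi01Z a {f} : Linf f -> pi01 (fun t => a * f t) = a *: pi01 f.
Proof.
move=> Lf; have := pi01_lin a Lf (Linf_cst 0); rewrite pi01_0 addr0 => <-.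
by congr pi01; apply/funext => t; rewrite addr0.
Qed.

Variable T : bop (dot01 R).
Hypothesis hT : fix_hull V T.

(** Conjugation by the unitary M_f is completely contractive and fixes every
    multiplication operator, so it fixes T, which thus commutes with M_f. *)
Lemma hull_commutes_unimodular f : Linf f ->
  {ae lambda, forall t, I t -> Normc.normc (f t) = 1} ->
  forall x, T (pi01 f x) = pi01 f (T x).
Proof.
move=> Lf f1; have LJ := LinfJ Lf.
pose phi0 (S : bop (dot01 R)) := bop_mul (pi01 f) (bop_mul S (pi01 (fun t => (f t)^*%C))).
have lin : linear phi0.
  move=> a S S'; apply: bop_ext => x.
  by rewrite /phi0 !(mulbopE, addbopE, scalebopE) bopD bopZ.
pose phi : {linear bop (dot01 R) -> bop (dot01 R)} :=
  HB.pack phi0 (GRing.isLinear.Build _ _ _ _ phi0 lin).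
have f1' : {ae lambda, forall t, I t -> Normc.normc (f t) <= 1}.
  by apply: filterS f1 => t h It; rewrite h.
have J1' : {ae lambda, forall t, I t -> Normc.normc (f t)^*%C <= 1}.
  apply: filterS f1 => t h It; rewrite -(h It).
  by rewrite -ler_sqr ?nnegrE ?normc_ge0// !sqr_normcE cReJ cImJ sqrrN.
have phiT : bop_mul (pi01 f) (bop_mul T (pi01 (fun t => (f t)^*%C))) = T.
  apply: (hT phi).
    apply: completely_contractive_compression => x.
      by rewrite -[leRHS]mul1r; exact: pi01_norm f1' x.
    by rewrite -[leRHS]mul1r; exact: pi01_norm J1' x.
  move=> _ [g cg <-]; have Lg := continuous01_Linfty cg.
  have E := etrans (pi01_mul Lf (LinfM Lg LJ)) (congr1 (bop_mul (pi01 f)) (pi01_mul Lg LJ)).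
  apply: etrans (esym E) _.
  apply: (pi01_ae _ _ (LinfM Lf (LinfM Lg LJ)) Lg).
  by apply: filterS f1 => t h It; rewrite mulrCA normc1_conj ?mulr1// h.
move=> x; rewrite -{1}phiT !mulbopE; congr (pi01 f (T _)).
rewrite -mulbopE -(pi01_mul LJ Lf) -[RHS]pi01_1.
congr (bop_fun _ x); apply: (pi01_ae _ _ (LinfM LJ Lf) (Linf_cst 1)).
by apply: filterS f1 => t h It; rewrite mulrC normc1_conj// h.
Qed.

(** v is the real part of the unimodular function v + i sqrt (1 - v^2). *)
Lemma hull_commutes_contraction v : measurable_fun I v -> (forall t, I t -> `|v t| <= 1) ->
  forall x, T (pi01 (ofreal v) x) = pi01 (ofreal v) (T x).
Proof.
move=> mv v1 x.
have bv : bmeas v by split; [exact: mv|exists 1].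
pose f t : R[i] := v t +i* Num.sqrt (1 - v t ^+ 2).
have v2 t : I t -> 0 <= 1 - v t ^+ 2.
  by move=> It; rewrite subr_ge0 -(expr1n _ 2) -real_normK ?num_real// ler_sqr ?nnegrE ?v1.
have f1 t : I t -> Normc.normc (f t) = 1.
  move=> It; rewrite /f /= sqr_sqrtr ?v2// addrC subrK sqrtr1 //.
have mf : cmeasurable I f.
  split; first exact: mv.
  have ms : measurable_fun setT (@Num.sqrt R).
    by apply: continuous_measurable_fun; exact: sqrt_continuous.
  exact: (measurableT_comp ms (measurable_funB (measurable_cst _) (measurable_funX _ mv))).
have Lf : Linf f by apply: (Linf_bmeas _ mf); exists 1 => t It; rewrite f1.
have LJ := LinfJ Lf.
have E : pi01 (ofreal v) = (2^-1 : R)%:C *: pi01 f + (2^-1 : R)%:C *: pi01 (fun t => (f t)^*%C).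
  rewrite -(pi01Z _ LJ) -(pi01_lin _ Lf (LinfZ _ LJ)); congr pi01; apply/funext => t.
  by rewrite /ofreal /f; apply/eqP; rewrite eq_complex /=; apply/andP; split; apply/eqP; field.
rewrite E !addbopE !scalebopE bopD !bopZ.
rewrite (hull_commutes_unimodular f Lf); last by apply: aeW.
rewrite (hull_commutes_unimodular _ LJ)//; apply: aeW => t It; rewrite -(f1 t It).
by apply/eqP; rewrite -(@eqrXn2 _ 2)// ?normc_ge0// !sqr_normcE cReJ cImJ sqrrN.
Qed.

Lemma hull_commutes g : cmeasurable I g -> (exists M, forall t, I t -> Normc.normc (g t) <= M) ->
  forall x, T (pi01 g x) = pi01 g (T x).
Proof.
move=> mg [M gM] x; pose N := `|M| + 1.
have N0 : 0 < N by rewrite ltr_wpDl.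
have gN t : I t -> Normc.normc (g t) <= N.
  by move=> It; rewrite (le_trans (gM t It))// (le_trans (ler_norm _))// lerDl.
pose a t := complex.Re (g t) / N; pose b t := complex.Im (g t) / N.
have ma : measurable_fun I a by exact: measurable_funM mg.1 (measurable_cst _).
have mb : measurable_fun I b by exact: measurable_funM mg.2 (measurable_cst _).
have a1 t : I t -> `|a t| <= 1.
  move=> It; rewrite normrM (ger0_norm (ltW (_ : 0 < N^-1))) ?invr_gt0// ler_pdivrMr// mul1r.
  apply: le_trans (gN t It).
  by rewrite -ler_sqr ?nnegrE ?normc_ge0// sqr_normcE real_normK ?num_real// lerDl sqr_ge0.
have b1 t : I t -> `|b t| <= 1.
  move=> It; rewrite normrM (ger0_norm (ltW (_ : 0 < N^-1))) ?invr_gt0// ler_pdivrMr// mul1r.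
  apply: le_trans (gN t It).
  by rewrite -ler_sqr ?nnegrE ?normc_ge0// sqr_normcE real_normK ?num_real// lerDr sqr_ge0.
have La : Linf (ofreal a) by apply: bmeas_Linf; split; [exact: ma|exists 1].
have Lb : Linf (ofreal b) by apply: bmeas_Linf; split; [exact: mb|exists 1].
have -> : pi01 g = (N%:C * 'i) *: pi01 (ofreal b) + N%:C *: pi01 (ofreal a).
  rewrite -(pi01Z _ La) -(pi01_lin _ Lb (LinfZ _ La)).
  congr pi01; apply/funext => t; rewrite /ofreal /a /b; case: (g t) => c d.
  by apply/eqP; rewrite eq_complex /=; apply/andP; split; apply/eqP; field; rewrite lt0r_neq0.
rewrite !addbopE !scalebopE !bopD !bopZ.
by rewrite (hull_commutes_contraction b mb b1) (hull_commutes_contraction a ma a1).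
Qed.

Lemma normc_ofreal (r : R) : Normc.normc r%:C = `|r|.
Proof. by rewrite /= expr0n addr0 sqrtr_sqr. Qed.

(** The symbol is f = T 1. Commutation with the indicator function of the set
    where |f| exceeds the norm bound M of T shows that this set is null. For x
    in L^2, commutation with the indicator function of {|x|^2 <= n} and with the
    bounded truncation of x to this set gives T x = f x on this set; every point
    belongs to one of these sets. *)
Lemma fix_hull_multiplication : exists2 f, Linf f & T = pi01 f.
Proof.
pose one : L2f := MkL2fun (@one_sq_integrable R).
pose f := repr (T (cls one)).
have Tone : T (cls one) = cls f by rewrite /f L2class_repr.
have /sq_integrableP[mf sf] := valP f.
have Tb g (Lg : Linf g) : (exists M, forall t, I t -> Normc.normc (g t) <= M) ->
    T (pi01 g (cls one)) = cls (mulfun Lg f).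
  by move=> gM; rewrite hull_commutes//; [rewrite Tone (pi01E Lg)|exact: Lg.1].
have Lf : Linf f.
  split; [exact: mf|]; have [M M0 TM] := bop_bounded (dot01 R) T.
  exists M.
  pose E : set R := [set t | M ^+ 2 < Normc.normc (f t) ^+ 2] `&` I.
  pose e : R -> R := \1_E.
  have mE : measurable (E : set (caratheodory_type (wlength (@idfun R))^*%mu)).
    have := measurable_sqr_normc mf.
    move=> /(_ (@measurable_I01 R) `]M ^+ 2, +oo[%classic (measurable_itv _)).
    rewrite setIC; congr measurable; congr (_ `&` _).
    by apply/seteqP; split => t /=; rewrite in_itv /= andbT.
  have be : bmeas e.
    split; first exact: measurable_indic.
    by exists 1 => t _; rewrite /e indicE; case: (_ \in _); rewrite ?normr1 ?normr0.
  have Le := bmeas_Linf be.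
  have he : exists N, forall t, I t -> Normc.normc (ofreal e t) <= N.
    by have [_ [N eN]] := be; exists N => t It; rewrite normc_ofreal eN.
  have := TM (pi01 (ofreal e) (cls one)).
  rewrite (Tb _ Le he) (pi01E Le) -ler_sqr ?nnegrE ?mulr_ge0 ?hnorm_ge0//.
  rewrite exprMn !hnorm_cls => h.
  have e2 t : Normc.normc (ofreal e t) ^+ 2 = e t.
    by rewrite normc_ofreal /e indicE; case: (_ \in _); rewrite ?normr1 ?normr0 ?expr1n ?expr0n.
  pose k t := e t * (Normc.normc (f t) ^+ 2 - M ^+ 2).
  have ib := bmeas_integrable (bmeas_cst (M ^+ 2)).
  have ik0 : lambda.-integrable I (EFin \o (fun t => Normc.normc (f t) ^+ 2 - M ^+ 2)).
    exact: (integrableB (@measurable_I01 R) sf ib).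
  have ik : lambda.-integrable I (EFin \o k) by exact: integrable_bmeasM be ik0.
  have k0 t : I t -> 0 <= k t.
    move=> It; rewrite /k /e indicE; case: (boolP (t \in E)); last by rewrite mul0r.
    by rewrite inE => -[/= /ltW]; rewrite mul1r subr_ge0.
  have k1 : \int[lambda]_(t in I) k t <= 0.
    have -> : \int[lambda]_(t in I) k t =
      \int[lambda]_(t in I) (e t * Normc.normc (f t) ^+ 2) - M ^+ 2 * \int[lambda]_(t in I) e t.
      rewrite -(RintegralZl _ (@measurable_I01 R)); last exact: bmeas_integrable.
      rewrite -RintegralB; first by apply: eq_Rintegral => t _; rewrite /k; ring.
      - exact: measurable_I01.
      - exact: integrable_bmeasM be sf.
      - exact: integrable_bmeasM (bmeas_cst (M ^+ 2)) (bmeas_integrable be).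
    rewrite subr_le0; move: h; congr (_ <= _).
      by apply: eq_Rintegral => t _ /=; rewrite Normc.normcM exprMn e2.
    congr (_ * _); apply: eq_Rintegral => t _.
    by rewrite [LHS](_ : _ = Normc.normc (ofreal e t * 1) ^+ 2)// mulr1 e2.
  apply: filterS (Rintegral_eq0_ae k ik k0 k1) => t + It => /(_ It) kt.
  rewrite -ler_sqr ?nnegrE ?normc_ge0// leNgt; apply/negP => Mt.
  move: kt; rewrite /k /e indicE mem_set; last by split.
  by rewrite mul1r => /eqP; rewrite subr_eq0 gt_eqF.
exists f => //; apply: bop_ext => x.
pose y := repr x; have /sq_integrableP[my _] := valP y.
have xy : x = cls y by rewrite L2class_repr.
pose z := repr (T x); have xz : T x = cls z by rewrite L2class_repr.
rewrite xz xy (pi01E Lf); apply/L2classP.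
pose E (n : nat) : set R := [set t | Normc.normc (y t) ^+ 2 <= n%:R] `&` I.
pose e n : R -> R := \1_(E n).
have mE n : measurable (E n : set (caratheodory_type (wlength (@idfun R))^*%mu)).
  have := measurable_sqr_normc my.
  move=> /(_ (@measurable_I01 R) `]-oo, n%:R]%classic (measurable_itv _)).
  by rewrite setIC; congr measurable; congr (_ `&` _).
have be n : bmeas (e n).
  split; first exact: measurable_indic.
  by exists 1 => t _; rewrite /e indicE; case: (_ \in _); rewrite ?normr1 ?normr0.
have Le n := bmeas_Linf (be n).
have he n : exists N, forall t, I t -> Normc.normc (ofreal (e n) t) <= N.
  by have [_ [N eN]] := be n; exists N => t It; rewrite normc_ofreal eN.
have mey n : cmeasurable I (fun t => ofreal (e n) t * y t).
  exact: cmeasurableM (Le n).1 my.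
have hey n : exists N, forall t, I t -> Normc.normc (ofreal (e n) t * y t) <= N.
  exists (n%:R + 1) => t It; rewrite Normc.normcM normc_ofreal /e indicE.
  case: (boolP (t \in E n)); last by rewrite normr0 mul0r addr_ge0.
  rewrite inE normr1 mul1r => -[/= h _].
  rewrite -ler_sqr ?nnegrE ?normc_ge0 ?addr_ge0// (le_trans h)// sqrrD1.
  have : 0 <= n%:R ^+ 2 :> R by exact: sqr_ge0.
  by have : 0 <= n%:R :> R by []; lra.
have Ley n := Linf_bmeas _ (mey n) (hey n).
have key n : cls (mulfun (Le n) z) = cls (mulfun (Ley n) f).
  rewrite -(Tb _ _ (hey n)) -(pi01E (Le n)) -xz -(hull_commutes _ (Le n).1 (he n)).
  congr (T _); rewrite xy (pi01E (Le n)) (pi01E (Ley n)).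
  by apply/L2classP/aeW => t _ /=; rewrite mulr1.
have key' : {ae lambda, forall t n, I t -> ofreal (e n) t * z t = ofreal (e n) t * y t * f t}.
  apply/ae_foralln => n; have /L2classP hh := key n.
  by apply: filterS hh => t h It; exact: (h It).
apply: filterS key' => t h It /=.
have := h (Num.truncn (Normc.normc (y t) ^+ 2)).+1 It.
rewrite /ofreal /e indicE mem_set; last first.
  by split => //=; exact: ltW (truncnS_gt _).
by rewrite !mul1r mulrC.
Qed.

End Commutant.

(** * Densities of dominated additive set functions *)

Section WeakLimits.
Context {R : realType}.
Local Notation lambda := (@completed_lebesgue_measure R).
Local Notation I := (@I01 R).
Local Notation Tc := (caratheodory_type (wlength (@idfun R))^*%mu).
Implicit Types (u v d : R -> R) (A B E : set Tc).
Unset Implicit Arguments.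

Definition int01_on A u := int01 (fun t => (\1_A t : R) * u t).

Lemma bmeas_indicT A : measurable A -> bmeas (\1_A : R -> R).
Proof.
move=> mA; split; first exact: measurable_indic.
by exists 1 => x _; rewrite indicE; case: (_ \in _); rewrite ?normr1 ?normr0.
Qed.

Lemma bmeas_int01_on A u : measurable A -> bmeas u -> bmeas (fun t => (\1_A t : R) * u t).
Proof. by move=> mA bu; exact: bmeasM (bmeas_indicT A mA) bu. Qed.

Lemma int01_on_setU A B u : measurable A -> measurable B -> A `&` B = set0 -> bmeas u ->
  int01_on (A `|` B) u = int01_on A u + int01_on B u.
Proof.
move=> mA mB AB bu; rewrite /int01_on -int01D; [|exact: bmeas_int01_on..].
congr int01; apply/funext => t; rewrite -mulrDl; congr (_ * _).
rewrite !indicE in_setU; case: (boolP (t \in A)); case: (boolP (t \in B)) => //=.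
- by rewrite !inE => tB tA; have : (A `&` B) t by []; rewrite AB.
- by rewrite addr0.
- by rewrite add0r.
- by rewrite addr0.
Qed.

Lemma int01_on_lin A a u v : measurable A -> bmeas u -> bmeas v ->
  int01_on A (fun t => a * u t + v t) = a * int01_on A u + int01_on A v.
Proof.
move=> mA bu bv; rewrite /int01_on -int01Z; last exact: bmeas_int01_on.
rewrite -int01D; [|exact: bmeasM (bmeas_cst a) (bmeas_int01_on A u mA bu)|exact: bmeas_int01_on].
by congr int01; apply/funext => t; ring.
Qed.

Lemma le_int01_on A u v : measurable A -> bmeas u -> bmeas v -> (forall t, I t -> u t <= v t) ->
  int01_on A u <= int01_on A v.
Proof.
move=> mA bu bv uv; apply: le_int01; [exact: bmeas_int01_on|exact: bmeas_int01_on|].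
by move=> t It; rewrite ler_wpM2l ?uv// indicE.
Qed.

(** Test the hypothesis on the set where the conclusion fails. *)
Lemma le_ae_Rintegral (a b : R -> R) : lambda.-integrable I (EFin \o a) ->
  lambda.-integrable I (EFin \o b) ->
  (forall A, measurable A -> \int[lambda]_(t in I) ((\1_A t : R) * a t) <=
                             \int[lambda]_(t in I) ((\1_A t : R) * b t)) ->
  {ae lambda, forall t, I t -> a t <= b t}.
Proof.
move=> ia ib H.
have ma := (measurable_EFinP I a).1 (measurable_int _ ia).
have mb := (measurable_EFinP I b).1 (measurable_int _ ib).
pose E : set Tc := I `&` [set t | b t < a t].
have mE : measurable E.
  have -> : E = I `&` (fun t => a t - b t) @^-1` `]0, +oo[%classic.
    by apply/seteqP; split => t [It /=]; rewrite in_itv /= andbT subr_gt0.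
  have mab : measurable_fun I (fun t => a t - b t) := measurable_funB ma mb.
  exact: (mab (@measurable_I01 R) `]0, +oo[%classic (measurable_itv _)).
have iE := bmeas_indicT E mE.
pose k t := (\1_E t : R) * (a t - b t).
have iab : lambda.-integrable I (EFin \o (fun t => a t - b t)).
  exact: (integrableB (@measurable_I01 R) ia ib).
have ik : lambda.-integrable I (EFin \o k) by exact: integrable_bmeasM iE iab.
have k0 t : I t -> 0 <= k t.
  move=> It; rewrite /k indicE; case: (boolP (t \in E)); last by rewrite mul0r.
  by rewrite inE => -[_ /= /ltW]; rewrite mul1r subr_ge0.
have k1 : \int[lambda]_(t in I) k t <= 0.
  have -> : \int[lambda]_(t in I) k t = \int[lambda]_(t in I) ((\1_E t : R) * a t) -
       \int[lambda]_(t in I) ((\1_E t : R) * b t).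
    rewrite -RintegralB; first by apply: eq_Rintegral => t _; rewrite /k; ring.
    - exact: measurable_I01.
    - exact: integrable_bmeasM iE ia.
    - exact: integrable_bmeasM iE ib.
  by rewrite subr_le0; exact: H.
apply: filterS (Rintegral_eq0_ae k ik k0 k1) => t + It => /(_ It) kt.
rewrite leNgt; apply/negP => ba.
move: kt; rewrite /k indicE mem_set; last by split.
by rewrite mul1r => /eqP; rewrite subr_eq0 gt_eqF.
Qed.

Lemma le_ae_int01_on u v : bmeas u -> bmeas v ->
  (forall A, measurable A -> int01_on A u <= int01_on A v) -> {ae lambda, forall t, I t -> u t <= v t}.
Proof. by move=> bu bv; apply: le_ae_Rintegral; exact: bmeas_integrable. Qed.

Lemma eq_ae_int01_on u v : bmeas u -> bmeas v ->
  (forall A, measurable A -> int01_on A u = int01_on A v) -> {ae lambda, forall t, I t -> u t = v t}.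
Proof.
move=> bu bv uv; have h1 : {ae lambda, forall t, I t -> u t <= v t}.
  by apply: le_ae_int01_on => // A mA; rewrite uv.
have h2 : {ae lambda, forall t, I t -> v t <= u t}.
  by apply: le_ae_int01_on => // A mA; rewrite uv.
by apply: filterS2 h1 h2 => t a b It; apply/eqP; rewrite eq_le a ?b.
Qed.

Section Density.
Variables (r : set Tc -> R) (C : R).
Hypothesis C0 : 0 <= C.
Hypothesis rU : forall A B, measurable A -> measurable B -> A `&` B = set0 ->
  r (A `|` B) = r A + r B.
Hypothesis rC : forall A, measurable A -> `|r A| <= C * int01 (\1_A : R -> R).

Let nu A := (r A)%:E.

Let m A : R := int01 (\1_A : R -> R).

Let mE A : measurable A -> (m A)%:E = lambda (A `&` I).
Proof.
move=> mA; rewrite /m /int01 /Rintegral integral_indic//; last exact: measurable_I01.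
rewrite fineK// ge0_fin_numE; last exact: measure_ge0.
apply: (@le_lt_trans _ _ (lambda I)); last by rewrite lambda_I01 ltry.
by apply: le_measure; rewrite ?inE; [apply: measurableI => //; exact: measurable_I01|exact: measurable_I01|exact: subIsetr].
Qed.

Let m0 : m set0 = 0.
Proof. by rewrite /m indic0 int01_cst. Qed.

Let r0 : r set0 = 0.
Proof. by apply/eqP; rewrite -normr_le0 -(mulr0 C) -m0; exact: rC. Qed.

Let mU A B : measurable A -> measurable B -> A `&` B = set0 -> m (A `|` B) = m A + m B.
Proof.
move=> mA mB AB; have mT (X : set Tc) : m X = int01_on X (fun=> 1).
  by congr int01; apply/funext => t; rewrite mulr1.
by rewrite !mT int01_on_setU//; exact: bmeas_cst.
Qed.

Let sigma_additive_nu : semi_sigma_additive nu.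
Proof.
move=> F mF tF mUF; pose U := \bigcup_n F n; pose B n := \big[setU/set0]_(i < n) F i.
have mB n : measurable (B n) by exact: bigsetU_measurable.
have BU n : B n `<=` U.
  by rewrite /B -bigcup_mkord => t [i _ Fit]; exists i.
have add (q : set Tc -> R) : q set0 = 0 ->
    (forall A B, measurable A -> measurable B -> A `&` B = set0 -> q (A `|` B) = q A + q B) ->
    forall n, \sum_(0 <= i < n) q (F i) = q (B n).
  move=> q0 qU n; elim: n => [|n IH]; first by rewrite big_geq// /B big_ord0 q0.
  rewrite big_nat_recr//= IH /B big_ord_recr /= qU//; first exact: mB.
  rewrite -bigcup_mkord setI_bigcupl; apply/bigcup0P => i /= ni.
  by move/trivIsetP : tF => /(_ i n Logic.I Logic.I); apply; rewrite ltn_eqF.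
have dec (q : set Tc -> R)
    (qU : forall A B, measurable A -> measurable B -> A `&` B = set0 -> q (A `|` B) = q A + q B) n :
    q U = q (B n) + q (U `\` B n).
  by rewrite -(qU _ _ (mB n) (measurableD mUF (mB n)) (setDIK _ _)) setDUK//; exact: BU.
have cm : (fun n => \sum_(0 <= i < n) m (F i)) @ \oo --> m U.
  have cmE : (fun n => \sum_(0 <= i < n) (m (F i))%:E)%E @ \oo --> (m U)%:E.
    rewrite (mE U mUF).
    have := @measure_semi_sigma_additive _ _ _ (mrestr lambda (@measurable_I01 R)) F mF tF mUF.
    apply: cvg_trans; apply: near_eq_cvg; apply: nearW => n.
    by apply: eq_bigr => i _; rewrite (mE _ (mF i)).
  move: cmE => /fine_cvgP[_]; apply: cvg_trans; apply: near_eq_cvg.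
  by apply: nearW => n /=; rewrite sumEFin.
apply: cvg_EFin; first by apply: nearW => n; rewrite sumEFin.
apply/cvgrPdist_le => e e0.
have C1 : 0 < C + 1 by rewrite ltr_wpDl.
move/cvgrPdist_le : cm => /(_ (e / (C + 1)) (divr_gt0 e0 C1)).
apply: filterS => n; rewrite (add m m0 mU) (dec m mU n) addrAC subrr add0r => h.
rewrite /= sumEFin /= (add r r0 rU) (dec r rU n) addrAC subrr add0r.
apply: (le_trans (rC _ (measurableD mUF (mB n)))).
apply: (@le_trans _ _ ((C + 1) * m (U `\` B n))).
  by rewrite ler_wpM2r ?lerDl//; apply: int01_ge0 => t _; rewrite indicE.
by rewrite mulrC -ler_pdivlMr//; apply: le_trans h; exact: ler_norm.
Qed.

HB.instance Definition _ := isCharge.Build _ _ _ nu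
  (congr1 EFin r0) (fun A _ => erefl) sigma_additive_nu.

(** Domination by the measure turns finite additivity into countable additivity,
    so r is a charge with a Radon-Nikodym density. As its averages lie in
    [-C, C], so do its values a.e., and clamping makes it bounded everywhere. *)
Lemma bounded_density : exists2 d, bmeas d & forall A, measurable A -> r A = int01_on A d.
Proof.
have dom : nu `<< lambda.
  apply/null_content_dominatesP => A mA A0; congr (_%:E).
  apply/eqP; rewrite -normr_le0 -(mulr0 C); apply: (le_trans (rC A mA)).
  apply: ler_wpM2l => //; rewrite -lee_fin (mE A mA).
  apply: (@le_trans _ _ (lambda A)); last by rewrite A0.
  apply: le_measure; rewrite ?inE; [|exact: mA|exact: subIsetl].
  by apply: measurableI => //; exact: measurable_I01.
pose d0 := Radon_Nikodym nu lambda; pose d1 (t : R) : R := fine (d0 t).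
have d01 t : (d1 t)%:E = d0 t by rewrite fineK//; exact: Radon_Nikodym_fin_num.
have id1 : lambda.-integrable I (EFin \o d1).
  have -> : EFin \o d1 = d0 by apply/funext => t; exact: d01.
  apply: integrableS (Radon_Nikodym_integrable dom) => //; exact: measurable_I01.
have rI A : measurable A -> r A = \int[lambda]_(t in I) ((\1_A t : R) * d1 t).
  move=> mA; have mAI : measurable (A `&` I) by apply: measurableI => //; exact: measurable_I01.
  have -> : r A = r (A `&` I).
    have mAD : measurable (A `\` I) by apply: measurableD => //; exact: measurable_I01.
    have disj : (A `&` I) `&` (A `\` I) = set0 by apply/seteqP; split => t // [[_ ?] []].
    rewrite -[in LHS](setUIDK A I) (rU _ _ mAI mAD disj).
    suff -> : r (A `\` I) = 0 by rewrite addr0.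
    apply/eqP; rewrite -normr_le0 -(mulr0 C); apply: (le_trans (rC _ mAD)).
    by rewrite ler_wpM2l// -lee_fin mE// setDE -setIA setICl setI0 measure0.
  have := Radon_Nikodym_integral dom mAI; rewrite /= /nu => /(congr1 fine) /= ->.
  rewrite /Rintegral setIC integral_mkcondr; congr fine; apply: eq_integral => t _.
  by rewrite patchE indicE; case: (t \in A); rewrite ?mul1r ?mul0r// d01.
have iC (c : R) := bmeas_integrable (bmeas_cst c).
have rC' A (c : R) : measurable A -> \int[lambda]_(t in I) ((\1_A t : R) * c) = c * m A.
  move=> mA; rewrite -(RintegralZl _ (@measurable_I01 R)); last exact: bmeas_integrable (bmeas_indicT A mA).
  by apply: eq_Rintegral => t _; rewrite mulrC.
have dC : {ae lambda, forall t, I t -> d1 t <= C}.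
  have := le_ae_Rintegral d1 (fun=> C) id1 (iC C); apply => A mA.
  by rewrite rC'// -rI// (le_trans (ler_norm _))// rC.
have dC' : {ae lambda, forall t, I t -> - C <= d1 t}.
  have := le_ae_Rintegral (fun=> - C) d1 (iC (- C)) id1; apply => A mA.
  by have := rC A mA; rewrite ler_norml => /andP[h _]; rewrite rC'// -rI// mulNr.
have md1 := (measurable_EFinP I d1).1 (measurable_int _ id1).
exists (fun t => Num.max (- C) (Num.min C (d1 t))).
  split.
    apply: measurable_maxr; first exact: measurable_cst.
    by apply: measurable_minr => //; exact: measurable_cst.
  exists C => t _; rewrite ler_norml le_max lexx /= ge_max ge_min lexx andbT.
  by rewrite (le_trans _ C0)// oppr_le0.
move=> A mA; rewrite rI//; congr fine; apply: ae_eq_integral.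
- exact: measurable_I01.
- apply/measurable_EFinP; apply: measurable_funM => //; exact: measurable_indic.
- apply/measurable_EFinP; apply: measurable_funM; first exact: measurable_indic.
  apply: measurable_maxr; first exact: measurable_cst.
  by apply: measurable_minr => //; exact: measurable_cst.
- apply: filterS2 dC dC' => t h1 h2 It /=.
  by rewrite (min_r (h1 It)) (max_r (h2 It)).
Qed.

End Density.

End WeakLimits.

(** * Weak limits along an ultrafilter *)

Section WeakLimitAlongUltrafilter.
Context {R : realType}.
Local Notation lambda := (@completed_lebesgue_measure R).
Local Notation I := (@I01 R).
Local Notation Tc := (caratheodory_type (wlength (@idfun R))^*%mu).
Implicit Types (u v d : R -> R) (A B E : set Tc).
Unset Implicit Arguments.

Variable G : set_system nat.
Context {GU : UltraFilter G}.
Hypothesis ooG : \oo `<=` G.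

(** By compactness the image filter has a cluster point, and a cluster point of
    an ultrafilter is a limit. *)
Lemma ultra_bounded_cvg (x : nat -> R) (M : R) : (forall n, `|x n| <= M) -> cvg (x @ G).
Proof.
move=> xM; have K : compact (`[- M, M]%classic : set R) by exact: segment_compact.
have GK : G (x @^-1` `[- M, M]%classic).
  by apply: filterE => n /=; have := xM n; rewrite in_itv /= ler_norml.
have [p [_ clp]] := K (x @ G) _ GK.
apply/cvg_ex; exists p => U /= Up.
have [//|GnU] := in_ultra_setVsetC (x @^-1` U) GU.
have [y [/= nU yU]] := clp (~` U) U GnU Up.
by exfalso; exact: nU.
Qed.

Lemma cvg_ultra (x : nat -> R) (l : R) : x @ \oo --> l -> x @ G --> l.
Proof. by move=> xl; apply: cvg_trans xl; move=> U /= /ooG. Qed.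

(** Weak-star convergence of bounded functions along G, tested on indicator
    functions only. *)
Definition wlimit (c : nat -> R -> R) d := bmeas d /\
  forall A, measurable A -> (fun n => int01_on A (c n)) @ G --> int01_on A d.

(** The limits of the integrals over A exist by compactness, and form an additive
    set function dominated by a multiple of the measure. *)
Lemma wlimit_ex (c : nat -> R -> R) (M : R) : (forall n, bmeas (c n)) ->
  (forall n t, I t -> `|c n t| <= M) -> exists d, wlimit c d.
Proof.
move=> bc cM.
have M0 : 0 <= M by have I0 : I 0 by [apply/I01P; rewrite lexx ler01]; exact: le_trans (cM 0%N 0 I0).
have cA n A : measurable A -> `|int01_on A (c n)| <= M * int01 (\1_A : R -> R).
  move=> mA; have mT : int01 (\1_A : R -> R) = int01_on A (fun=> 1).
    by congr int01; apply/funext => t; rewrite mulr1.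
  have cst a : int01_on A (fun=> a) = a * int01 (\1_A : R -> R).
    rewrite -int01Z; last exact: bmeas_indicT.
    by congr int01; apply/funext => t; rewrite mulrC.
  rewrite ler_norml; apply/andP; split.
    rewrite -mulNr -cst; apply: le_int01_on => //; first exact: bmeas_cst.
    by move=> t It; have := cM n t It; rewrite ler_norml => /andP[].
  rewrite -cst; apply: le_int01_on => //; first exact: bmeas_cst.
  by move=> t It; have := cM n t It; rewrite ler_norml => /andP[].
have cvA A : measurable A -> cvg ((fun n => int01_on A (c n)) @ G).
  by move=> mA; apply: (ultra_bounded_cvg _ (M * int01 (\1_A : R -> R))) => n; exact: cA.
pose r A : R := lim ((fun n => int01_on A (c n)) @ G).
have rA A : measurable A -> (fun n => int01_on A (c n)) @ G --> r A by exact: cvA.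
have [||d bd dr] := @bounded_density R r M M0.
- move=> A B mA mB AB; have h1 := cvgD (rA A mA) (rA B mB).
  have h2 := rA _ (measurableU _ _ mA mB).
  have h3 : (fun n => int01_on (A `|` B) (c n)) @ G --> r A + r B.
    rewrite (_ : (fun n => _) = (fun n => int01_on A (c n) + int01_on B (c n))); first exact: h1.
    by apply/funext => n; exact: int01_on_setU.
  exact: (norm_cvg_unique h2 h3).
- move=> A mA; rewrite ler_norml; apply/andP; split.
    apply: limr_ge; first exact: cvA.
    by apply: nearW => n; have := cA n A mA; rewrite ler_norml => /andP[].
  apply: limr_le; first exact: cvA.
  by apply: nearW => n; have := cA n A mA; rewrite ler_norml => /andP[].
by exists d; split => // A mA; rewrite -dr//; exact: rA.
Qed.

Lemma wlimit_lin a c d c' d' : (forall n, bmeas (c n)) -> (forall n, bmeas (c' n)) ->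
  wlimit c d -> wlimit c' d' ->
  wlimit (fun n t => a * c n t + c' n t) (fun t => a * d t + d' t).
Proof.
move=> bc bc' [bd cd] [bd' cd']; split.
  exact: bmeasD (bmeasM (bmeas_cst a) bd) bd'.
move=> A mA; rewrite int01_on_lin//.
have h := cvgD (cvgM (cvg_cst a) (cd A mA)) (cd' A mA).
rewrite (_ : (fun n => _) = (fun n => a * int01_on A (c n) + int01_on A (c' n))); first exact: h.
by apply/funext => n; exact: int01_on_lin.
Qed.

Lemma wlimit_le c d c' d' : (forall n, bmeas (c n)) -> (forall n, bmeas (c' n)) ->
  wlimit c d -> wlimit c' d' -> (forall n t, I t -> c n t <= c' n t) ->
  {ae lambda, forall t, I t -> d t <= d' t}.
Proof.
move=> bc bc' [bd cd] [bd' cd'] cc'; apply: le_ae_int01_on => // A mA.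
apply: (ler_cvg_to (cd A mA) (cd' A mA)); apply: nearW => n.
by apply: le_int01_on => //; exact: cc'.
Qed.

Lemma wlimit_unique c d d' : wlimit c d -> wlimit c d' ->
  {ae lambda, forall t, I t -> d t = d' t}.
Proof.
move=> [bd cd] [bd' cd']; apply: eq_ae_int01_on => // A mA.
exact: (norm_cvg_unique (cd A mA) (cd' A mA)).
Qed.

Lemma wlimit_cst u : bmeas u -> wlimit (fun=> u) u.
Proof. by move=> bu; split => // A mA; exact: cvg_cst. Qed.

Lemma wlimit_uniform c v : (forall n, bmeas (c n)) -> bmeas v ->
  (forall e, 0 < e -> exists N, forall n, (N <= n)%N -> forall t, I t -> `|c n t - v t| <= e) ->
  wlimit c v.
Proof.
move=> bc bv cv; split => // A mA; apply: cvg_ultra.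
apply/cvgrPdist_le => e e0; have [N cN] := cv e e0.
exists N => // n /= Nn; rewrite distrC.
have m1 : int01 (\1_A : R -> R) <= 1.
  rewrite -(int01_cst (1 : R)); apply: le_int01; [exact: bmeas_indicT|exact: bmeas_cst|].
  by move=> t _; rewrite indicE; case: (_ \in _).
have m0 : 0 <= int01 (\1_A : R -> R) by apply: int01_ge0 => t _; rewrite indicE.
have cst a : int01_on A (fun=> a) = a * int01 (\1_A : R -> R).
  rewrite -int01Z; last exact: bmeas_indicT.
  by congr int01; apply/funext => t; rewrite mulrC.
have d0 : int01_on A (c n) - int01_on A v = int01_on A (fun t => -1 * v t + c n t).
  by rewrite int01_on_lin// mulN1r addrC.
have bd : bmeas (fun t => -1 * v t + c n t) := bmeasD (bmeasM (bmeas_cst (-1)) bv) (bc n).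
have ed t : I t -> - e <= -1 * v t + c n t <= e.
  by move=> It; have := cN n Nn t It; rewrite ler_norml mulN1r addrC.
rewrite d0 ler_norml; apply/andP; split.
  apply: (@le_trans _ _ (int01_on A (fun=> - e))).
    by rewrite cst mulNr lerN2 ler_piMr// ltW.
  by apply: le_int01_on => //; [exact: bmeas_cst|move=> t /ed /andP[]].
apply: (@le_trans _ _ (int01_on A (fun=> e))); last by rewrite cst ler_piMr// ltW.
by apply: le_int01_on => //; [exact: bmeas_cst|move=> t /ed /andP[]].
Qed.

Lemma wlimit_int01 c d : wlimit c d -> (fun n => int01 (c n)) @ G --> int01 d.
Proof.
have eT u : int01_on setT u = int01 u.
  by congr int01; apply/funext => t; rewrite indicT mul1r.
move=> [bd /(_ setT measurableT)]; rewrite eT.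
by rewrite (_ : (fun n => _) = (fun n => int01 (c n)))//; apply/funext => n; rewrite eT.
Qed.

Definition cbmeas (f : R -> R[i]) :=
  bmeas (fun t => complex.Re (f t)) /\ bmeas (fun t => complex.Im (f t)).

Definition cwlimit (c : nat -> R -> R[i]) (h : R -> R[i]) :=
  wlimit (fun n t => complex.Re (c n t)) (fun t => complex.Re (h t)) /\
  wlimit (fun n t => complex.Im (c n t)) (fun t => complex.Im (h t)).

Lemma cbmeas_Linf {f} : cbmeas f -> Linfty lambda I f.
Proof.
move=> [[mr [M rM]] [mi [N iN]]]; apply: Linf_bmeas; first by split.
exists (M + N) => t It; rewrite -ler_sqr ?nnegrE ?normc_ge0 ?addr_ge0//; last 2 first.
- exact: le_trans (rM t It).
- exact: le_trans (iN t It).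
rewrite sqr_normcE; have := rM t It; have := iN t It.
rewrite !ler_norml => /andP[? ?] /andP[? ?]; nra.
Qed.

Lemma cbmeas_lin a {f g} : cbmeas f -> cbmeas g -> cbmeas (fun t => a * f t + g t).
Proof.
move=> [f1 f2] [g1 g2]; split.
  rewrite (_ : (fun t => _) = (fun t => complex.Re a * complex.Re (f t) +
     (- complex.Im a * complex.Im (f t) + complex.Re (g t)))).
    by apply: bmeasD (bmeasM (bmeas_cst _) f1) (bmeasD (bmeasM (bmeas_cst _) f2) g1).
  by apply/funext => t; rewrite cReD cReM mulNr addrA.
rewrite (_ : (fun t => _) = (fun t => complex.Re a * complex.Im (f t) +
     (complex.Im a * complex.Re (f t) + complex.Im (g t)))).
  by apply: bmeasD (bmeasM (bmeas_cst _) f2) (bmeasD (bmeasM (bmeas_cst _) f1) g2).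
by apply/funext => t; rewrite cImD cImM addrA.
Qed.

Lemma cwlimit_cbmeas {c h} : cwlimit c h -> cbmeas h.
Proof. by move=> [[? _] [? _]]. Qed.

Lemma cwlimit_lin a c h c' h' : (forall n, cbmeas (c n)) -> (forall n, cbmeas (c' n)) ->
  cwlimit c h -> cwlimit c' h' ->
  cwlimit (fun n t => a * c n t + c' n t) (fun t => a * h t + h' t).
Proof.
move=> bc bc' [c1 c2] [c1' c2'].
have [b1 b2] : (forall n, bmeas (fun t => complex.Re (c n t))) /\
    (forall n, bmeas (fun t => complex.Im (c n t))) by split => n; have [] := bc n.
have [b1' b2'] : (forall n, bmeas (fun t => complex.Re (c' n t))) /\
    (forall n, bmeas (fun t => complex.Im (c' n t))) by split => n; have [] := bc' n.
split.
  have h1 := wlimit_lin (- complex.Im a) _ _ _ _ b2 b1' c2 c1'.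
  have b3 n : bmeas (fun t => - complex.Im a * complex.Im (c n t) + complex.Re (c' n t)).
    exact: bmeasD (bmeasM (bmeas_cst _) (b2 n)) (b1' n).
  have := wlimit_lin (complex.Re a) _ _ _ _ b1 b3 c1 h1.
  congr wlimit; [apply/funext => n|]; apply/funext => t; rewrite cReD cReM; ring.
have h1 := wlimit_lin (complex.Im a) _ _ _ _ b1 b2' c1 c2'.
have b3 n : bmeas (fun t => complex.Im a * complex.Re (c n t) + complex.Im (c' n t)).
  exact: bmeasD (bmeasM (bmeas_cst _) (b1 n)) (b2' n).
have := wlimit_lin (complex.Re a) _ _ _ _ b2 b3 c2 h1.
congr wlimit; [apply/funext => n|]; apply/funext => t; rewrite cImD cImM; ring.
Qed.

Lemma cwlimit_unique c h h' : cwlimit c h -> cwlimit c h' ->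
  {ae lambda, forall t, I t -> h t = h' t}.
Proof.
move=> [a1 a2] [b1 b2]; have := wlimit_unique _ _ _ a2 b2.
have := wlimit_unique _ _ _ a1 b1; apply: filterS2 => t h1 h2 It.
by apply/eqP; rewrite eq_complex h1// h2// !eqxx.
Qed.

Lemma cwlimit_0 : cwlimit (fun _ _ => 0) (fun=> 0).
Proof. by split; exact: wlimit_cst (bmeas_cst 0). Qed.

Lemma cwlimit_sum m (F : 'I_m -> nat -> R -> R[i]) (h : 'I_m -> R -> R[i]) (a : 'I_m -> R[i]) :
  (forall i n, cbmeas (F i n)) -> (forall i, cwlimit (F i) (h i)) ->
  (forall n, cbmeas (fun t => \sum_(i < m) a i * F i n t)) /\
  cwlimit (fun n t => \sum_(i < m) a i * F i n t) (fun t => \sum_(i < m) a i * h i t).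
Proof.
elim: m F h a => [|m IH] F h a bF hF.
  have E (T : Type) (K : T -> 'I_0 -> R[i]) : (fun t => \sum_(i < 0) K t i) = (fun=> 0).
    by apply/funext => t; rewrite big_ord0.
  split => [n|]; first by rewrite E; split; exact: bmeas_cst.
  rewrite E (_ : (fun n => _) = (fun _ _ => 0)); first exact: cwlimit_0.
  by apply/funext => n; rewrite E.
have [b1 h1] := IH (fun i => F (lift ord0 i)) (fun i => h (lift ord0 i)) (fun i => a (lift ord0 i))
  (fun i => bF _) (fun i => hF _).
have E (T : Type) (K : T -> 'I_m.+1 -> R[i]) :
    (fun t => \sum_(i < m.+1) K t i) = (fun t => K t ord0 + \sum_(i < m) K t (lift ord0 i)).
  by apply/funext => t; rewrite big_ord_recl.
split => [n|]; first by rewrite E; exact: cbmeas_lin (bF _ _) (b1 _).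
rewrite E (_ : (fun n => _) = (fun n t => a ord0 * F ord0 n t +
   \sum_(i < m) a (lift ord0 i) * F (lift ord0 i) n t)).
  exact: cwlimit_lin.
by apply/funext => n; rewrite E.
Qed.

End WeakLimitAlongUltrafilter.

(** * Testing a matrix on Gaussian integer vectors *)

Section Gaussian.
Context {R : realType}.
Local Notation lambda := (@completed_lebesgue_measure R).
Local Notation I := (@I01 R).
Unset Implicit Arguments.

Lemma ae_countable (K : countType) (P : K -> caratheodory_type (wlength (@idfun R))^*%mu -> Prop) :
  (forall k, {ae lambda, forall t, P k t}) -> {ae lambda, forall t, forall k, P k t}.
Proof.
move=> H.
have : {ae lambda, forall t, forall n : nat, if unpickle n is Some k then P k t else True}.
  apply/ae_foralln => n; case: (unpickle n) => [k|]; first exact: H.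
  by apply: aeW.
move=> h0; apply: filterS h0 => t h k.
by have := h (pickle k); rewrite pickleK.
Qed.

(** Only countably many vectors are tested, so that inequalities holding a.e. for
    each of them hold for all of them outside a single null set. *)
Definition gauss (z : int * int) : R[i] := (z.1%:~R) +i* (z.2%:~R).

(** The real part of the sesquilinear form b^* A a. *)
Definition re_sesq n (A : 'I_n -> 'I_n -> R[i]) (a b : 'I_n -> R[i]) : R :=
  \sum_(i < n) \sum_(j < n) complex.Re (A i j * (a j * (b i)^*%C)).

Definition sqnorm n (a : 'I_n -> R[i]) : R := \sum_(i < n) Normc.normc (a i) ^+ 2.

Lemma sqnormZ n (s : R) (a : 'I_n -> R[i]) : sqnorm n (fun i => s%:C * a i) = s ^+ 2 * sqnorm n a.
Proof.
rewrite /sqnorm mulr_sumr; apply: eq_bigr => i _.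
rewrite Normc.normcM exprMn; congr (_ * _).
by rewrite sqr_normcE /= expr0n addr0.
Qed.

Lemma re_sesqZ n A (s s' : R) (a b : 'I_n -> R[i]) :
  re_sesq n A (fun i => s%:C * a i) (fun i => s'%:C * b i) = s * s' * re_sesq n A a b.
Proof.
rewrite /re_sesq mulr_sumr; apply: eq_bigr => i _; rewrite mulr_sumr; apply: eq_bigr => j _.
by case: (A i j) => ? ?; case: (a j) => ? ?; case: (b i) => ? ? /=; ring.
Qed.

Lemma cvg_sumR n (f : 'I_n -> nat -> R) (l : 'I_n -> R) : (forall i, f i @ \oo --> l i) ->
  (fun m => \sum_(i < n) f i m) @ \oo --> \sum_(i < n) l i.
Proof.
elim: n f l => [|n IH] f l fl.
  rewrite big_ord0 (_ : (fun m => _) = fun=> 0); first exact: cvg_cst.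
  by apply/funext => m; rewrite big_ord0.
rewrite big_ord_recl (_ : (fun m => _) =
  (fun m => f ord0 m + \sum_(i < n) f (lift ord0 i) m)).
  exact: cvgD (fl _) (IH _ _ (fun i => fl _)).
by apply/funext => m; rewrite big_ord_recl.
Qed.

Definition gauss_floor (l : nat) (z : R[i]) : int * int :=
  (Num.floor (l.+1%:R * complex.Re z), Num.floor (l.+1%:R * complex.Im z)).

Lemma cvg_floor (x : R) : (fun l : nat => (l.+1%:R)^-1 * (Num.floor (l.+1%:R * x))%:~R) @ \oo --> x.
Proof.
apply/cvgrPdist_le => e e0; exists (Num.truncn e^-1).+1 => // l /= le.
have l0 : 0 < l.+1%:R :> R by [].
have le' : (l.+1%:R)^-1 <= e :> R.
  rewrite -[leRHS]invrK lef_pV2 ?posrE ?invr_gt0//.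
  apply: (@le_trans _ _ (Num.truncn e^-1).+1%:R); first exact: ltW (truncnS_gt _).
  by rewrite ler_nat ltnW.
have := floor_itv (l.+1%:R * x : R).
set k := (Num.floor _)%:~R; rewrite intrD -/k => /andP[h1 h2].
apply: le_trans le'; rewrite -(ler_pM2l l0) divff ?gt_eqF//.
rewrite -[X in X * `|_|]gtr0_norm// -normrM mulrBr mulrA divff ?gt_eqF// mul1r.
by rewrite ger0_norm ?subr_ge0// lerBlDl ltW.
Qed.

(** Both sides of the hypothesis are homogeneous and continuous, so rounding
    (l + 1) a to Gaussian integers and dividing by l + 1 extends it to all
    vectors. Taking b = A a / C then bounds A a. *)
Lemma re_sesq_gauss_le n (A : 'I_n -> 'I_n -> R[i]) (C : R) : 0 < C ->
  (forall p q : {ffun 'I_n -> int * int},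
     re_sesq n A (fun j => gauss (p j)) (fun j => gauss (q j)) <=
     C / 2 * (sqnorm n (fun j => gauss (p j)) + sqnorm n (fun j => gauss (q j)))) ->
  forall a, sqnorm n (fun i => \sum_(j < n) A i j * a j) <= C ^+ 2 * sqnorm n a.
Proof.
move=> C0 H.
pose ap l (a : 'I_n -> R[i]) i : R[i] := ((l.+1%:R)^-1)%:C * gauss (gauss_floor l (a i)).
have rcv a i : (fun l => complex.Re (ap l a i)) @ \oo --> complex.Re (a i).
  rewrite (_ : (fun l => _) = (fun l : nat => (l.+1%:R)^-1 * (Num.floor (l.+1%:R * complex.Re (a i)))%:~R)).
    exact: cvg_floor.
  by apply/funext => l; rewrite /ap /gauss /gauss_floor cReM /= mul0r subr0.
have icv a i : (fun l => complex.Im (ap l a i)) @ \oo --> complex.Im (a i).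
  rewrite (_ : (fun l => _) = (fun l : nat => (l.+1%:R)^-1 * (Num.floor (l.+1%:R * complex.Im (a i)))%:~R)).
    exact: cvg_floor.
  by apply/funext => l; rewrite /ap /gauss /gauss_floor cImM /= mul0r addr0.
have scv a : (fun l => sqnorm n (ap l a)) @ \oo --> sqnorm n a.
  apply: cvg_sumR => i.
  rewrite sqr_normcE (_ : (fun l => _) = (fun l => complex.Re (ap l a i) ^+ 2 + complex.Im (ap l a i) ^+ 2)).
    by apply: cvgD; rewrite expr2 ; apply: cvgM.
  by apply/funext => l; rewrite sqr_normcE.
have secv a b : (fun l => re_sesq n A (ap l a) (ap l b)) @ \oo --> re_sesq n A a b.
  apply: cvg_sumR => i; apply: cvg_sumR => j.
  have E (x y z : R[i]) : complex.Re (x * (y * z^*%C)) =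
    complex.Re x * (complex.Re y * complex.Re z + complex.Im y * complex.Im z) -
    complex.Im x * (complex.Im y * complex.Re z - complex.Re y * complex.Im z).
    by case: x => ? ?; case: y => ? ?; case: z => ? ? /=; ring.
  rewrite E (_ : (fun l => _) = (fun l => complex.Re (A i j) * (complex.Re (ap l a j) * complex.Re (ap l b i) + complex.Im (ap l a j) * complex.Im (ap l b i)) -
    complex.Im (A i j) * (complex.Im (ap l a j) * complex.Re (ap l b i) - complex.Re (ap l a j) * complex.Im (ap l b i)))); last first.
    by apply/funext => l; rewrite E.
  apply: cvgB; apply: cvgM; [exact: cvg_cst| |exact: cvg_cst|].
    by apply: cvgD; apply: cvgM.
  by apply: cvgB; apply: cvgM.
have all a b : re_sesq n A a b <= C / 2 * (sqnorm n a + sqnorm n b).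
  have h : (fun l => C / 2 * (sqnorm n (ap l a) + sqnorm n (ap l b))) @ \oo --> C / 2 * (sqnorm n a + sqnorm n b).
    by apply: cvgM; [exact: cvg_cst|exact: cvgD].
  apply: (ler_cvg_to (secv a b) h); apply: nearW => l.
  rewrite re_sesqZ !sqnormZ -mulrDr mulrCA -expr2 ler_wpM2l ?sqr_ge0//.
  have := H [ffun i => gauss_floor l (a i)] [ffun i => gauss_floor l (b i)].
  congr (_ <= _).
    by congr (re_sesq n A _ _); apply/funext => i; rewrite ffunE.
  by congr (_ * (sqnorm n _ + sqnorm n _)); apply/funext => i; rewrite ffunE.
move=> a; set y := fun i => \sum_(j < n) A i j * a j.
have := all a (fun i => (C^-1)%:C * y i).
have -> : re_sesq n A a (fun i => (C^-1)%:C * y i) = C^-1 * sqnorm n y.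
  rewrite /re_sesq /sqnorm mulr_sumr; apply: eq_bigr => i _.
  transitivity (complex.Re (y i * ((C^-1)%:C * y i)^*%C)).
    rewrite /y mulr_suml (big_morph _ (@cReD R) (erefl : complex.Re 0 = 0)).
    by apply: eq_bigr => j _; rewrite mulrA.
  by rewrite sqr_normcE; case: (y i) => c d /=; ring.
rewrite sqnormZ => h.
have {h} := ler_wpM2l (ltW C0) h.
rewrite mulrA divff ?gt_eqF// mul1r exprVn.
have -> : C * (C / 2 * (sqnorm n a + (C ^+ 2)^-1 * sqnorm n y)) = C ^+ 2 * sqnorm n a / 2 + sqnorm n y / 2.
  by field; rewrite gt_eqF.
by move: (sqnorm n y) (C ^+ 2 * _) => u v; clear; lra.
Qed.

Lemma Rintegral_sum n (f : 'I_n -> R -> R) : (forall i, lambda.-integrable I (EFin \o f i)) ->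
  lambda.-integrable I (EFin \o (fun t => \sum_(i < n) f i t)) /\
  \int[lambda]_(t in I) (\sum_(i < n) f i t) = \sum_(i < n) \int[lambda]_(t in I) f i t.
Proof.
elim: n f => [|n IH] f fi.
  rewrite (_ : (fun t => \sum_(i < 0) f i t) = fun=> 0); last by apply/funext => t; rewrite big_ord0.
  by split; [exact: bmeas_integrable (bmeas_cst 0)|rewrite big_ord0; exact: int01_cst].
have [h1 h2] := IH (fun i => f (lift ord0 i)) (fun i => fi _).
rewrite (_ : (fun t => \sum_(i < n.+1) f i t) = (fun t => f ord0 t + \sum_(i < n) f (lift ord0 i) t)); last first.
  by apply/funext => t; rewrite big_ord_recl.
split; first exact: (integrableD (@measurable_I01 R) (fi _) h1).
by rewrite RintegralD; [rewrite h2 big_ord_recl|exact: measurable_I01|exact: fi|exact: h1].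
Qed.

Local Notation L2f := (L2fun lambda (@measurable_I01 R)).
Local Notation cls := (@L2class _ _ R lambda I (@measurable_I01 R)).

Lemma cls_sum n (F : 'I_n -> L2f) : \sum_(i < n) cls (F i) = cls (\sum_(i < n) F i).
Proof.
elim: n F => [|n IH] F; first by rewrite !big_ord0.
by rewrite !big_ord_recl L2classD IH.
Qed.

Lemma L2fun_sumE n (F : 'I_n -> L2f) t : (\sum_(i < n) F i : L2f) t = \sum_(i < n) F i t.
Proof.
elim: n F => [|n IH] F; first by rewrite !big_ord0.
by rewrite !big_ord_recl -IH.
Qed.

End Gaussian.

(** * Completely contractive maps built from localized vector states *)

Section SingularMap.
Context {R : realType}.
Local Notation lambda := (@completed_lebesgue_measure R).
Local Notation I := (@I01 R).
Local Notation Linf := (Linfty lambda I).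
Local Notation H := (L2_01 R).
Local Notation hn := (hnorm (dot01 R)).
Local Notation V := (@pi01 R @` @continuous01 R).
Local Notation BH := (bop (dot01 R)).
Local Notation cls := (@L2class _ _ R lambda I (@measurable_I01 R)).
Unset Implicit Arguments.

(** The vector xi n k is localized on the k-th cell of the n-th partition: its
    vector state sees only the values of a symbol there. *)
Variable xi : nat -> nat -> H.
Hypothesis xi1 : forall n k, (k <= n)%N -> hn (xi n k) = 1.
Hypothesis xi_local : forall n k, (k <= n)%N -> forall (f : R -> R[i]) (c : R), Linf f ->
  (forall t, I t -> cell n t = k -> c <= complex.Re (f t)) ->
  c <= complex.Re (dot01 R (pi01 f (xi n k)) (xi n k)).

Variable G : set_system nat.
Context {GU : UltraFilter G}.
Hypothesis ooG : \oo `<=` G.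

(** A vector state in S for each t, and a step function of t for each S. *)
Definition state (S : BH) (n : nat) (t : R) : R[i] :=
  dot01 R (S (xi n (cell n t))) (xi n (cell n t)).

Lemma state_cbmeas S n : cbmeas (state S n).
Proof.
by split; apply: squeezed_bmeas;
  [exact: (squeezed_step n (fun k => complex.Re (dot01 R (S (xi n k)) (xi n k))))
  |exact: (squeezed_step n (fun k => complex.Im (dot01 R (S (xi n k)) (xi n k))))].
Qed.

Lemma state_lin (a : R[i]) S S' n t : state (a *: S + S') n t = a * state S n t + state S' n t.
Proof. by rewrite /state addbopE scalebopE dotDl dotZl. Qed.

Lemma state_bound S : exists M : R, forall n t, Normc.normc (state S n t) <= M.
Proof.
have [M M0 SM] := bop_bounded _ S; exists M => n t.
apply: le_trans (cauchy_schwarz _ _ _) _.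
have x1 := xi1 n (cell n t) (cell_le n t).
by apply: le_trans (ler_wpM2r (hnorm_ge0 _ _) (SM _)) _; rewrite x1 !mulr1.
Qed.

Lemma state_limit S : exists h, cwlimit G (state S) h.
Proof.
have [M SM] := state_bound S.
have [u hu] : exists u, wlimit G (fun n t => complex.Re (state S n t)) u.
  apply: (wlimit_ex G _ M) => [n|n t _]; first exact: (state_cbmeas S n).1.
  exact: le_trans (ler_Re_normc _) (SM n t).
have [v hv] : exists v, wlimit G (fun n t => complex.Im (state S n t)) v.
  apply: (wlimit_ex G _ M) => [n|n t _]; first exact: (state_cbmeas S n).2.
  exact: le_trans (ler_Im_normc _) (SM n t).
by exists (fun t => u t +i* v t).
Qed.

(** The weak limit of the step functions of S; multiplication by it is the image
    of S under the map under construction. *)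
Definition symbol (S : BH) : R -> R[i] := sval (cid (state_limit S)).

Lemma symbolP S : cwlimit G (state S) (symbol S).
Proof. exact: svalP (cid (state_limit S)). Qed.

Lemma symbol_Linf S : Linf (symbol S).
Proof. exact: cbmeas_Linf (cwlimit_cbmeas G (symbolP S)). Qed.

Lemma pi01_symbol S h : cwlimit G (state S) h -> pi01 (symbol S) = pi01 h.
Proof.
move=> Sh; apply: (pi01_ae _ _ (symbol_Linf S) (cbmeas_Linf (cwlimit_cbmeas G Sh))).
exact: cwlimit_unique (symbolP S) Sh.
Qed.

Definition singular_fun (S : BH) : BH := pi01 (symbol S).

Lemma singular_fun_linear : linear singular_fun.
Proof.
move=> a S S'; rewrite /singular_fun -(pi01_lin a (symbol_Linf S) (symbol_Linf S')).
apply: pi01_symbol.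
have -> : state (a *: S + S') = (fun n t => a * state S n t + state S' n t).
  by apply/funext => n; apply/funext => t; rewrite state_lin.
exact: cwlimit_lin (state_cbmeas S) (state_cbmeas S') (symbolP S) (symbolP S').
Qed.

Definition singular : {linear BH -> BH} :=
  HB.pack singular_fun (GRing.isLinear.Build _ _ _ _ singular_fun singular_fun_linear).

(** The entries state (T i j) n t form the matrix a |-> <T (a xi), b xi>, a
    compression of T; the product of norms from the Cauchy-Schwarz inequality
    is split with weight C so that both sides become homogeneous polynomials. *)
Lemma state_re_sesq_le m (T : 'M[BH]_m) (C : R) : 0 < C ->
  (forall x : 'I_m -> H, hnormn (dot01 R) (mxact T x) <= C * hnormn (dot01 R) x) ->
  forall n t (a b : 'I_m -> R[i]),
  re_sesq m (fun i j => state (T i j) n t) a b <= C / 2 * (sqnorm m a + sqnorm m b).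
Proof.
move=> C0 TC n t a b; rewrite /state; set x := xi n (cell n t).
have x1 : hn x = 1 by exact: xi1 (cell_le n t).
pose y i := mxact T (fun j => a j *: x) i.
have le1 (z : R[i]) : complex.Re z <= Normc.normc z.
  exact: le_trans (ler_norm _) (ler_Re_normc _).
have yS : \sum_(i < m) hn (y i) ^+ 2 <= C ^+ 2 * sqnorm m a.
  have := (le_hnormn (dot01 R) m _ _ C (ltW C0)).1 (TC (fun j => a j *: x)).
  congr (_ <= _ * _); apply: eq_bigr => i _.
  by rewrite hnormZ x1 mulr1.
apply: (@le_trans _ _ (\sum_(i < m) (hn (y i) ^+ 2 / (2 * C) + C / 2 * Normc.normc (b i) ^+ 2))).
  apply: ler_sum => i _.
  have -> : \sum_(j < m) complex.Re (dot01 R (T i j x) x * (a j * (b i)^*%C)) =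
      complex.Re (dot01 R (y i) (b i *: x)).
    rewrite -(big_morph _ (@cReD R) (erefl : complex.Re 0 = 0)); congr complex.Re.
    rewrite dotZr /y /mxact.
    have -> : dot01 R (\sum_(j < m) T i j (a j *: x)) x = \sum_(j < m) a j * dot01 R (T i j x) x.
      rewrite (big_morph (fun z => dot01 R z x) (fun u v => dotDl (dot01 R) u v x)
         (linear0l (dot01 R) x)).
      by apply: eq_bigr => j _; rewrite bopZ dotZl.
    by rewrite mulr_sumr; apply: eq_bigr => j _; ring.
  apply: le_trans (le1 _) _; apply: le_trans (cauchy_schwarz _ _ _) _.
  rewrite hnormZ x1 mulr1.
  have := sqr_ge0 (hn (y i) - C * Normc.normc (b i)).
  have C2 : 0 < (2 * C)^-1 by rewrite invr_gt0 mulr_gt0.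
  move=> /(mulr_ge0 (ltW C2)).
  rewrite -subr_ge0; set p := hn _; set q := Normc.normc _.
  have -> : (2 * C)^-1 * (p - C * q) ^+ 2 = p ^+ 2 / (2 * C) + C / 2 * q ^+ 2 - p * q.
    by field; rewrite gt_eqF.
  by rewrite !subr_ge0.
rewrite big_split /= -mulr_suml -mulr_sumr -/(sqnorm m b) mulrDr lerD2r.
rewrite ler_pdivrMr ?mulr_gt0//; apply: le_trans yS _.
by rewrite le_eqVlt; apply/orP; left; apply/eqP; field.
Qed.

Lemma symbol_re_sesq_le m (T : 'M[BH]_m) (C : R) : 0 < C ->
  (forall x : 'I_m -> H, hnormn (dot01 R) (mxact T x) <= C * hnormn (dot01 R) x) ->
  forall (a b : 'I_m -> R[i]), {ae lambda, forall t, I t ->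
  re_sesq m (fun i j => symbol (T i j) t) a b <= C / 2 * (sqnorm m a + sqnorm m b)}.
Proof.
move=> C0 TC a b.
pose c i j := a j * (b i)^*%C.
pose F i n t := \sum_(j < m) c i j * state (T i j) n t.
pose h i t := \sum_(j < m) c i j * symbol (T i j) t.
have Fh i : (forall n, cbmeas (F i n)) /\ cwlimit G (F i) (h i).
  by apply: cwlimit_sum => j; [exact: state_cbmeas|exact: symbolP].
have [bF cF] := cwlimit_sum G m F h (fun=> 1) (fun i => (Fh i).1) (fun i => (Fh i).2).
have E (A : 'I_m -> 'I_m -> R[i]) : complex.Re (\sum_(i < m) 1 * \sum_(j < m) c i j * A i j) = re_sesq m A a b.
  rewrite (big_morph _ (@cReD R) (erefl : complex.Re 0 = 0)); apply: eq_bigr => i _.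
  rewrite mul1r (big_morph _ (@cReD R) (erefl : complex.Re 0 = 0)); apply: eq_bigr => j _.
  by rewrite mulrC.
have := wlimit_le G _ _ _ _ (fun n => (bF n).1) (fun n => bmeas_cst (C / 2 * (sqnorm m a + sqnorm m b)))
   cF.1 (wlimit_cst G _ (bmeas_cst _)).
have le_n n t : I t -> complex.Re (\sum_(i < m) 1 * F i n t) <= C / 2 * (sqnorm m a + sqnorm m b).
  by move=> It; rewrite E; exact: state_re_sesq_le.
move=> /(_ GU GU le_n) h0; apply: filterS h0 => t + It => /(_ It); by rewrite E.
Qed.

(** The matrix of symbols satisfies a.e. the bound of the matrices of states, of
    which it is a weak limit; this pointwise bound is then integrated against a
    vector of L^2 functions. *)
Lemma singular_bound m (T : 'M[BH]_m) (C : R) : 0 < C ->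
  (forall x : 'I_m -> H, hnormn (dot01 R) (mxact T x) <= C * hnormn (dot01 R) x) ->
  forall x : 'I_m -> H, hnormn (dot01 R) (mxact (map_mx singular T) x) <= C * hnormn (dot01 R) x.
Proof.
move=> C0 TC x.
pose A i j := symbol (T i j); pose y j := repr (x j).
have ae_le : {ae lambda, forall t, I t ->
    \sum_(i < m) Normc.normc (\sum_(j < m) A i j t * y j t) ^+ 2 <=
    C ^+ 2 * \sum_(j < m) Normc.normc (y j t) ^+ 2}.
  have := ae_countable ({ffun 'I_m -> int * int} * {ffun 'I_m -> int * int})%type
    (fun pq t => I t -> re_sesq m (fun i j => symbol (T i j) t)
        (fun j => gauss (pq.1 j)) (fun j => gauss (pq.2 j)) <=
      C / 2 * (sqnorm m (fun j => gauss (pq.1 j)) + sqnorm m (fun j => gauss (pq.2 j)))).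
  move=> /(_ (fun pq => symbol_re_sesq_le m T C C0 TC _ _)) h; apply: filterS h => t h It.
  exact: (re_sesq_gauss_le m (fun i j => symbol (T i j) t) C C0 (fun p q => h (p, q) It) (fun j => y j t)).
pose F i j := mulfun (symbol_Linf (T i j)) (y j).
have actE i : mxact (map_mx singular T) x i = cls (\sum_(j < m) F i j).
  rewrite /mxact -cls_sum; apply: eq_bigr => j _.
  by rewrite mxE -[x j]L2class_repr; exact: pi01E.
apply: (le_hnormn (dot01 R) m _ _ C (ltW C0)).2.
under eq_bigr do rewrite actE hnorm_cls.
have -> : \sum_(j < m) hn (x j) ^+ 2 = \sum_(j < m) \int[lambda]_(t in I) Normc.normc (y j t) ^+ 2.
  by apply: eq_bigr => j _; rewrite -{1}[x j]L2class_repr hnorm_cls.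
have [i1 <-] := Rintegral_sum m (fun i t => Normc.normc ((\sum_(j < m) F i j) t) ^+ 2)
  (fun i => sq_int _).
have [i2 <-] := Rintegral_sum m (fun j t => Normc.normc (y j t) ^+ 2) (fun i => sq_int _).
rewrite -(RintegralZl _ (@measurable_I01 R) i2).
apply: le_Rintegral_ae; [exact: i1|exact: integrable_bmeasM (bmeas_cst (C ^+ 2)) i2|].
apply: filterS ae_le => t + It => /(_ It).
by congr (_ <= _); apply: eq_bigr => i _; rewrite L2fun_sumE.
Qed.

Lemma singular_completely_contractive : completely_contractive singular.
Proof.
(* The estimates need a positive bound; M = 0 is reached as a limit of such. *)
apply/completely_contractiveP => m T M M0 TM x; apply/ler_addgt0Pr => e e0.
pose N := hnormn (dot01 R) x + 1; have N0 : 0 < N by rewrite ltr_wpDl ?hnormn_ge0.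
have C0 : 0 < M + e / N by rewrite ltr_wpDl// divr_gt0.
have TC (z : 'I_m -> H) : hnormn (dot01 R) (mxact T z) <= (M + e / N) * hnormn (dot01 R) z.
  by apply: le_trans (TM z) _; rewrite ler_wpM2r ?hnormn_ge0// lerDl divr_ge0// ltW.
apply: le_trans (singular_bound m T _ C0 TC x) _.
rewrite mulrDl lerD2l mulrAC ler_pdivrMr// ler_wpM2l ?(ltW e0)// lerDl //.
Qed.

Lemma cell_dist n (s t : R) : I s -> I t -> cell n s = cell n t -> `|s - t| <= n.+1%:R^-1.
Proof.
move=> Is It st; have /andP[a1 a2] := cell_itv n s Is; have /andP[b1 b2] := cell_itv n t It.
rewrite st in a1 a2.
have E : (cell n t).+1%:R / n.+1%:R = (cell n t)%:R / n.+1%:R + n.+1%:R^-1 :> R.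
  by rewrite -natr1 mulrDl mul1r.
rewrite E in a2 b2.
move: a1 a2 b1 b2; set p := _ / _; set q := _^-1; move: p q; clear=> p q ? ? ? ?.
by rewrite ler_norml; apply/andP; split; lra.
Qed.

(** The vectors of a cell only see the values of f there, and the cells shrink:
    uniform continuity makes the values of f on the cell of t close to f t. *)
Lemma state_continuous (f : R -> R[i]) : continuous01 f -> forall e, 0 < e ->
  exists N, forall n, (N <= n)%N -> forall t, I t ->
  complex.Re (f t) - e <= complex.Re (state (pi01 f) n t).
Proof.
move=> cf e e0; have /continuous01P[cr _] := cf.
have [d d0 fd] := cont01_uniform _ cr e e0.
exists (Num.truncn d^-1) => n Nn t It; apply: xi_local; [exact: cell_le|exact: continuous01_Linfty|].
move=> s Is st; have := fd s t Is It.
have -> : `|s - t| < d.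
  apply: le_lt_trans (cell_dist _ _ _ Is It st) _.
  rewrite -[ltRHS]invrK ltf_pV2 ?posrE ?invr_gt0//.
  by apply: lt_le_trans (truncnS_gt _) _; rewrite ler_nat ltnS.
by move=> /(_ isT); rewrite ltr_norml => /andP[? _]; lra.
Qed.

Lemma stateZ (a : R[i]) (f : R -> R[i]) n t : Linf f -> state (pi01 (fun s => a * f s)) n t = a * state (pi01 f) n t.
Proof. by move=> Lf; rewrite (pi01Z a Lf) /state scalebopE dotZl. Qed.

(** The lower estimate state_continuous, applied to multiples of f by 1, -1, i and
    -i, gives uniform convergence of the step functions to f. *)
Lemma singular_id S : V S -> singular S = S.
Proof.
move=> [f cf <-]; have Lf := continuous01_Linfty cf.
have cZ a : continuous01 (fun t => a * f t).
  have c0 : continuous01 (fun=> 0 : R[i]) by apply/continuous01P; split; exact: cont01_cst.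
  have -> : (fun t => a * f t) = a *: (f : R -> R[i]^o) + (fun=> 0).
    by apply/funext => t; rewrite -[RHS]/(a * f t + 0) addr0.
  have [h _ _] := continuous01_stable a cf c0; exact: h.
have /continuous01P[/cont01_bmeas br /cont01_bmeas bi] := cf.
have near2 a e : 0 < e -> exists N, forall n, (N <= n)%N -> forall t, I t ->
    `|complex.Re (a * state (pi01 f) n t) - complex.Re (a * f t)| <= e.
  move=> e0; have [N1 h1] := state_continuous _ (cZ a) e e0.
  have [N2 h2] := state_continuous _ (cZ (- a)) e e0.
  exists (maxn N1 N2) => n; rewrite geq_max => /andP[n1 n2] t It.
  have := h1 n n1 t It; have := h2 n n2 t It; rewrite (stateZ a _ _ _ Lf) (stateZ (- a) _ _ _ Lf).
  rewrite !mulNr; case: (a * f t) => p q; case: (a * state _ _ _) => p' q' /= ? ?.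
  by rewrite ler_norml; apply/andP; split; lra.
rewrite -[LHS]/(pi01 (symbol (pi01 f))); apply: pi01_symbol; split.
  apply: (wlimit_uniform G ooG) => [n||e e0]; [exact: (state_cbmeas _ n).1|exact: br|].
  have [N h] := near2 1 e e0; exists N => n Nn t It.
  by have := h n Nn t It; rewrite !mul1r.
apply: (wlimit_uniform G ooG) => [n||e e0]; [exact: (state_cbmeas _ n).2|exact: bi|].
have [N h] := near2 (- 'i) e e0; exists N => n Nn t It.
have := h n Nn t It.
have E (z : R[i]) : complex.Re (- 'i * z) = complex.Im z by case: z => ? ? /=; ring.
by rewrite !E.
Qed.

Lemma hull_state_limit (f : R -> R[i]) : cbmeas f -> fix_hull V (pi01 f) ->
  (fun n => int01 (fun t => complex.Re (state (pi01 f) n t))) @ G -->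
  int01 (fun t => complex.Re (f t)).
Proof.
move=> bf hf; have := hf singular singular_completely_contractive singular_id.
move=> /(pi01_eqP (symbol_Linf _) (cbmeas_Linf bf)) E.
have h := wlimit_int01 G _ _ (symbolP (pi01 f)).1.
have bs := (cwlimit_cbmeas G (symbolP (pi01 f))).1.
suff -> : int01 (fun t => complex.Re (f t)) = int01 (fun t => complex.Re (symbol (pi01 f) t)).
  exact: h.
by apply/eqP; rewrite eq_le; apply/andP; split; apply: le_int01_ae => //; try exact: bf.1;
  apply: filterS E => t h0 It; rewrite (h0 It).
Qed.

End SingularMap.

(** * Localized vectors and upper sums *)

Section LocalizedVectors.
Context {R : realType}.
Local Notation lambda := (@completed_lebesgue_measure R).
Local Notation I := (@I01 R).
Local Notation Linf := (Linfty lambda I).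
Local Notation H := (L2_01 R).
Local Notation hn := (hnorm (dot01 R)).
Local Notation V := (@pi01 R @` @continuous01 R).
Local Notation L2f := (L2fun lambda (@measurable_I01 R)).
Local Notation cls := (@L2class _ _ R lambda I (@measurable_I01 R)).
Local Notation Tc := (caratheodory_type (wlength (@idfun R))^*%mu).
Unset Implicit Arguments.

Definition cellset n k : set Tc := I `&` [set t | cell n t = k].

Lemma measurable_cellset n k : measurable (cellset n k).
Proof.
have [ms _] := squeezed_bmeas (squeezed_step n (fun j => (j == k)%:R : R)).
have := ms (@measurable_I01 R) `[1, +oo[%classic (measurable_itv _).
congr measurable; apply/seteqP; split => t [It /=]; rewrite in_itv /= andbT.
  by case: eqP => // _; rewrite ler10.
by move=> ->; rewrite eqxx lexx.
Qed.

Lemma cellset_gt0 n k : (k <= n)%N -> (0 < lambda (cellset n k))%E.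
Proof.
move=> kn; have N0 : 0 < n.+1%:R :> R by [].
have sub : `[k%:R / n.+1%:R, k.+1%:R / n.+1%:R[%classic `<=` cellset n k.
  move=> t /=; rewrite in_itv /= ler_pdivrMr// ltr_pdivlMr// => /andP[h1 h2].
  split; last first.
    by rewrite /= /cell (truncn_def (n := k)) ?h1//; apply/minn_idPr.
  apply/I01P; apply/andP; split.
    by rewrite -(ler_pM2r N0) mul0r (le_trans _ h1).
  rewrite -(ler_pM2r N0) mul1r (le_trans (ltW h2))// ler_nat ltnS //.
apply: (@lt_le_trans _ _ (lambda `[k%:R / n.+1%:R, k.+1%:R / n.+1%:R[%classic)); last exact: le_outer_measure.
rewrite [ltRHS](_ : _ = lebesgue_measure (`[k%:R / n.+1%:R, k.+1%:R / n.+1%:R[%classic : set R))//.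
rewrite lebesgue_measure_itv /= lte_fin ltr_pM2r ?invr_gt0// ltr_nat ltnSn.
by rewrite -EFinB lte_fin subr_gt0 ltr_pM2r ?invr_gt0// ltr_nat.
Qed.

(** An essential supremum up to e: c is the least number of the form - M + j e
    that bounds u a.e. on E, and B is where u exceeds the preceding one. *)
Lemma ess_sup_approx (u : R -> R) e (E : set Tc) : bmeas u -> 0 < e -> measurable E -> E `<=` I ->
  (0 < lambda E)%E -> exists c (B : set Tc),
  [/\ {ae lambda, forall t, E t -> u t <= c}, measurable B, B `<=` E, (0 < lambda B)%E &
      forall t, B t -> c - e <= u t].
Proof.
move=> [mu [M uM]] e0 mE EI E0.
pose c (j : nat) := - M + j%:R * e.
pose B j : set Tc := E `&` [set t | c j < u t].
have mB j : measurable (B j).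
  have -> : B j = E `&` (I `&` u @^-1` `]c j, +oo[%classic).
    apply/seteqP; split => t; first by move=> [Et /= ct]; split => //; split; [exact: EI|rewrite /= in_itv /= andbT].
    by move=> [Et [_ /=]]; rewrite in_itv /= andbT.
  apply: measurableI => //; exact: (mu (@measurable_I01 R) `]c j, +oo[%classic (measurable_itv _)).
(* The upper bound M of u is passed after 2 M / e steps. *)
have exj : exists j, lambda (B j) == 0%E.
  exists (Num.truncn (2 * M / e)).+1; rewrite [X in lambda X](_ : _ = set0) ?measure0//.
  apply/seteqP; split => // t [Et /=]; apply/negP; rewrite -leNgt.
  apply: le_trans (ler_norm _) _; apply: le_trans (uM t (EI _ Et)) _.
  have := ltW (truncnS_gt (2 * M / e)); rewrite ler_pdivrMr// /c; lra.
case: (ex_minnP exj) => j /eqP Bj0 jmin.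
have ae_c : {ae lambda, forall t, E t -> u t <= c j}.
  exists (B j); split => // t /= /not_implyP[Et /negP]; rewrite -ltNge => h.
  by split.
case: j Bj0 jmin ae_c => [|j] Bj0 jmin ae_c.
  exists (c 0%N), E; split => // t Et; have := uM t (EI _ Et).
  by rewrite ler_norml /c mul0r addr0 => /andP[h _]; apply: le_trans h; rewrite gerBl ltW.
exists (c j.+1), (B j); split => //.
- by move=> t [].
- rewrite lt_neqAle measure_ge0 andbT eq_sym; apply/negP => /jmin.
  by rewrite ltnn.
- by move=> t [_ /= /ltW]; apply: le_trans; rewrite /c -natr1; lra.
Qed.

Lemma bmeas_sq_integrable (v : R -> R) : bmeas v ->
  (fun t => (v t)%:C) \in sq_integrable lambda (@measurable_I01 R).
Proof.
move=> bv; apply: (@sq_integrable_le _ _ R lambda I (@measurable_I01 R) (ofreal v) (fun t => v t * v t)).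
- by split; [exact: bv.1|exact: measurable_cst].
- exact: bmeas_integrable (bmeasM bv bv).
- by apply: aeW => t _; rewrite sqr_normcE /= expr0n addr0 expr2.
Qed.

Lemma Re_dot_pi01 (f : R -> R[i]) (Lf : Linf f) (g : L2f) :
  complex.Re (dot01 R (pi01 f (cls g)) (cls g)) =
  \int[lambda]_(t in I) (complex.Re (f t) * Normc.normc (g t) ^+ 2).
Proof.
rewrite (pi01E Lf) [X in complex.Re X](L2dotE (mulfun Lf g) g) /cintegral.
apply: eq_Rintegral => t _; rewrite sqr_normcE /=.
by case: (f t) => a b; case: (g t) => c d /=; ring.
Qed.

(** x is the normalized indicator function of B, so that its vector state is the
    average over B. *)
Lemma localized_vector (B : set Tc) : measurable B -> B `<=` I -> (0 < lambda B)%E ->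
  exists2 x : H, hn x = 1 & forall (f : R -> R[i]) (c : R), Linf f ->
  (forall t, B t -> c <= complex.Re (f t)) -> c <= complex.Re (dot01 R (pi01 f x) x).
Proof.
move=> mB BI B0.
have lB : lambda B = (int01 (\1_B : R -> R))%:E.
  rewrite /int01 /Rintegral integral_indic//; last exact: measurable_I01.
  have BIB : B `&` I = B by apply/setIidPl.
  rewrite BIB fineK// ge0_fin_numE; last exact: measure_ge0.
  apply: (@le_lt_trans _ _ (lambda I)); last by rewrite lambda_I01 ltry.
  by apply: le_measure; rewrite ?inE//; exact: measurable_I01.
set m := int01 _ in lB; have m0 : 0 < m by rewrite -lte_fin -lB.
have bB := bmeas_indicT B mB.
pose v (t : R) := (Num.sqrt m)^-1 * (\1_B t : R).
have bv : bmeas v by exact: bmeasM (bmeas_cst _) bB.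
pose g : L2f := MkL2fun (bmeas_sq_integrable v bv).
have gE t : Normc.normc (g t) ^+ 2 = m^-1 * (\1_B t : R).
  rewrite sqr_normcE /= expr0n addr0 /v exprMn exprVn sqr_sqrtr ?(ltW m0)//.
  by congr (_ * _); rewrite indicE; case: (_ \in _); rewrite ?expr1n ?expr0n.
have iB := bmeas_integrable bB.
have ig : \int[lambda]_(t in I) Normc.normc (g t) ^+ 2 = 1.
  transitivity (\int[lambda]_(t in I) (m^-1 * (\1_B t : R))).
    by apply: eq_Rintegral => t _; exact: gE.
  rewrite (RintegralZl _ (@measurable_I01 R) iB) -[X in _ * X]/m.
  by rewrite mulVf// gt_eqF.
exists (cls g).
  apply/eqP; rewrite -(@eqrXn2 _ 2)// ?hnorm_ge0//.
  by rewrite [X in X == _]hnorm_cls ig expr1n.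
move=> f c Lf fc; rewrite (Re_dot_pi01 f Lf g).
rewrite -[leLHS]mulr1 -ig -(RintegralZl _ (@measurable_I01 R) (sq_int g)).
have [mr [M rM]] := Lf.
have mrf : measurable_fun I (fun t => complex.Re (f t)) := mr.1.
have ir : lambda.-integrable I (EFin \o (fun t => complex.Re (f t) * Normc.normc (g t) ^+ 2)).
  have [h1 _] := cintegrable_dot (mulfun Lf g) g.
  apply: eq_integrable h1; first exact: measurable_I01.
  move=> t _; apply: (congr1 EFin); rewrite sqr_normcE -[mulfun Lf g t]/(f t * g t).
  by case: (f t) => a b; case: (g t) => a' b' /=; ring.
apply: le_Rintegral; [exact: measurable_I01| |exact: ir|].
  exact: integrable_bmeasM (bmeas_cst c) (sq_int g).
move=> t It; rewrite gE indicE; case: (boolP (t \in B)); last by rewrite !mulr0.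
by rewrite inE mulr1 => Bt; rewrite ler_wpM2r ?invr_ge0 ?(ltW m0)// fc.
Qed.

(** Choose on each cell a vector that nearly attains the essential supremum of
    Re f. The integrals of the resulting step functions nearly dominate those of
    the essential upper step functions of Re f, and converge to the integral of
    Re f because pi01 f is fixed by the singular map of these vectors. *)
Lemma hull_upper_step (f : R -> R[i]) : cbmeas f -> fix_hull V (pi01 f) ->
  forall e, 0 < e -> exists w, [/\ squeezed w,
    {ae lambda, forall t, I t -> complex.Re (f t) <= w t} &
    int01 w <= int01 (fun t => complex.Re (f t)) + e].
Proof.
move=> bf hf e e0; have e2 : 0 < e / 2 by rewrite divr_gt0.
have Lf := cbmeas_Linf bf; have bu := bf.1.
have /choice[z zP] : forall nk : nat * nat, exists z : R * H, (nk.2 <= nk.1)%N ->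
    [/\ {ae lambda, forall t, I t -> cell nk.1 t = nk.2 -> complex.Re (f t) <= z.1},
        hn z.2 = 1,
        forall (g : R -> R[i]) (c : R), Linf g ->
          (forall t, I t -> cell nk.1 t = nk.2 -> c <= complex.Re (g t)) ->
          c <= complex.Re (dot01 R (pi01 g z.2) z.2) &
        z.1 - e / 2 <= complex.Re (dot01 R (pi01 f z.2) z.2)].
  move=> [n k] /=; have [kn|_] := leqP k n; last by exists (0, 0).
  have EI : cellset n k `<=` I by move=> t [].
  have [c [B [uc mB BE B0 Bc]]] := ess_sup_approx _ _ _ bu e2 (measurable_cellset n k) EI (cellset_gt0 n k kn).
  have [x x1 xB] := localized_vector B mB (subset_trans BE EI) B0.
  exists (c, x) => _ /=; split => //.
  - by apply: filterS uc => t h It tk; apply: h; split.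
  - by move=> g c' Lg gc; apply: xB => // t /BE [It tk]; exact: gc.
  - exact: xB.
pose xi n k := (z (n, k)).2; pose c n k := (z (n, k)).1.
have [G [GU ooG]] := @ultraFilterLemma nat \oo _.
have xi1 n k : (k <= n)%N -> hn (xi n k) = 1 by move=> /(zP (n, k))[].
have xiloc n k : (k <= n)%N -> forall (g : R -> R[i]) (c : R), Linf g ->
  (forall t, I t -> cell n t = k -> c <= complex.Re (g t)) ->
  c <= complex.Re (dot01 R (pi01 g (xi n k)) (xi n k)) by move=> /(zP (n, k))[].
have lim := hull_state_limit xi xi1 xiloc G ooG f bf hf; have {}lim := lim GU.
have GP : ProperFilter G by exact: (@ultra_proper _ _ GU).
have near_n := (cvgrPdist_lt (F := G) _ _).1 lim _ e2.
have [n nP] := @filter_ex _ G GP _ (near_n _).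
exists (fun t => c n (cell n t)); split.
- exact: squeezed_step.
- have h : {ae lambda, forall t, forall k : nat, I t -> (k <= n)%N -> cell n t = k -> complex.Re (f t) <= c n k}.
    apply: (ae_countable nat (fun k t => I t -> (k <= n)%N -> cell n t = k -> complex.Re (f t) <= c n k)) => k.
    have [kn|kn] := leqP k n; last by apply: aeW.
    by have [h _ _ _] := zP (n, k) kn; apply: filterS h => t h It _; exact: h.
  by apply: filterS h => t h It; apply: (h _ It (cell_le n t)).
have bc : bmeas (fun t => c n (cell n t)) := squeezed_bmeas (squeezed_step n (c n)).
have h1 : int01 (fun t => c n (cell n t) - e / 2) <= int01 (fun t => complex.Re (state xi (pi01 f) n t)).
  apply: le_int01; [exact: bmeasB bc (bmeas_cst _)|exact: (state_cbmeas xi _ n).1|].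
  by move=> t It; have [_ _ _] := zP (n, cell n t) (cell_le n t).
move: nP h1; rewrite int01B//; last exact: bmeas_cst.
rewrite int01_cst ltr_norml => /andP[? ?] ?; lra.
Qed.

End LocalizedVectors.

(** * The operators fixed by all completely contractive maps *)

Section Final.
Context {R : realType}.
Local Notation lambda := (@completed_lebesgue_measure R).
Local Notation I := (@I01 R).
Local Notation Linf := (Linfty lambda I).
Local Notation hn := (hnorm (dot01 R)).
Local Notation V := (@pi01 R @` @continuous01 R).
Local Notation BH := (bop (dot01 R)).
Implicit Types (u v : R -> R) (f g : R -> R[i]).
Unset Implicit Arguments.

(** Up to squeezed terms u^2 is (u + M)^2, where u + M takes values in [0, 2 M].
    On this interval squaring is nondecreasing and 4 M-Lipschitz, which clamping
    the argument, as F does, makes true on the whole line. *)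
Lemma squeezed_sqr {u} : squeezed u -> squeezed (fun t => u t ^+ 2).
Proof.
move=> su; have [M0 uM0] := squeezed_bounded su; pose M := `|M0|.
have M_ge0 : 0 <= M by exact: normr_ge0.
have uM t : I t -> - M <= u t <= M.
  by move=> It; rewrite -ler_norml (le_trans (uM0 t It))// ler_norm.
pose F (s : R) : R := Num.max 0 (Num.min (2 * M) s) ^+ 2.
have cF : continuous F.
  move=> s; have cc (k : R) : {for s, continuous (fun=> k : R^o)} by exact: cvg_cst.
  have h : {for s, continuous (id : R -> R^o)} by exact: cvg_id.
  pose F1 (r : R) : R := Num.max 0 (Num.min (2 * M) r).
  have hm : F1 r @[r --> s] --> F1 s by exact: (continuous_max (cc 0) (continuous_min (cc (2 * M)) h)).
  rewrite (_ : F = (fun r => F1 r * F1 r)); last by apply/funext => r; rewrite /F expr2.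
  exact: (cvgM hm hm).
have FL s t : s <= t -> 0 <= F t - F s <= 4 * M * (t - s).
  move=> st; rewrite /F; set a := Num.max 0 (Num.min _ s); set b := Num.max 0 (Num.min _ t).
  have a0 : 0 <= a by rewrite le_max lexx.
  have bM : b <= 2 * M by rewrite ge_max ge_min lexx mulr_ge0.
  have ab : a <= b by rewrite ge_max !le_max lexx /= !le_min !ge_min lexx st !orbT.
  have bats : b - a <= t - s.
    rewrite /a /b; move: st M_ge0; clear; move: M => c st c0.
    by case: (leP (2 * c) s) => ?; case: (leP (2 * c) t) => ?;
      case: (leP 0 (2 * c)) => ?; case: (leP 0 s) => ?; case: (leP 0 t) => ?; lra.
  apply/andP; split; first nra.
  rewrite subr_sqr [leLHS]mulrC.
  apply: (@le_trans _ _ (4 * M * (b - a))).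
    by rewrite ler_wpM2r ?subr_ge0//; lra.
  by rewrite ler_wpM2l// mulr_ge0.
have sM : squeezed (fun t => u t + M) := squeezedD su (squeezed_cont (cont01_cst M)).
have s2 := squeezed_comp cF FL sM.
have := squeezedD s2 (squeezedD (squeezedZ (- (2 * M)) su) (squeezed_cont (cont01_cst (- M ^+ 2)))).
apply: eq_squeezed => t It /=.
have /andP[h1 h2] := uM t It.
rewrite /F min_r; last by lra.
by rewrite max_r; [ring|lra].
Qed.

Lemma squeezedM {u v} : squeezed u -> squeezed v -> squeezed (fun t => u t * v t).
Proof.
move=> su sv.
have := squeezedZ (4^-1) (squeezedB (squeezed_sqr (squeezedD su sv)) (squeezed_sqr (squeezedB su sv))).
by apply: eq_squeezed => t _; field.
Qed.

Lemma Linf_cbmeas_repr f : Linf f -> exists2 g, cbmeas g & pi01 f = pi01 g.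
Proof.
move=> Lf; have [[mr mi] [M fM]] := Lf; pose N := `|M|.
pose clamp (r : R) := Num.max (- N) (Num.min N r).
have cb u : measurable_fun I u -> bmeas (fun t => clamp (u t)).
  move=> mu; split.
    by apply: measurable_maxr (measurable_cst _) _; exact: measurable_minr (measurable_cst _) mu.
  exists N => t _; rewrite ler_norml le_max lexx /= ge_max ge_min lexx andbT.
  by apply: (@le_trans _ _ 0); rewrite ?oppr_le0 normr_ge0.
have cE r : `|r| <= N -> clamp r = r.
  by rewrite ler_norml => /andP[h1 h2]; rewrite /clamp min_r// max_r.
have bg : cbmeas (fun t => clamp (complex.Re (f t)) +i* clamp (complex.Im (f t))).
  by split; exact: cb.
exists (fun t => clamp (complex.Re (f t)) +i* clamp (complex.Im (f t))) => //.
apply: (pi01_ae _ _ Lf (cbmeas_Linf bg)); apply: filterS fM => t h It.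
have hN : Normc.normc (f t) <= N by rewrite (le_trans (h It))// ler_norm.
rewrite !cE; first by case: (f t).
  exact: le_trans (ler_Im_normc _) hN.
exact: le_trans (ler_Re_normc _) hN.
Qed.

Lemma fix_hull_linear (a : R[i]) (S T : BH) : fix_hull V S -> fix_hull V T -> fix_hull V (a *: S + T).
Proof. by move=> hS hT phi cc id; rewrite linearP hS// hT. Qed.

Lemma fix_hull0 : fix_hull V (0 : BH).
Proof. by move=> phi _ _; exact: linear0. Qed.

Lemma fix_hullZ (a : R[i]) (S : BH) : fix_hull V S -> fix_hull V (a *: S).
Proof. by move=> hS; rewrite -[_ *: _]addr0; exact: fix_hull_linear hS fix_hull0. Qed.

Lemma cbmeasZ a {f} : cbmeas f -> cbmeas (fun t => a * f t).
Proof.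
move=> bf; have := cbmeas_lin a bf (_ : cbmeas (fun=> 0)).
have b0 : cbmeas (fun=> 0 : R[i]) by split; exact: bmeas_cst.
move=> /(_ b0); rewrite (_ : (fun t => a * f t + 0) = (fun t => a * f t))//.
by apply/funext => t; rewrite addr0.
Qed.

(** Upper step functions of Re f and of - Re f. *)
Lemma hull_Re_squeezed f : cbmeas f -> fix_hull V (pi01 f) ->
  ae_squeezed (fun t => complex.Re (f t)).
Proof.
move=> bf hf; apply: ae_squeezed_squeeze => e e0.
have e3 : 0 < e / 3 by rewrite divr_gt0.
have [w [sw fw iw]] := hull_upper_step f bf hf _ e3.
have hf' : fix_hull V (pi01 (fun t => -1 * f t)).
  by rewrite (pi01Z (-1) (cbmeas_Linf bf)); exact: fix_hullZ.
have [w' [sw' fw' iw']] := hull_upper_step _ (cbmeasZ (-1) bf) hf' _ e3.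
exists (fun t => - w' t), w; split => //; first exact: squeezedN.
  apply: filterS2 fw fw' => t h1 h2 It; rewrite h1//= andbT.
  by have := h2 It; rewrite mulN1r; case: (f t) => a b /=; rewrite lerNl.
have [bw bw'] : bmeas w /\ bmeas w' by split; exact: squeezed_bmeas.
have E : int01 (fun t => complex.Re (-1 * f t)) = - int01 (fun t => complex.Re (f t)).
  rewrite -int01N; last exact: bf.1.
  by congr int01; apply/funext => t; rewrite mulN1r; case: (f t).
rewrite E in iw'.
rewrite (_ : (fun x => _) = (fun t => w t + w' t)); last by apply/funext => t; rewrite opprK.
rewrite int01D//; move: iw iw'; move: (int01 w) (int01 w') (int01 _).
by move: e e3 e0; clear; move=> e e3 e0 a b c; lra.
Qed.

Lemma fix_hull_riemann (T : BH) : fix_hull V T -> exists2 f, riemann01 f & T = pi01 f.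
Proof.
move=> hT; have [f0 Lf0 T0] := fix_hull_multiplication T hT.
have [f bf f0f] := Linf_cbmeas_repr f0 Lf0; have Tf : T = pi01 f by rewrite T0.
have Lf := cbmeas_Linf bf.
have hf : fix_hull V (pi01 f) by rewrite -Tf.
have [u [su bu uE]] := ae_squeezed_modification _ (hull_Re_squeezed f bf hf).
have hf' : fix_hull V (pi01 (fun t => - 'i * f t)).
  by rewrite (pi01Z (- 'i) Lf); exact: fix_hullZ.
have [v [sv bv vE]] := ae_squeezed_modification _ (hull_Re_squeezed _ (cbmeasZ (- 'i) bf) hf').
exists (fun t => u t +i* v t); first exact/riemann01_squeezed.
have bw : cbmeas (fun t => u t +i* v t) by split; [exact: bu|exact: bv].
rewrite Tf; apply: (pi01_ae _ _ Lf (cbmeas_Linf bw)).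
apply: filterS2 uE vE => t h1 h2 It; rewrite h1// h2//.
by case: (f t) => a b; apply/eqP; rewrite eq_complex /=; apply/andP; split => //; apply/eqP; ring.
Qed.

Lemma riemann_fix_hull f : riemann01 f -> fix_hull V (pi01 f).
Proof.
move=> /riemann01_squeezed[sr si] phi cc idV.
have c1 : continuous01 (fun=> 1 : R[i]) by apply/continuous01P; split; exact: cont01_cst.
have phi1 : phi (pi01 (fun=> 1)) = pi01 (fun=> 1) by apply: idV; exists (fun=> 1).
exact: phi_fix_riemann.
Qed.

Lemma squeezed_cbmeas f : squeezed (fun t => complex.Re (f t)) ->
  squeezed (fun t => complex.Im (f t)) -> cbmeas f.
Proof. by move=> sr si; split; exact: squeezed_bmeas. Qed.

Lemma fix_hull_mul (S T : BH) : fix_hull V S -> fix_hull V T -> fix_hull V (bop_mul S T).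
Proof.
move=> /fix_hull_riemann[f rf ->] /fix_hull_riemann[g rg ->].
have /riemann01_squeezed[fr fi] := rf; have /riemann01_squeezed[gr gi] := rg.
rewrite -(pi01_mul (cbmeas_Linf (squeezed_cbmeas f fr fi)) (cbmeas_Linf (squeezed_cbmeas g gr gi))).
apply: riemann_fix_hull; apply/riemann01_squeezed; split.
  apply: eq_squeezed (squeezedB (squeezedM fr gr) (squeezedM fi gi)) => t _.
  by rewrite cReM.
apply: eq_squeezed (squeezedD (squeezedM fr gi) (squeezedM fi gr)) => t _.
by rewrite cImM.
Qed.

Lemma fix_hull_adjoint (T : BH) : fix_hull V T -> exists2 S, fix_hull V S & is_adjoint T S.
Proof.
move=> /fix_hull_riemann[f rf ->]; have /riemann01_squeezed[fr fi] := rf.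
exists (pi01 (fun t => (f t)^*%C)); last exact: pi01_adjoint (cbmeas_Linf (squeezed_cbmeas f fr fi)).
apply: riemann_fix_hull; apply/riemann01_squeezed; split.
  by apply: eq_squeezed fr => t _; rewrite cReJ.
by apply: eq_squeezed (squeezedN fi) => t _; rewrite cImJ.
Qed.

(** phi T - T = phi (T - S) - (T - S) for S fixed by phi. *)
Lemma fix_hull_closed (T : BH) :
  (forall e : R, 0 < e -> exists2 S, fix_hull V S & (opnorm (T - S)%R < e%:E)%E) -> fix_hull V T.
Proof.
move=> HT phi cc idV; apply: bop_ext => x.
apply/eqP; rewrite -subr_eq0 -(hnorm_eq0 (dot01 R)) eq_le hnorm_ge0 andbT.
apply/ler_addgt0Pr => e e0; rewrite add0r.
pose d := e / (2 * (hn x + 1)).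
have x1 : 0 < hn x + 1 by rewrite ltr_wpDl ?hnorm_ge0.
have d0 : 0 < d by rewrite divr_gt0// mulr_gt0.
have [S hS TS] := HT d d0.
have b1 := opnorm_bound (dot01 R) (T - S) d (ltW d0) (ltW TS).
have b2 := completely_contractive1 _ _ _ _ (ltW d0) cc b1.
have -> : phi T x - T x = phi (T - S)%R x + (- ((T - S)%R x)).
  rewrite linearB (hS phi cc idV) !addbopE !oppbopE; by rewrite opprD opprK addrACA addNr addr0.
apply: le_trans (hnorm_le2 _ _ _ _ (b2 x) _) _.
  by rewrite hnormN; exact: b1.
rewrite /d; apply: (@le_trans _ _ (2 * (e / (2 * (hn x + 1)) * (hn x + 1)))).
  by rewrite ler_wpM2l// ler_wpM2l ?(ltW d0)// lerDl.
by rewrite le_eqVlt; apply/orP; left; apply/eqP; field; rewrite gt_eqF.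
Qed.

End Final.

Theorem corollary4p28 (R : realType) :
  fix_hull (@pi01 R @` @continuous01 R) = @pi01 R @` @riemann01 R /\
  is_Cstar_algebra (fix_hull (@pi01 R @` @continuous01 R)).
Proof.
split.
  apply/seteqP; split => [T /fix_hull_riemann[f rf ->]|_ [f rf <-]]; first by exists f.
  exact: riemann_fix_hull.
split.
- exact: fix_hull0.
- exact: fix_hull_linear.
- exact: fix_hull_mul.
- exact: fix_hull_adjoint.
- exact: fix_hull_closed.
Qed.
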